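(* Let $G$ be an lcsc group which has exact polynomial growth with respect to an adapted metric $d$. Then for every weighted Delone set $\Lambda$ in $G$ which is almost linearly repetitive with respect to $d$ (in particular for every Delone or weighted Delone set that is linearly repetitive with respect to $d$), the hull $\mathcal H_\Lambda$ is minimal and uniquely ergodic.
   Context: lcsc = locally compact second countable; $e$ is the identity, $m_G$ a left Haar measure on $G$. A metric $d$ on $G$ is adapted if it is left-invariant, proper (each ball $B_t=\{g: d(g,e)<t\}$ is relatively compact) and locally bounded (every point has a neighbourhood of finite $d$-diameter); it need not be continuous. Write $B_t(h)=hB_t$. $G$ has exact polynomial growth with respect to $d$ if there are $C>0$, $q\ge0$ with $\lim_{t\to\infty} m_G(B_t)/(Ct^q)=1$. A subset $P\subseteq G$ is Delone if there are a nonempty open relatively compact $U\subseteq G$ with $\#(gU\cap P)\le 1$ for all $g\in G$ and a compact $K\subseteq G$ with $PK=G$. A weighted Delone set is a pair $\Lambda=(P,\alpha)$ with $P$ Delone and $\alpha:P\to[\sigma^{-1},\sigma]$ for some $\sigma\ge1$; Delone sets are weighted Delone sets with weight $1$. $\Lambda$ is identified with the Radon measure $\delta_\Lambda=\sum_{x\in P}\alpha(x)\delta_x$. $G$ acts by $g.(P,\alpha)=(gP,\alpha(g^{-1}\,\cdot))$. The hull $\mathcal H_\Lambda$ is the closure of $\{g.\Lambda:g\in G\}$ in the space of Radon measures with the weak-$*$ topology (tested against $C_c(G)$); it is compact and $G$ acts on it jointly continuously. Minimal: every orbit is dense; uniquely ergodic: there is exactly one $G$-invariant Borel probability measure on $\mathcal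 H_\Lambda$. Fix a continuous adapted metric $d_0$ on $G$ (one always exists) with balls $B^0_\delta(y)$. For relatively compact $S\subseteq G$ and Radon measures $\mu,\nu$ put $d_S(\mu,\nu)=\inf\{\delta>0: |\mu(B^0_\delta(y))-\nu(B^0_\delta(y))|<\delta\ \text{for all } y\in S\cap(\operatorname{supp}\mu\cup\operatorname{supp}\nu)\}$. For relatively compact $S$, the $S$-patch of $\Lambda$ is $(\delta_\Lambda|_S,S)$; patches are equivalent if one is the translate $g.(\mu,S)=(g_*\mu,gS)$ of the other, and a pattern of size $S$ is the equivalence class of a patch whose support is a translate of $S$. For $\delta>0$, the pattern of a patch $(\mu,S)$ $\delta$-occurs in $T\subseteq G$ if there is $g\in G$ with $gS\subseteq T$ and $d_{gS}(g_*\mu,\delta_\Lambda|_{gS})<\delta$; it occurs in $T$ if there is $g\in G$ with $gS\subseteq T$ and $g_*\mu=\delta_\Lambda|_{gS}$. $\Lambda$ is almost linearly repetitive with respect to $d$ if for every $\delta\in(0,1)$ there is $c_\Lambda(\delta)>0$ such that for all $R\ge1$ every pattern of $\Lambda$ of size $B_R$ $\delta$-occurs in $B_{c_\Lambda(\delta)R}(h)$ for all $h\in G$. $\Lambda$ is linearly repetitive with respect to $d$ if there is $c_\Lambda>0$ such that for all $R\ge1$ every pattern of size $B_R$ occurs in $B_{c_\Lambda R}(h)$ for all $h\in G$. *)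

(* Defs.v *)
From HB Require Import structures.
From mathcomp Require Import all_boot all_order all_algebra finmap.
From mathcomp Require Import all_classical all_reals all_analysis measurable_realfun.

Set Implicit Arguments.
Unset Strict Implicit.
Unset Printing Implicit Defensive.

Import Order.TTheory GRing.Theory Num.Theory.
Import numFieldNormedType.Exports.

Local Open Scope classical_set_scope.
Local Open Scope ring_scope.

(* The distinguished point is arbitrary: the library asks for one in order to
   form a measurableType. *)
HB.mixin Record isLCSCGroup G of Group G & PointedTopological G := {
  mulg_continuous : continuous (fun z : G * G => (z.1 * z.2)%g) ;
  invg_continuous : continuous (fun x : G => (x^-1)%g) ;
  lcsc_hausdorff : hausdorff_space G ;
  lcsc_locally_compact : locally_compact [set: G] ;
  lcsc_second_countable : @second_countable G }.

#[short(type="lcscGroupType")]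
HB.structure Definition LCSCGroup :=
  {G of Group G & PointedTopological G & isLCSCGroup G}.

Definition borel (X : ptopologicalType) := g_sigma_algebraType (@open X).
HB.instance Definition _ (X : ptopologicalType) := Measurable.on (borel X).

Definition ltrans (G : lcscGroupType) (g : G) (A : set G) : set G :=
  [set (g * x)%g | x in A].

Section translations.
Variable G : lcscGroupType.
Implicit Types (g h x : G) (A : set G).

Lemma ltransE g A : ltrans g A = (fun x => (g^-1 * x)%g) @^-1` A.
Proof.
apply/seteqP; split=> x /=; first by move=> [y Ay <-]; rewrite mulKg.
by move=> Ax; exists (g^-1 * x)%g => //; rewrite mulVKg.
Qed.

Lemma ltransVE g A : ltrans g^-1%g A = (fun x => (g * x)%g) @^-1` A.
Proof. by rewrite ltransE invgK. Qed.

Lemma lmul_continuous g : continuous (fun x : G => (g * x)%g).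
Proof.
move=> x; apply: (@continuous_comp _ _ _ (fun y : G => (g, y))
  (fun z : G * G => (z.1 * z.2)%g)); last exact: mulg_continuous.
by apply: cvg_pair; [exact: cvg_cst|exact: cvg_id].
Qed.

Lemma lmul_measurable g :
  measurable_fun [set: borel G] (fun x : borel G => (g * x)%g : borel G).
Proof.
apply: (@measurability _ _ (borel G) (borel G) _ _ (@open G)) => //.
move=> _ [U oU <-]; rewrite setTI; apply: sub_sigma_algebra.
by move/continuousP : (@lmul_continuous g); exact.
Qed.

Lemma open_ltrans g A : open A -> open (ltrans g A).
Proof.
by rewrite ltransE; move/continuousP : (@lmul_continuous g^-1%g); exact.
Qed.

Lemma compact_ltrans g A : compact A -> compact (ltrans g A).
Proof.
by apply: continuous_compact; apply: continuous_subspaceT => x;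
  exact: lmul_continuous.
Qed.

Lemma precompact_ltrans g A : precompact A -> precompact (ltrans g A).
Proof.
move=> [K AK [cK _]]; exists (ltrans g K); first by move=> _ [x /AK Kx <-]; exists x.
split; first exact: compact_ltrans.
by apply: compact_closed; [exact: lcsc_hausdorff|exact: compact_ltrans].
Qed.

End translations.

Section radon_measures.
Variables (R : realType) (G : lcscGroupType).
Local Open Scope ereal_scope.

(* Outer regularity on Borel sets is automatic on an lcsc space. Imposed on
   every subset it pins down the values off the Borel sets, which {measure _}
   leaves arbitrary, so that a Radon measure is determined by its values on
   Borel sets and [mu A] is the outer measure of a non-Borel set [A]. *)
Record radon := Radon {
  radon_measure :> {measure set (borel G) -> \bar R} ;
  radon_compact : forall K : set G, compact K -> radon_measure K < +oo ;
  radon_outer : forall A : set G, radon_measure A =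
    ereal_inf [set radon_measure U | U in [set U : set G | open U /\ A `<=` U]] }.

Lemma radon_ext (mu nu : radon) : (forall A, mu A = nu A) -> mu = nu.
Proof.
case: mu nu => [mu c o] [nu c' o'] /= e.
have {}e : mu = nu by apply: eq_measure; apply/funext.
by case: _ / e c' o' => c' o'; congr Radon; exact: Prop_irrelevance.
Qed.

Record test_function := TestFunction {
  test_fun :> G -> R ;
  test_continuous : continuous test_fun ;
  test_support : precompact [set x | test_fun x != 0%R] }.

HB.instance Definition _ := gen_eqMixin test_function.
HB.instance Definition _ := gen_eqMixin radon.
HB.instance Definition _ := gen_choiceMixin radon.

Definition radon_pairing (mu : radon) : prod_topology (fun _ : test_function => R) :=
  fun f => (\int[mu]_x (f x))%R.

HB.instance Definition _ :=
  Topological.copy radon (initial_topology radon_pairing).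

Section action.
Variables (g : G) (mu : radon).

Definition translate_fun (A : set (borel G)) : \bar R :=
  mu ((fun x : G => (g * x)%g) @^-1` A).

Let translate0 : translate_fun set0 = 0.
Proof. by rewrite /translate_fun preimage_set0 measure0. Qed.

Let translate_ge0 A : 0 <= translate_fun A.
Proof. exact: measure_ge0. Qed.

Let translate_sigma_additive : semi_sigma_additive translate_fun.
Proof.
move=> F mF tF mUF; rewrite /translate_fun preimage_bigcup.
apply: measure_semi_sigma_additive.
- by move=> n; rewrite -[X in measurable X]setTI; exact: lmul_measurable.
- apply/trivIsetP => /= i j _ _ ij; rewrite -preimage_setI.
  by move/trivIsetP : tF => /(_ _ _ _ _ ij) ->//; rewrite preimage_set0.
- rewrite -preimage_bigcup -[X in measurable X]setTI; exact: lmul_measurable.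
Qed.

HB.instance Definition _ := isMeasure.Build _ _ _ translate_fun
  translate0 translate_ge0 translate_sigma_additive.

Let translate_compact (K : set G) : compact K -> translate_fun K < +oo.
Proof.
by move=> cK; rewrite /translate_fun -ltransVE; apply: radon_compact;
  exact: compact_ltrans.
Qed.

Let translate_outer (A : set G) : translate_fun A =
  ereal_inf [set translate_fun U | U in [set U : set G | open U /\ A `<=` U]].
Proof.
rewrite /translate_fun radon_outer; congr ereal_inf; apply/seteqP; split.
- move=> _ [U [oU AU] <-]; exists (ltrans g U).
    split; first exact: open_ltrans.
    by rewrite ltransE => x Ax; apply: AU; rewrite /= mulVKg.
  by rewrite -ltransVE; congr (mu _); apply/seteqP; split=> x;
    rewrite ltransVE ltransE /= mulKg.
- move=> _ [U [oU AU] <-]; exists ((fun x => (g * x)%g) @^-1` U) => //.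
  split; first by rewrite -ltransVE; exact: open_ltrans.
  by move=> x /AU.
Qed.

Definition radon_translate : radon := Radon translate_compact translate_outer.

End action.

Definition haar (m : radon) :=
  m [set: G] != 0 /\ forall g, radon_translate g m = m.

End radon_measures.

Arguments radon_translate {R G}.

Section metrics.
Variables (R : realType) (G : lcscGroupType).
Implicit Types (d : G -> G -> R) (h : G).

Record is_metric d : Prop := IsMetric {
  metric_ge0 : forall x y, 0 <= d x y ;
  metric_eq0 : forall x y, d x y = 0 <-> x = y ;
  metric_sym : forall x y, d x y = d y x ;
  metric_triangle : forall x y z, d x z <= d x y + d y z }.

Definition cball d (t : R) : set G := [set g | d g 1%g < t].

Definition cball_at d (t : R) h : set G := ltrans h (cball d t).

Record adapted d : Prop := Adapted {
  adapted_metric : is_metric d ;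
  adapted_left_invariant : forall g x y, d (g * x)%g (g * y)%g = d x y ;
  adapted_proper : forall t, precompact (cball d t) ;
  adapted_locally_bounded : forall x : G, exists2 V : set G, nbhs x V &
    exists M : R, forall y z, V y -> V z -> d y z <= M }.

Definition exact_polynomial_growth (m : radon R G) d :=
  exists C q : R, [/\ 0 < C, 0 <= q &
    (m (cball d t) * ((C * t `^ q)^-1)%:E)%E @[t --> +oo] --> 1%E].

End metrics.

Section delone_sets.
Variables (R : realType) (G : lcscGroupType).

Definition delone (P : set G) :=
  (exists U : set G, [/\ open U, U !=set0, precompact U &
    forall g, is_subset1 (ltrans g U `&` P)]) /\
  (exists2 K : set G, compact K &
    [set (x * k)%g | x in P & k in K] = [set: G]).

(* The values of the weight outside the point set are irrelevant. *)
Record weighted_delone := WeightedDelone {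
  points : set G ;
  weight : G -> R ;
  points_delone : delone points ;
  weight_bounded : exists2 sigma : R, 1 <= sigma &
    forall x, points x -> sigma^-1 <= weight x <= sigma }.

Section translate.
Variables (g : G) (L : weighted_delone).

Let translate_delone : delone (ltrans g (points L)).
Proof.
case: (points_delone L) => -[U [oU U0 pU U1]] [K cK PK]; split.
  exists U; split=> // h _ _ [[u Uu <-] [x Lx ex]] [[v Uv <-] [y Ly ey]].
  rewrite -ex -ey; congr (_ * _)%g; apply: (U1 (g^-1 * h)%g); split=> //.
    by exists u => //; rewrite -mulgA -ex mulKg.
  by exists v => //; rewrite -mulgA -ey mulKg.
exists K => //; apply/seteqP; split=> // z _.
have : [set: G] (g^-1 * z)%g by [].
rewrite -PK => -[x Lx [k Kk e]]; exists (g * x)%g; first by exists x.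
by exists k => //; rewrite -mulgA e mulVKg.
Qed.

Let translate_bounded : exists2 sigma : R, 1 <= sigma &
  forall x, ltrans g (points L) x -> sigma^-1 <= weight L (g^-1 * x)%g <= sigma.
Proof.
case: (weight_bounded L) => s s1 H; exists s => // _ [x Lx <-].
by rewrite mulKg; exact: H.
Qed.

Definition delone_translate := WeightedDelone translate_delone translate_bounded.

End translate.

Section delta.
Variable L : weighted_delone.
Local Open Scope ereal_scope.

Definition delta_fun (A : set (borel G)) : \bar R :=
  \esum_(x in points L `&` A) (weight L x)%:E.

Lemma weight_ge0 x : points L x -> 0 <= (weight L x)%:E.
Proof.
case: (weight_bounded L) => s s1 H /H/andP[+ _]; rewrite lee_fin.
by apply: le_trans; rewrite invr_ge0 (le_trans _ s1).
Qed.

Let delta0 : delta_fun set0 = 0.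
Proof. by rewrite /delta_fun setI0 esum_set0. Qed.

Let delta_ge0 A : 0 <= delta_fun A.
Proof. by apply: esum_ge0 => x [/weight_ge0]. Qed.

Let delta_sigma_additive : semi_sigma_additive delta_fun.
Proof.
move=> F mF tF mUF; rewrite /delta_fun setI_bigcupr.
rewrite (_ : \esum_(_ in _) _ = \sum_(0 <= i <oo) delta_fun (F i)); last first.
  rewrite nneseries_esumT// esum_bigcup//; last by move=> x [i _ [/weight_ge0]].
  apply: sub_trivIset (@subsetT _ _) _.
  by apply/trivIsetP => i j _ _ ij; rewrite setIACA;
    move/trivIsetP : tF => /(_ _ _ I I ij) ->; rewrite setI0.
by apply: is_cvg_nneseries => n _ _; exact: delta_ge0.
Qed.

HB.instance Definition _ := isMeasure.Build _ _ _ delta_fun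
  delta0 delta_ge0 delta_sigma_additive.

Lemma delone_nbhs (x : G) :
  exists V : set G, [/\ open V, V x & is_subset1 (V `&` points L)].
Proof.
case: (points_delone L) => -[U [oU [u Uu] _ U1]] _.
exists (ltrans (x * u^-1)%g U); split=> //; first exact: open_ltrans.
by exists u => //; rewrite -mulgA mulVg mulg1.
Qed.

Lemma delone_finite (K : set G) : compact K -> finite_set (K `&` points L).
Proof.
move=> cK; have /choice[V HV] := delone_nbhs.
move: (cK); rewrite compact_cover => /(_ G [set: G] V).
case=> [x _|x _|D _ KD]; [by case: (HV x)|by exists x => //; case: (HV x)|].
have sub : K `&` points L `<=` \bigcup_(i in [set` D]) (V i `&` points L).
  by move=> x [/KD[i Di Vx] Lx]; exists i.
apply: sub_finite_set sub _; apply: bigcup_finite; first exact: finite_fset.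
move=> i _; case: (HV i) => _ _ H.
have [->|/set0P[y Hy]] := eqVneq (V i `&` points L) set0.
  exact: finite_set0.
have sub1 : V i `&` points L `<=` [set y] by move=> z Hz; exact: H.
exact: sub_finite_set sub1 (finite_set1 y).
Qed.

Let delta_compact (K : set G) : compact K -> delta_fun K < +oo.
Proof.
move=> /delone_finite; rewrite setIC => fK; rewrite /delta_fun esum_fset//.
  by rewrite fsbig_finite//= sumEFin ltry.
by move=> x /set_mem[/weight_ge0].
Qed.

Let delta_subset (A B : set G) : A `<=` B -> delta_fun A <= delta_fun B.
Proof.
move=> AB; apply: le_ereal_sup => _ [F [fF FA] <-]; exists F => //.
by split=> // x /FA[? /AB].
Qed.

Let delta_outer (A : set G) : delta_fun A =
  ereal_inf [set delta_fun U | U in [set U : set G | open U /\ A `<=` U]].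
Proof.
apply/eqP; rewrite eq_le; apply/andP; split.
  by apply: le_ereal_inf_tmp => _ [U [_ AU] <-]; exact: delta_subset.
apply: ereal_inf_lbound; exists (~` (points L `\` A)).
  split; last by move=> x Ax [].
  rewrite openE => x nx; have [V [oV Vx V1]] := delone_nbhs x.
  have clx (y : G) : closed [set y].
    by apply: accessible_closed_set1; apply: hausdorff_accessible;
      exact: lcsc_hausdorff.
  have [[y [Vy LAy]]|nV] := pselect (exists y, (V `&` (points L `\` A)) y).
    rewrite /interior nbhsE; exists (V `&` ~` [set y]).
      split; first by apply: openI => //; apply: closed_openC; exact: clx.
      by split=> // xy; apply: nx; rewrite xy.
    by move=> z [Vz zy] [Lz _]; apply: zy; apply: V1; split=> //; case: LAy.
  rewrite /interior nbhsE; exists V => // z Vz LAz; apply: nV.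
  by exists z.
rewrite /delta_fun; congr esum; apply/seteqP; split=> x [Lx]; last first.
  by move=> Ax; split=> // -[].
by move=> nLA; split=> //; apply: contrapT => nA; apply: nLA.
Qed.

Definition delta_measure : radon R G := Radon delta_compact delta_outer.

End delta.

End delone_sets.

Section action_continuity.
Variables (R : realType) (G : lcscGroupType).
Implicit Types (f : test_function R G) (mu : radon R G).

Lemma pairing_continuous f : continuous (fun mu => radon_pairing mu f).
Proof.
move=> mu; apply: (@continuous_comp _ _ _ (@radon_pairing R G)
  (fun z : prod_topology (fun _ : test_function R G => R) => z f)).
  exact: initial_continuous.
exact: (@proj_continuous (test_function R G) (fun=> R) f).
Qed.

Lemma continuous_pairing (X : topologicalType) (F : X -> radon R G) :
  (forall f, continuous (fun x => radon_pairing (F x) f)) -> continuous F.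
Proof.
move=> cF; apply: (@continuous_comp_initial _ _ _ (@radon_pairing R G) F).
move=> x; apply/cvg_sup => f U [_ [[V oV <-] Vx]] /filterS; apply.
by apply: (cF f x); exact: open_nbhs_nbhs.
Qed.

Lemma test_comp_continuous g f : continuous (fun x : G => f (g * x)%g).
Proof.
move=> x; apply: (@continuous_comp _ _ _ (fun x : G => (g * x)%g) f).
  exact: lmul_continuous.
exact: test_continuous.
Qed.

Lemma test_comp_support g f : precompact [set x : G | f (g * x)%g != 0].
Proof.
rewrite (_ : [set x | _] = ltrans g^-1%g [set x | f x != 0]).
  by apply: precompact_ltrans; exact: test_support.
by rewrite ltransVE.
Qed.

Definition test_comp g f :=
  TestFunction (@test_comp_continuous g f) (@test_comp_support g f).

Lemma test_measurable f : measurable_fun [set: borel G] (f : borel G -> R).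
Proof.
apply: (measurability _ (RGenOpens.measurableE R)).
move=> _ [_ [a [b ->] <-]]; rewrite setTI; apply: sub_sigma_algebra.
by move/continuousP : (@test_continuous _ _ f); apply; exact: interval_open.
Qed.

Lemma pairing_translate g mu f :
  radon_pairing (radon_translate g mu) f = radon_pairing mu (test_comp g f).
Proof.
rewrite /radon_pairing /Rintegral; congr fine.
have /measurable_EFinP mf := @test_measurable f.
pose phi := fun x : borel G => (g * x)%g : borel G.
have mphi : measurable_fun setT phi by exact: lmul_measurable.
have E (h : borel G -> \bar R) : measurable_fun setT h ->
    (forall x, (0 <= h x)%E) ->
    (\int[radon_translate g mu]_x h x = \int[mu]_x (h \o phi) x)%E.
  by move=> mh h0; exact: (ge0_integral_pushforward mphi mu measurableT mh).
rewrite integralE [RHS]integralE; congr (_ - _)%E.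
  rewrite E; [|exact: measurable_funepos|by move=> x; exact: funepos_ge0].
  by rewrite -funepos_comp.
rewrite E; [|exact: measurable_funeneg|by move=> x; exact: funeneg_ge0].
by rewrite -funeneg_comp.
Qed.

Lemma radon_translate_continuous g : continuous (@radon_translate R G g).
Proof.
apply: continuous_pairing => f.
rewrite (_ : (fun mu => _) = (fun mu => radon_pairing mu (test_comp g f))).
  exact: pairing_continuous.
by apply/funext => mu; rewrite pairing_translate.
Qed.

End action_continuity.

Section hull.
Variables (R : realType) (G : lcscGroupType) (L : weighted_delone R G).

Definition hull : set (radon R G) :=
  closure [set delta_measure (delone_translate g L) | g in [set: G]].

Lemma delta_translate g (L' : weighted_delone R G) :
  delta_measure (delone_translate g L') = radon_translate g (delta_measure L').
Proof.
apply: radon_ext => A; rewrite /= /delta_fun /translate_fun /= /delta_fun.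
rewrite [LHS](@reindex_esum _ _ _ (points L' `&` (fun x : G => (g * x)%g) @^-1` A) _
  (fun x : G => (g * x)%g)); last first.
  split.
  - by move=> x [Lx Ax]; split=> //; exists x.
  - by move=> x y _ _; exact: mulgI.
  - by move=> _ [[x Lx <-] Ax]; exists x.
by apply: eq_esum => x _ /=; rewrite mulKg.
Qed.

Lemma hull_translate g mu : hull mu -> hull (radon_translate g mu).
Proof.
move=> Hmu U nU.
have [_ [[h _ <-] Uh]] := Hmu _ (@radon_translate_continuous R G g mu _ nU).
exists (delta_measure (delone_translate (g * h)%g L)); split.
  by exists (g * h)%g.
rewrite delta_translate; move: Uh; rewrite /= delta_translate.
congr U; apply: radon_ext => A; rewrite /= /translate_fun /= /translate_fun.
by congr (delta_fun _ _); apply/seteqP; split=> x /=; rewrite mulgA.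
Qed.

Definition hull_space := set_type hull.

HB.instance Definition _ := Topological.copy hull_space (set_type hull).

Lemma hull_base : hull (delta_measure (delone_translate 1%g L)).
Proof. by apply: subset_closure; exists 1%g. Qed.

HB.instance Definition _ :=
  isPointed.Build hull_space (exist (fun mu => mu \in hull) _ (mem_set hull_base)).

Definition hull_act (g : G) (x : hull_space) : hull_space :=
  exist (fun mu => mu \in hull) (radon_translate g (val x))
    (mem_set (@hull_translate g _ (set_mem (valP x)))).

End hull.

Section dynamics.
Variables (R : realType) (G : lcscGroupType) (X : ptopologicalType).
Variable act : G -> X -> X.

Definition minimal := forall x : X, dense [set act g x | g in [set: G]].

Definition invariant (P : probability (borel X) R) :=
  forall g (A : set (borel X)), measurable A -> P (act g @^-1` A) = P A.

Definition uniquely_ergodic :=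
  exists2 P : probability (borel X) R, invariant P &
    forall Q : probability (borel X) R, invariant Q ->
      forall A : set (borel X), measurable A -> Q A = P A.

End dynamics.

Section patches.
Variables (R : realType) (G : lcscGroupType) (d0 : G -> G -> R).
Variable L : weighted_delone R G.

Definition supp (mu : set G -> \bar R) : set G :=
  [set x | forall U : set G, open U -> U x -> (0 < mu U)%E].

Definition patch_dist (S : set G) (mu nu : set G -> \bar R) : \bar R :=
  ereal_inf [set delta%:E | delta in [set delta : R | 0 < delta /\
    forall y, S y -> (supp mu `|` supp nu) y ->
      (`|mu (cball_at d0 delta y) - nu (cball_at d0 delta y)| < delta%:E)%E]].

(* The balls of an adapted metric need not be Borel, so the measure of a patch
   is kept as a bare set function, defined on all subsets. *)
Record patch := Patch {
  patch_measure : set G -> \bar R ;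
  patch_support : set G }.

Definition restriction (S : set G) : set G -> \bar R :=
  fun A => delta_measure L (A `&` S).

Definition patch_of (S : set G) := Patch (restriction S) S.

Definition patch_translate (g : G) (p : patch) :=
  Patch (fun A => patch_measure p ((fun x => (g * x)%g) @^-1` A))
        (ltrans g (patch_support p)).

Definition pattern (p : patch) : set patch :=
  [set patch_translate g p | g in [set: G]].

Definition pattern_of_size (S : set G) : set (set patch) :=
  [set pattern (patch_of (ltrans h S)) | h in [set: G]].

(* The members (g_* mu, gS) of a pattern are exactly the translates of any of
   its patches (mu, S). *)
Definition almost_occurs (delta : R) (Pi : set patch) (T : set G) :=
  exists p, [/\ Pi p, patch_support p `<=` T &
    (patch_dist (patch_support p) (patch_measure p)
       (restriction (patch_support p)) < delta%:E)%E].

Definition occurs (Pi : set patch) (T : set G) :=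
  exists p, [/\ Pi p, patch_support p `<=` T &
    patch_measure p = restriction (patch_support p)].

Definition almost_linearly_repetitive (d : G -> G -> R) :=
  forall delta : R, 0 < delta < 1 -> exists2 c : R, 0 < c &
    forall r : R, 1 <= r -> forall Pi, pattern_of_size (cball d r) Pi ->
      forall h, almost_occurs delta Pi (cball_at d (c * r) h).

Definition linearly_repetitive (d : G -> G -> R) :=
  exists2 c : R, 0 < c &
    forall r : R, 1 <= r -> forall Pi, pattern_of_size (cball d r) Pi ->
      forall h, occurs Pi (cball_at d (c * r) h).

End patches.

(* Main.v *)
Require Import Defs.
From HB Require Import structures.
From mathcomp Require Import finmap.
From mathcomp Require Import all_boot all_order all_algebra.
From mathcomp Require Import all_classical all_reals all_analysis.
From mathcomp Require Import measurable_realfun.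
From mathcomp Require Import ring lra.

Import Order.TTheory GRing.Theory Num.Theory.
Import numFieldNormedType.Exports.

Local Open Scope classical_set_scope.
Local Open Scope ring_scope.

Set Implicit Arguments.
Unset Strict Implicit.
Unset Printing Implicit Defensive.

(** Write [F y] for the value at [y^-1.Lambda] of a local function [f] with values
    in [0, 1], that is, of a uniformly continuous function of finitely many
    pairings with test functions. A patch that almost recurs after translation by
    [g] gives nearly equal values of [F] at [y] and [g y], away from the boundary
    of the patch ([patch_close], [repetitive_recurrent]).

    Uniqueness. Let [b] be the infimum of the numbers [a] such that, for some
    ball, the averages of [F] over all its translates are at most [a], and let
    [b'] be the same number for [1 - F]. Always [b + b' >= 1]; the heart of the
    proof is the converse ([recurrent_upper_averages]). For a large radius [r],
    some ball of radius [r] has an average of [1 - F] close to [b'] or larger,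
    hence an average of [F] of at most about [1 - b']. By repetitivity this ball
    reappears in every ball of radius about [c r], of which it fills the
    proportion [c^-q] by exact polynomial growth. On the rest of the large ball,
    a double counting argument ([averaging]) bounds the average of [F] by about
    [b]. All averages over balls of radius [c r] are therefore at most about
    [b (1 - c^-q) + (1 - b') c^-q], which cannot be less than [b], so that
    [b <= 1 - b'].

    The integral of [f] against an invariant probability [P] is at most [b]: a
    Riemann sum turns an average of [F] over a ball into a finite combination of
    translates of [f], which is bounded on the hull because it is bounded along
    the orbit ([mean_le_upper_average]). Likewise the integral of [1 - f] against
    an invariant [Q] is at most [b']. The integral against [P] is thus at most
    the integral against [Q], and by symmetry they agree ([invariant_mean_le]).
    Local functions increase to the indicators of finite intersections of
    half-spaces [t < c * mu(phi)]; these form a pi-system that generates the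
    Borel sets of the hull, and [P = Q] follows ([invariant_unique]).

    Existence. The laws of [g.Lambda], for [g] uniform in balls of growing radius,
    have a limit along an ultrafilter as contents on compact sets, and a content
    on a compact Hausdorff space induces a Borel measure. By exact growth, large
    balls are almost invariant under left translations, so the limit is invariant
    ([invariant_law_invariant]).

    Minimality. If [f] is positive at a point of the orbit, recurrence and the
    equicontinuity of the action provide finitely many group elements such that
    every translate of [Lambda] is taken by one of them to a point where [f]
    exceeds a fixed positive number. The sum of the corresponding translates of
    [f] is continuous and bounded below along the orbit, hence on the hull, and
    so every orbit in the hull meets the set where [f] is positive
    ([positive_on_orbits]).

    The hull is compact and Hausdorff. Compactness uses the same construction as
    existence: along an ultrafilter, Radon measures with bounded pairings
    converge to the Radon measure of a content ([radon_bounded_compact]).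
    Countably many test functions separate Radon measures
    ([truncated_cones_separate]), which gives the Hausdorff property and a
    countable base of half-space intersections ([hull_half_spaces_base]). *)

(** * Borel measures from contents *)

Section content.
Local Open Scope ereal_scope.

(** Additivity on disjoint compacts and subadditivity are what survives of a
    measure in a limit along an ultrafilter. *)
Record is_content {R : realType} {X : topologicalType} (lam : set X -> R) := IsContent {
  content_ge0 : forall K, compact K -> (0 <= lam K)%R ;
  content_le : forall K K', compact K -> compact K' -> K `<=` K' ->
    (lam K <= lam K')%R ;
  content_subadd : forall K K', compact K -> compact K' ->
    (lam (K `|` K') <= lam K + lam K')%R ;
  content_add : forall K K', compact K -> compact K' -> K `&` K' = set0 ->
    lam (K `|` K') = (lam K + lam K')%R }.

Context {R : realType} {X : ptopologicalType}.
Implicit Types (A K U V : set X).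

Definition inner_content (lam : set X -> R) U : \bar R :=
  ereal_sup [set (lam K)%:E | K in [set K | compact K /\ K `<=` U]].

Definition outer_content (lam : set X -> R) A : \bar R :=
  ereal_inf [set inner_content lam U | U in [set U | open U /\ A `<=` U]].

(** Separating a set from each point of a compact set separates it from the
    compact set. Applied twice, this separates two compact sets. *)
Let separation_step (A K : set X) :
  compact K ->
  (forall y, K y -> exists U V, [/\ open U, open V, A `<=` U, V y & U `&` V = set0]) ->
  exists U V, [/\ open U, open V, A `<=` U, K `<=` V & U `&` V = set0].
Proof.
move=> cK H.
have /choice[f Hf] : forall y, exists UV : set X * set X, K y ->
    [/\ open UV.1, open UV.2, A `<=` UV.1, UV.2 y & UV.1 `&` UV.2 = set0].
  move=> y; have [Ky|nKy] := pselect (K y); last by exists (setT, setT).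
  by have [U [V ?]] := H _ Ky; exists (U, V).
move: cK; rewrite compact_cover => /(_ X K (fun y => (f y).2)).
case=> [y Ky|y Ky|D DK KD]; [by case: (Hf _ Ky)|by exists y => //; case: (Hf _ Ky)|].
exists (\bigcap_(y in [set` D]) (f y).1), (\bigcup_(y in [set` D]) (f y).2); split=> //.
- rewrite bigcap_fset big_seq; apply: (@big_ind _ (@open X)).
  + exact: openT.
  + exact: openI.
  + by move=> y /DK/set_mem/Hf[].
- by apply: bigcup_open => y /DK/set_mem/Hf[].
- by move=> x Ax y /DK/set_mem/Hf[_ _ + _ _]; exact.
- apply/seteqP; split=> // z [Uz [y Dy Vz]].
  have [_ _ _ _ /seteqP[+ _]] := Hf _ (set_mem (DK _ Dy)).
  by move=> /(_ z); apply; split => //; exact: Uz.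
Qed.

Lemma compact_separation (hX : hausdorff_space X) K K' :
  compact K -> compact K' -> K `&` K' = set0 ->
  exists U V, [/\ open U, open V, K `<=` U, K' `<=` V & U `&` V = set0].
Proof.
move=> cK cK' KK'; apply: separation_step => // y K'y.
have [|U [V [oU oV yU KV UV]]] := @separation_step [set y] K cK.
  move=> x Kx; move: hX; rewrite open_hausdorff => /(_ y x).
  case=> [|[U V] [/set_mem Uy /set_mem Vx] [oU oV /eqP UV]].
    by apply/eqP => yx; have : (K `&` K') y; [split=> //; rewrite yx|rewrite KK'].
  by exists U, V; split=> // _ ->.
by exists V, U; split=> //; [exact: yU|rewrite setIC].
Qed.

(** Subadditivity of the content passes from compact sets to open sets by
    distributing a compact subset of a union over its two members. *)
Lemma compact_split (hX : hausdorff_space X) K U V : compact K ->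
  open U -> open V -> K `<=` U `|` V ->
  exists K1 K2, [/\ compact K1, compact K2, K1 `<=` U, K2 `<=` V & K = K1 `|` K2].
Proof.
move=> cK oU oV KUV.
have [| | |A [B [oA oB KA KB AB]]] := @compact_separation hX (K `\` V) (K `\` U).
- by apply: compact_closedI => //; exact: open_closedC.
- by apply: compact_closedI => //; exact: open_closedC.
- by apply/seteqP; split=> // x [[/KUV[Ux nV|//]] [_ /(_ Ux)]].
exists (K `\` B), (K `\` A); split.
- by apply: compact_closedI => //; exact: open_closedC.
- by apply: compact_closedI => //; exact: open_closedC.
- by move=> x [Kx nB]; apply: contrapT => nU; apply: nB; exact: KB.
- by move=> x [Kx nA]; apply: contrapT => nV; apply: nA; exact: KA.
apply/seteqP; split=> [x Kx|x [[]//|[]//]].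
have [Ax|nAx] := pselect (A x); last by right.
by left; split=> // Bx; have : (A `&` B) x by []; rewrite AB.
Qed.

Context {lam : set X -> R} (Hlam : is_content lam) (hX : hausdorff_space X).
Local Notation inn := (inner_content lam).
Local Notation out := (outer_content lam).

Lemma content0 : lam set0 = 0%R.
Proof.
have := content_add Hlam compact0 compact0 (setI0 set0).
by rewrite setU0; lra.
Qed.

Lemma inner_content_ge K U : compact K -> K `<=` U -> (lam K)%:E <= inn U.
Proof. by move=> cK KU; apply: ereal_sup_ubound; exists K. Qed.

Lemma inner_content_le U (b : \bar R) :
  (forall K, compact K -> K `<=` U -> (lam K)%:E <= b) -> inn U <= b.
Proof. by move=> H; apply: ge_ereal_sup => _ [K [cK KU] <-]; exact: H. Qed.

Lemma inner_content_homo U V : U `<=` V -> inn U <= inn V.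
Proof.
move=> UV; apply: inner_content_le => K cK KU; apply: inner_content_ge => //.
exact: subset_trans KU UV.
Qed.

Lemma inner_content_ge0 U : 0 <= inn U.
Proof.
apply: (le_trans _ (inner_content_ge compact0 (sub0set U))).
by rewrite lee_fin; apply: content_ge0 => //; exact: compact0.
Qed.

Lemma outer_contentE U : open U -> out U = inn U.
Proof.
move=> oU; apply/eqP; rewrite eq_le; apply/andP; split.
  by apply: ereal_inf_lbound; exists U; split.
by apply: le_ereal_inf_tmp => _ [V [oV UV] <-]; exact: inner_content_homo.
Qed.

Lemma outer_content_homo A A' : A `<=` A' -> out A <= out A'.
Proof.
move=> AA'; apply: le_ereal_inf_tmp => _ [V [oV UV] <-].
by apply: ereal_inf_lbound; exists V => //; split => //; exact: subset_trans UV.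
Qed.

Lemma outer_content_ge0 A : 0 <= out A.
Proof. by apply: le_ereal_inf_tmp => _ [V _ <-]; exact: inner_content_ge0. Qed.

Lemma outer_content_compact K : compact K -> (lam K)%:E <= out K.
Proof.
by move=> cK; apply: le_ereal_inf_tmp => _ [V [_ KV] <-]; exact: inner_content_ge.
Qed.

Lemma outer_content_open U A : open U -> A `<=` U -> out A <= inn U.
Proof. by move=> oU AU; rewrite -outer_contentE//; exact: outer_content_homo. Qed.

Let outer_content0 : out set0 = 0.
Proof.
rewrite outer_contentE; last exact: open0.
apply/eqP; rewrite eq_le inner_content_ge0 andbT.
by apply: inner_content_le => K cK; rewrite subset0 => ->; rewrite content0.
Qed.

Let finite_subadditive (F : nat -> set X) (s : seq nat) K :
  (forall i, open (F i)) -> compact K ->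
  K `<=` \bigcup_(i in [set` s]) F i -> (lam K)%:E <= \sum_(i <- s) inn (F i).
Proof.
move=> oF; elim: s K => [|i s IH] K cK.
  by rewrite bigcup0// subset0 => ->; rewrite content0 big_nil.
move=> KF.
have oV : open (\bigcup_(j in [set` s]) F j) by exact: bigcup_open.
have [|K1 [K2 [cK1 cK2 K1U K2V KE]]] := compact_split hX cK (oF i) oV.
  move=> x /KF[j /=]; rewrite inE => /orP[/eqP ->|js] Fjx; first by left.
  by right; exists j.
rewrite big_cons KE; apply: (@le_trans _ _ (lam K1 + lam K2)%:E).
  by rewrite lee_fin; exact: content_subadd.
by rewrite EFinD; apply: leeD; [exact: inner_content_ge|exact: IH].
Qed.

Let inner_sigma_subadditive (F : nat -> set X) : (forall i, open (F i)) ->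
  inn (\bigcup_i F i) <= \sum_(0 <= i <oo) inn (F i).
Proof.
move=> oF; apply: inner_content_le => K cK KF.
move: (cK); rewrite compact_cover => /(_ nat setT F)[||D _ KD] //.
pose N := (\max_(i <- D) i).+1.
apply: (@le_trans _ _ (\sum_(i <- index_iota 0 N) inn (F i))).
  apply: finite_subadditive => // x /KD[i Di Fix]; exists i => //=.
  by rewrite mem_index_iota ltnS/= (@leq_bigmax_seq _ _ xpredT id).
by apply: nneseries_lim_ge => i _ _; exact: inner_content_ge0.
Qed.

Let outer_sigma_subadditive : sigma_subadditive out.
Proof.
move=> F.
have [[i Fi]|] := pselect (exists i, out (F i) = +oo).
  rewrite [leRHS](_ : _ = +oo) ?leey//; apply/eqP; rewrite -leye_eq -Fi.
  apply: le_trans (@nneseries_lim_ge _ _ xpredT 0 i.+1 _).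
    by rewrite big_nat_recr//= leeDr// sume_ge0// => *; exact: outer_content_ge0.
  by move=> *; exact: outer_content_ge0.
move=> /forallNP Ffin; apply/lee_addgt0Pr => e e0.
apply: (le_trans _ (epsilon_trick _ _ _)); last 2 first.
- by move=> *; exact: outer_content_ge0.
- exact: ltW.
have /choice[V HV] : forall i, exists V, [/\ open V, F i `<=` V &
    inn V <= out (F i) + (e / (2 ^ i.+1)%:R)%:E].
  move=> i; have e'0 : (0 < e / (2 ^ i.+1)%:R)%R.
    by rewrite divr_gt0// ltr0n expn_gt0.
  have [|x [V [oV FV] <-] Vlt] := @lb_ereal_inf_adherent _
    [set inn U | U in [set U | open U /\ F i `<=` U]] _ e'0.
    rewrite ge0_fin_numE ?ltey; last exact: outer_content_ge0.
    by apply/eqP; exact: Ffin.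
  by exists V; split => //; exact: ltW.
have oV i : open (V i) by case: (HV i).
apply: (@le_trans _ _ (inn (\bigcup_i V i))).
  apply: outer_content_open; first exact: bigcup_open.
  by move=> x [i _ Fix]; exists i => //; case: (HV i) => _ + _; exact.
apply: le_trans (inner_sigma_subadditive oV) _.
apply: lee_nneseries => [i _ _|i _]; first exact: inner_content_ge0.
by case: (HV i).
Qed.

HB.instance Definition _ := isOuterMeasure.Build R X out
  outer_content0 outer_content_ge0 outer_content_homo outer_sigma_subadditive.

(** A compact part of [V `&` U] leaves room in [V] for an open neighbourhood of
    what lies outside [U], and disjoint additivity adds up the two masses. *)
Let open_caratheodory U : open U -> out.-caratheodory U.
Proof.
move=> oU; apply: le_caratheodory_measurable => A.
apply: le_ereal_inf_tmp => _ [V [oV AV] <-].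
apply: (@le_trans _ _ (inn (V `&` U) + out (A `&` ~` U))).
  apply: leeD2r; apply: outer_content_open; first exact: openI.
  exact: setSI.
suff H K : compact K -> K `<=` V `&` U -> (lam K)%:E + out (A `&` ~` U) <= inn V.
  have := outer_content_ge0 (A `&` ~` U).
  case E : (out (A `&` ~` U)) => [r| |] // _.
    rewrite -leeBrDr//; apply: inner_content_le => K cK KV.
    by rewrite leeBrDr// -E; exact: H.
  have := H set0 compact0 (sub0set _).
  by rewrite E content0 add0e leye_eq => /eqP ->; exact: leey.
move=> cK KVU.
have oW : open (V `&` ~` K) by apply: openI => //; apply: closed_openC; exact: compact_closed.
apply: (@le_trans _ _ ((lam K)%:E + inn (V `&` ~` K))).
  apply: leeD2l; apply: outer_content_open => // x [Ax nUx].
  by split; [exact: AV|move=> /KVU[]].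
rewrite -leeBrDl//; apply: inner_content_le => K' cK' K'V.
rewrite leeBrDl// -EFinD -(content_add Hlam)//; last first.
  by apply/seteqP; split=> // x [Kx /K'V[]].
apply: inner_content_ge; first exact: compactU.
by move=> x [/KVU[]|/K'V[]].
Qed.

Let borel_caratheodory (A : set (borel X)) : measurable A ->
  out.-cara.-measurable A.
Proof.
apply: smallest_sub; first exact: sigma_algebra_measurable.
by move=> U oU; exact: open_caratheodory.
Qed.

Let borel_sigma_additive : semi_sigma_additive (out : set (borel X) -> \bar R).
Proof.
move=> F mF tF mUF; apply: (@caratheodory_measure_sigma_additive R X out) => //.
  by move=> i; exact: borel_caratheodory.
exact: borel_caratheodory.
Qed.

(** The set function does not mention the two proofs; they are arguments so
    that the measure structure, which needs them, can be inferred. *)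
Definition content_measure (_ : is_content lam) (_ : hausdorff_space X) :
  set (borel X) -> \bar R := out.

HB.instance Definition _ := isMeasure.Build _ _ _ (content_measure Hlam hX)
  outer_content0 outer_content_ge0 borel_sigma_additive.

End content.

(** * Limits along ultrafilters *)

Section borel_sets.
Context {X : ptopologicalType}.

Lemma borel_open (U : set X) : open U -> measurable (U : set (borel X)).
Proof. by move=> oU; apply: sub_sigma_algebra. Qed.

Lemma borel_closed (A : set X) : closed A -> measurable (A : set (borel X)).
Proof.
move=> cA; rewrite -[A]setCK; apply: measurableC.
by apply: borel_open; exact: closed_openC.
Qed.

Lemma borel_compact (K : set X) : hausdorff_space X -> compact K ->
  measurable (K : set (borel X)).
Proof. by move=> hX cK; apply: borel_closed; exact: compact_closed. Qed.

End borel_sets.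

Section ultralimits.
Context {R : realType} {I : Type} {F : set_system I} (FU : UltraFilter F).

Lemma ultra_bounded_cvg (u : I -> R) (C : R) :
  F [set i | `|u i| <= C] -> cvg (u @ F).
Proof.
move=> uC; have FF := @ultra_proper _ _ FU.
have uF : F (u @^-1` `[- C, C]%classic).
  by apply: filterS uC => i /=; rewrite ler_norml in_itv.
have [p [_ clp]] := @segment_compact R (- C) C (u @ F) _ uF.
apply/cvg_ex; exists p => N Np.
have [//|FN] := in_ultra_setVsetC (u @^-1` N) FU.
by have [x [nNx Nx]] := clp _ _ (FN : (u @ F) (~` N)) Np.
Qed.

Lemma ultra_le_lim (u v : I -> R) : cvg (u @ F) -> cvg (v @ F) ->
  F [set i | u i <= v i] -> lim (u @ F) <= lim (v @ F).
Proof.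
have FF := @ultra_proper _ _ FU.
move=> cu cv uv; rewrite -subr_ge0 -limB//; apply: limr_ge.
  exact: (is_cvgB cv cu).
by apply: filterS uv => i /=; rewrite subr_ge0.
Qed.

Lemma measure_content (X : ptopologicalType) (hX : hausdorff_space X)
    (mu : {measure set (borel X) -> \bar R}) :
  (forall K, compact K -> (mu K < +oo)%E) -> is_content (fun K => fine (mu K)).
Proof.
move=> fin.
have mK K : compact K -> measurable (K : set (borel X)) := @borel_compact _ _ hX.
have fK K : compact K -> mu K \is a fin_num.
  by move=> cK; rewrite ge0_fin_numE//; exact: fin.
split=> [K _|K K' cK cK' KK'|K K' cK cK'|K K' cK cK' KK'].
- exact/fine_ge0/measure_ge0.
- by rewrite fine_le ?fK// le_measure ?inE//; exact: mK.
- rewrite -fineD ?fK// fine_le ?fK//; first exact: compactU.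
    by rewrite fin_numD !fK.
  by apply: measureU2; exact: mK.
- by rewrite -fineD ?fK//; congr fine; rewrite measureU//; exact: mK.
Qed.

(** Countable additivity is lost in such a limit, the axioms of a content are
    not: they are closed conditions on finitely many values. *)
Lemma ultralimit_content (X : ptopologicalType) (lam : I -> set X -> R) :
  (forall i, is_content (lam i)) ->
  (forall K, compact K -> exists C, F [set i | lam i K <= C]) ->
  (forall K, compact K -> cvg (lam i K @[i --> F])) /\
  is_content (fun K => lim (lam i K @[i --> F])).
Proof.
move=> Hlam bnd; have FF := @ultra_proper _ _ FU.
have cv K : compact K -> cvg (lam i K @[i --> F]).
  move=> cK; have [C FC] := bnd _ cK; apply: (@ultra_bounded_cvg _ C).
  by apply: filterS FC => i /= ?; rewrite ger0_norm//; exact: content_ge0.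
split=> //; split=> [K cK|K K' cK cK' KK'|K K' cK cK'|K K' cK cK' KK'].
- by apply: limr_ge; [exact: cv|apply: nearW => i; exact: content_ge0].
- apply: ultra_le_lim; [exact: cv|exact: cv|].
  by apply: nearW => i; exact: content_le.
- have cKK' := compactU cK cK'.
  rewrite -limD; [|exact: cv|exact: cv].
  apply: ultra_le_lim; [exact: cv|exact: (is_cvgD (cv _ cK) (cv _ cK'))|].
  by apply: nearW => i; exact: content_subadd.
- rewrite -limD; [|exact: cv|exact: cv].
  by congr (lim (_ @ F)); apply/funext => i /=; exact: content_add.
Qed.

End ultralimits.

(** * Adapted metrics *)

Section adapted_metric.
Context {R : realType} {G : lcscGroupType} {d : G -> G -> R} (ad : adapted d).

Let md := adapted_metric ad.

Lemma adapted_dist0 x : d x x = 0.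
Proof. by apply/(Defs.metric_eq0 md). Qed.

Lemma adapted_le_size x y : d x 1%g <= d x y + d y 1%g.
Proof. exact: (Defs.metric_triangle md). Qed.

Lemma adapted_size_mul x y : d (x * y)%g 1%g <= d x 1%g + d y 1%g.
Proof.
apply: le_trans (adapted_le_size _ x) _.
by rewrite -{2}(mulg1 x) (adapted_left_invariant ad) addrC.
Qed.

Lemma adapted_size_inv x : d x^-1%g 1%g = d x 1%g.
Proof.
by rewrite -(adapted_left_invariant ad x) mulgV mulg1 (Defs.metric_sym md).
Qed.

(** An adapted metric need not be continuous: local boundedness is what makes
    compact sets bounded. *)
Lemma compact_adapted_bounded (K : set G) : compact K ->
  exists2 t : R, 0 < t & K `<=` cball d t.
Proof.
move=> /compact_near_coveringP/(_ R (+oo : set_system R) (fun t x => d x 1%g < t)) [].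
  move=> x _; have [V nV [M HM]] := adapted_locally_bounded ad x.
  exists (V, [set t | M + d x 1%g < t]).
    by split=> //; apply: nbhs_pinfty_gt; exact: num_real.
  move=> [y t] [/= Vy tM]; apply: le_lt_trans tM.
  apply: le_trans (adapted_le_size _ x) _; rewrite lerD2r; apply: HM => //.
  exact: nbhs_singleton.
move=> t0 [_ H]; have := normr_ge0 t0; have := ler_norm t0 => t0n n0.
exists (`|t0| + 1); first by lra.
by move=> x Kx; apply: H => //=; lra.
Qed.

End adapted_metric.

Section continuous_metric.
Context {R : realType} {G : lcscGroupType} {d0 : G -> G -> R}.
Context (ad : adapted d0) (cd : continuous (fun z : G * G => d0 z.1 z.2)).

Let md := adapted_metric ad.

Lemma metric_continuousr y : continuous (fun x => d0 x y).
Proof.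
move=> x; apply: (@continuous_comp _ _ _ (fun x : G => (x, y))
  (fun z : G * G => d0 z.1 z.2)); last exact: cd.
by apply: cvg_pair; [exact: cvg_id|exact: cvg_cst].
Qed.

Lemma closed_metric_ball t : closed [set x | d0 x 1%g <= t].
Proof.
apply: (@preimage_closed _ _ (fun x => d0 x 1%g) [set r | r <= t]).
  by move=> x _; exact: metric_continuousr.
exact: closed_le.
Qed.

Lemma compact_metric_ball t : compact [set x | d0 x 1%g <= t].
Proof.
rewrite -precompact_closed; last exact: closed_metric_ball.
apply: precompact_subset (adapted_proper ad (t + 1)) => x /= xt.
by rewrite /cball /=; lra.
Qed.

Lemma open_metric_ball t x : open [set y | d0 y x < t].
Proof.
apply: (@open_comp _ _ (fun y => d0 y x) [set r | r < t]).
  by move=> y _; exact: metric_continuousr.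
exact: open_lt.
Qed.

(** Closed balls are compact and shrink to the identity, so a continuous proper
    metric induces the topology. *)
Lemma metric_ball_basis (V : set G) : nbhs 1%g V ->
  exists2 e : R, 0 < e & forall x, d0 x 1%g < e -> V x.
Proof.
move=> nV; pose K := [set x | d0 x 1%g <= 1] `&` ~` V°.
have cK : compact K.
  by apply: compact_closedI; [exact: compact_metric_ball|exact/open_closedC/open_interior].
have /compact_near_coveringP/(_ R 0^'+ (fun t x => t < d0 x 1%g))[] := cK.
  move=> x [_ nVx]; have dx : 0 < d0 x 1%g.
    rewrite lt_neqAle (Defs.metric_ge0 md) andbT; apply/eqP => /esym/(Defs.metric_eq0 md) x1.
    by apply: nVx; rewrite x1.
  exists ([set y | d0 x 1%g / 2 < d0 y 1%g], [set t | t < d0 x 1%g / 2]).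
    split=> /=; last by apply: nbhs_right_lt; lra.
    apply: (@metric_continuousr 1%g x [set r | d0 x 1%g / 2 < r]).
    by apply: lt_nbhsr; lra.
  by move=> [y t] [/= ? ?]; lra.
move=> e /= e0 H; exists (Num.min 1 (e / 2)); first by rewrite lt_min ltr01 divr_gt0.
move=> x; rewrite lt_min => /andP[x1 xe]; apply: contrapT => nVx.
have := H (e / 2); rewrite /= sub0r normrN ger0_norm; last by rewrite divr_ge0// ltW.
move=> /(_ _ _ x); rewrite /K/= => /(_ _ _ _) H'.
suff : e / 2 < d0 x 1%g by lra.
apply: H'; [by lra|by lra|split; [by lra|]].
by move=> /interior_subset.
Qed.

(** A test function equal to 1 on a ball, which serves as the majorant in the
    estimates that follow. *)
Definition plateau_fun (t : R) (x : G) : R := Num.max 0 (Num.min 1 (t + 1 - d0 x 1%g)).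

Let plateau_continuous t : continuous (plateau_fun t).
Proof.
move=> x; apply: (@continuous_max R G (fun=> 0)); first exact: cvg_cst.
apply: (@continuous_min R G (fun=> 1)); first exact: cvg_cst.
by apply: cvgB; [exact: cvg_cst|exact: metric_continuousr].
Qed.

Let plateau_support t : precompact [set x | plateau_fun t x != 0].
Proof.
apply: precompact_subset (adapted_proper ad (t + 1)) => x /=.
rewrite /cball/= /plateau_fun; case: (ltP (d0 x 1%g) (t + 1)) => // H.
by rewrite (max_idPl _) ?eqxx// ge_min; apply/orP; right; lra.
Qed.

Definition plateau t : test_function R G :=
  TestFunction (@plateau_continuous t) (plateau_support t).
Arguments plateau : simpl never.

Lemma plateau_ge0 t x : 0 <= plateau t x.
Proof. by rewrite /plateau/= /plateau_fun le_max lexx. Qed.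

Lemma plateau1 t x : d0 x 1%g <= t -> plateau t x = 1.
Proof. by move=> xt; rewrite /plateau/= /plateau_fun (min_idPl _) ?(max_idPr _)//; lra. Qed.

Lemma test_function_bounded_support (f : test_function R G) :
  exists2 t : R, 0 < t & forall x, f x != 0 -> d0 x 1%g < t.
Proof.
have [K fK [cK _]] := @test_support _ _ f.
have [t t0 Kt] := compact_adapted_bounded ad cK.
by exists t => // x fx; apply: Kt; exact: fK.
Qed.

(** Uniform continuity, with the bound written as a multiple of a test function
    so that it can be integrated against any Radon measure. *)
Lemma test_function_uniform_left (f : test_function R G) (t e : R) :
  (forall x, f x != 0 -> d0 x 1%g < t) -> 0 < e ->
  \forall v \near (1%g : G), forall x, `|f (v * x)%g - f x| <= e * plateau (t + 1) x.
Proof.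
move=> ft e0.
have /compact_near_coveringP := @compact_metric_ball (t + 1).
move=> /(_ G (nbhs (1%g : G)) (fun v x => `|f (v * x)%g - f x| < e)) near_cover.
have {}near_cover : \forall v \near (1%g : G), forall x, d0 x 1%g <= t + 1 ->
    `|f (v * x)%g - f x| < e.
  apply: near_cover => x _.
  pose h (z : G * G) := f (z.2 * z.1)%g - f z.1.
  have ch : {for (x, 1%g), continuous h}.
    apply: cvgB.
      apply: (@continuous_comp _ _ _ (fun z : G * G => (z.2 * z.1)%g) f).
        apply: (@continuous_comp _ _ _ (fun z : G * G => (z.2, z.1))
           (fun z : G * G => (z.1 * z.2)%g)); last exact: mulg_continuous.
        by apply: cvg_pair; [exact: cvg_snd|exact: cvg_fst].
      exact: test_continuous.
    apply: (@continuous_comp _ _ _ (fun z : G * G => z.1) f); first exact: cvg_fst.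
    exact: test_continuous.
  have : nbhs (h (x, 1%g)) [set r | `|r| < e].
    rewrite /h /= mul1g subrr.
    by apply/nbhs_ballP; exists e => //= r; rewrite /ball/= sub0r normrN.
  exact: ch.
near=> v => x.
have [xt|xt] := leP (d0 x 1%g) (t + 1).
  rewrite plateau1// mulr1; apply: ltW; move: x xt.
  by near: v.
have v1 : d0 v 1%g < 1.
  near: v; apply: open_nbhs_nbhs; split; first exact: open_metric_ball.
  by rewrite /= (adapted_dist0 ad).
have [->|] := eqVneq (f x) 0; last by move=> /ft; lra.
have [->|] := eqVneq (f (v * x)%g) 0.
  by rewrite subrr normr0 mulr_ge0 ?plateau_ge0// ltW.
move=> /ft vx; have := adapted_size_mul ad v^-1%g (v * x)%g.
by rewrite mulKg adapted_size_inv//; lra.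
Unshelve. all: by end_near. Qed.

Lemma test_function_uniform_right (f : test_function R G) (t e : R) :
  (forall x, f x != 0 -> d0 x 1%g < t) -> 0 < e ->
  exists2 r : R, 0 < r & forall x y, d0 x y < r ->
    `|f y - f x| <= e * plateau (t + 1) x.
Proof.
move=> ft e0.
have /compact_near_coveringP := @compact_metric_ball (t + 1).
move=> /(_ G (nbhs (1%g : G)) (fun v x => `|f (x * v)%g - f x| < e)) near_cover.
have {}near_cover : \forall v \near (1%g : G), forall x, d0 x 1%g <= t + 1 ->
    `|f (x * v)%g - f x| < e.
  apply: near_cover => x _.
  pose h (z : G * G) := f (z.1 * z.2)%g - f z.1.
  have ch : {for (x, 1%g), continuous h}.
    apply: cvgB.
      apply: (@continuous_comp _ _ _ (fun z : G * G => (z.1 * z.2)%g) f).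
        exact: mulg_continuous.
      exact: test_continuous.
    apply: (@continuous_comp _ _ _ (fun z : G * G => z.1) f); first exact: cvg_fst.
    exact: test_continuous.
  have : nbhs (h (x, 1%g)) [set r | `|r| < e].
    rewrite /h /= mulg1 subrr.
    by apply/nbhs_ballP; exists e => //= r; rewrite /ball/= sub0r normrN.
  exact: ch.
have [r r0 Hr] := metric_ball_basis near_cover.
exists (Num.min 1 r); first by rewrite lt_min ltr01.
move=> x y; rewrite lt_min => /andP[xy1 xyr].
have [xt|xt] := leP (d0 x 1%g) (t + 1).
  rewrite plateau1// mulr1; apply: ltW; rewrite -(mulVKg x y); apply: Hr => //.
  by rewrite -(adapted_left_invariant ad x) mulVKg mulg1 (Defs.metric_sym md).
have [->|] := eqVneq (f x) 0; last by move=> /ft; lra.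
have [->|] := eqVneq (f y) 0.
  by rewrite subrr normr0 mulr_ge0 ?plateau_ge0// ltW.
by move=> /ft yt; have := adapted_le_size ad x y; lra.
Qed.

End continuous_metric.

(** * Integration of test functions *)

Section radon_integration.
Context {R : realType} {G : lcscGroupType}.
Implicit Types (mu nu : radon R G) (f g h : test_function R G).

Lemma test_function_bounded f : exists2 M : R, 0 <= M & forall x, `|f x| <= M.
Proof.
have [K fK [cK _]] := @test_support _ _ f.
have cf : compact (f @` K).
  by apply: continuous_compact => //; apply: continuous_subspaceT; exact: test_continuous.
have [M [_ /(_ (`|M| + 1))]] := compact_bounded cf.
rewrite (le_lt_trans (ler_norm _)) ?ltrDl// => /(_ isT) HM.
exists (`|M| + 1) => // x; have [->|fx] := eqVneq (f x) 0; first by rewrite normr0.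
by apply: HM; exists x => //; exact: fK.
Qed.

Lemma test_function_integrable mu f :
  mu.-integrable [set: borel G] (EFin \o (f : borel G -> R)).
Proof.
have [M M0 HM] := test_function_bounded f.
have [K fK [cK _]] := @test_support _ _ f.
have mK := borel_compact (@lcsc_hausdorff G) cK.
apply/integrableP; split; first by apply/measurable_EFinP; exact: test_measurable.
apply: (@le_lt_trans _ _ (\int[mu]_(x in [set: borel G]) (M * \1_K x)%:E)%E).
  apply: ge0_le_integral => //.
  - by apply: (@measurableT_comp _ _ _ _ _ _ abse) => //; apply/measurable_EFinP; exact: test_measurable.
  - by apply/measurable_EFinP; apply: measurable_funM => //; exact: measurable_indic.
  move=> x _ /=; rewrite lee_fin indicE; case: (boolP (x \in K)) => xK.
    by rewrite mulr1.
  have [->|fx] := eqVneq (f x) 0; first by rewrite normr0 mulr0.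
  by move: xK; rewrite mem_set//; exact: fK.
under eq_integral do rewrite EFinM.
rewrite ge0_integralZl//; last by apply/measurable_EFinP; exact: measurable_indic.
rewrite integral_indic// setIT lte_mul_pinfty//; exact: radon_compact.
Qed.

Lemma pairing_ge0 mu f : (forall x, 0 <= f x) -> 0 <= radon_pairing mu f.
Proof. by move=> f0; apply: Rintegral_ge0 => //. Qed.

(** The form in which uniform continuity of test functions is used: a plateau
    function [h] carries the bound to all measures at once. *)
Lemma pairing_close mu f g h e : (forall x, `|f x - g x| <= e * h x) ->
  `|radon_pairing mu f - radon_pairing mu g| <= e * radon_pairing mu h.
Proof.
move=> H; have If := test_function_integrable mu.
rewrite /radon_pairing -RintegralB// -RintegralZl//.
have IB : mu.-integrable [set: borel G] (EFin \o (fun x : borel G => f x - g x)).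
  rewrite (_ : _ \o _ = (EFin \o (f : borel G -> R)) \- (EFin \o (g : borel G -> R)))%E//.
  by apply: integrableB.
have IZ : mu.-integrable [set: borel G] (EFin \o (fun x : borel G => e * h x)).
  by rewrite (_ : _ \o _ = fun x => (e%:E * (EFin \o (h : borel G -> R)) x)%E)//; exact: integrableZl.
apply: le_trans (le_normr_Rintegral _ _) _ => //.
apply: le_Rintegral => //.
exact: (integrable_abse IB).
Qed.

Lemma EFin_pairing mu f :
  (radon_pairing mu f)%:E = (\int[mu]_(x in [set: borel G]) (f x)%:E)%E.
Proof. by rewrite fineK//; exact: integrable_fin_num (test_function_integrable mu f). Qed.

End radon_integration.

(** * Countably many test functions separate Radon measures *)

Section separating_family.
Context {R : realType} {G : lcscGroupType} {d0 : G -> G -> R}.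
Context (ad : adapted d0) (cd : continuous (fun z : G * G => d0 z.1 z.2)).

Let md := adapted_metric ad.

Lemma metric_ball_nbhs x (V : set G) : nbhs x V ->
  exists2 e : R, 0 < e & forall y, d0 x y < e -> V y.
Proof.
move=> nV; have nV1 : nbhs 1%g ((fun y => (x * y)%g) @^-1` V).
  by apply: lmul_continuous; rewrite mulg1.
have [e e0 He] := metric_ball_basis ad cd nV1.
exists e => // y xy; rewrite -(mulVKg x y); apply: He.
by rewrite -(adapted_left_invariant ad x) mulVKg mulg1 (Defs.metric_sym md).
Qed.

Lemma exists_dense_sequence : exists p : nat -> G,
  forall x (e : R), 0 < e -> exists i, d0 (p i) x < e.
Proof.
have [B cB [oB nB]] := @lcsc_second_countable G.
have /countable_injP[c cinj] := cB.
have /choice[p Hp] : forall n, exists y : G, forall U, B U -> c U = n -> U !=set0 -> U y.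
  move=> n; have [[U [BU cU [y Uy]]]|H] := pselect (exists U, [/\ B U, c U = n & U !=set0]).
    exists y => V BV cV _; suff -> : V = U by [].
    by apply: cinj; rewrite ?inE// cU.
  by exists point => U BU cU U0; exfalso; apply: H; exists U.
exists p => x e e0.
have nx : nbhs x [set y | d0 y x < e].
  apply: open_nbhs_nbhs; split; first exact: open_metric_ball.
  by rewrite /= (adapted_dist0 ad).
have [U [BU Ux] Ue] := nB x _ nx; exists (c U); apply: Ue.
by apply: Hp => //; exists x.
Qed.

Definition cone (a : G) (r : R) (x : G) : R := Num.max 0 (r - d0 x a).

Lemma cone_ge0 a r x : 0 <= cone a r x.
Proof. by rewrite /cone le_max lexx. Qed.

Lemma cone_gt0 a r x : (0 < cone a r x) = (d0 x a < r).
Proof. by rewrite /cone lt_max ltxx/= subr_gt0. Qed.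

Lemma cone_continuous a r : continuous (cone a r).
Proof.
move=> x; apply: (@continuous_max R G (fun=> 0)); first exact: cvg_cst.
by apply: cvgB; [exact: cvg_cst|exact: metric_continuousr].
Qed.

Context (p : nat -> G).

(** Multiples of finite sums of cones with centres in the sequence [p], cut off
    at 1. There are countably many, and they approximate indicators of open
    sets from below. *)
Definition truncated_cones_fun (t : seq (nat * nat) * nat) (x : G) : R :=
  Num.min 1 (t.2%:R * \sum_(j <- t.1) cone (p j.1) (j.2.+1%:R^-1) x).

Let truncated_cones_continuous t : continuous (truncated_cones_fun t).
Proof.
move=> x; apply: (@continuous_min R G (fun=> 1)); first exact: cvg_cst.
apply: cvgM; first exact: cvg_cst.
elim: t.1 => [|j s IH].
  by under eq_fun do rewrite big_nil; rewrite big_nil; exact: cvg_cst.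
under eq_fun do rewrite big_cons.
by rewrite big_cons; apply: cvgD => //; exact: cone_continuous.
Qed.

Let truncated_cones_support t : precompact [set x | truncated_cones_fun t x != 0].
Proof.
apply: (@precompact_subset _ _ (\bigcup_(j in [set` t.1]) [set x | d0 x 1%g <= j.2.+1%:R^-1 + d0 (p j.1) 1%g])).
  move=> x /= H; apply: contrapT => nx; move/eqP : H; apply.
  rewrite /truncated_cones_fun big_seq big1 ?mulr0 ?(min_idPr _)// => j jt.
  apply/eqP; rewrite eq_le cone_ge0 andbT leNgt cone_gt0; apply/negP => xj.
  apply: nx; exists j => //=.
  by apply: le_trans (adapted_le_size ad _ (p j.1)) _; rewrite lerD2r ltW.
rewrite precompact_closed.
  by rewrite bigcup_seq; apply: bigsetU_compact => j _; exact: compact_metric_ball.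
by rewrite bigcup_seq; apply: big_ind => [|A B|j _]; [exact: closed0|exact: closedU|exact: closed_metric_ball].
Qed.

Definition truncated_cones t : test_function R G :=
  TestFunction (@truncated_cones_continuous t) (truncated_cones_support t).

Hypothesis pdense : forall x (e : R), 0 < e -> exists i, d0 (p i) x < e.

(** An open set is the union of the balls in it that have a centre in the dense
    sequence and radius [1/k]; adding up cones over more and more of them, with
    growing factors, gives an increasing sequence with limit the indicator. The
    sequence does not depend on the measure, so that the values on the countable
    family determine the measure of every open set. *)
Lemma radon_open_limit (U : set G) : open U ->
  exists t : nat -> seq (nat * nat) * nat, forall mu : radon R G,
    (radon_pairing mu (truncated_cones (t n)))%:E @[n --> \oo] --> mu U.
Proof.
move=> oU.
pose inU (j : nat * nat) := `[< forall y, d0 y (p j.1) < j.2.+1%:R^-1 -> U y >].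
pose s n : seq (nat * nat) := [seq j <- pmap (@choice.unpickle _) (iota 0 n) | inU j].
exists (fun n => (s n, n)) => mu.
have homo x n m : (n <= m)%N -> truncated_cones (s n, n) x <= truncated_cones (s m, m) x.
  move=> nm; rewrite /truncated_cones/= /truncated_cones_fun/=.
  have sum_ge0 k : 0 <= \sum_(j <- s k) cone (p j.1) j.2.+1%:R^-1 x.
    by apply: sumr_ge0 => *; exact: cone_ge0.
  rewrite le_min ge_min lexx/= ge_min; apply/orP; right.
  apply: ler_pM => //; first by rewrite ler_nat.
  rewrite -(subnKC nm) /s iotaD pmap_cat filter_cat big_cat/= lerDl.
  by apply: sumr_ge0 => *; exact: cone_ge0.
have ge0 n x : 0 <= truncated_cones (s n, n) x.
  rewrite /truncated_cones/= /truncated_cones_fun/= le_min ler01/= mulr_ge0//.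
  by apply: sumr_ge0 => *; exact: cone_ge0.
have cvgU x : (truncated_cones (s n, n) x)%:E @[n --> \oo] --> ((\1_U x)%:E : \bar R).
  apply/cvg_EFin; first by near=> n.
  have [Ux|nUx] := pselect (U x); last first.
    rewrite indicE memNset//=.
    apply: cvg_near_cst; apply: nearW => n.
    rewrite /truncated_cones/= /truncated_cones_fun/= big_seq big1 ?mulr0 ?(min_idPr _)// => j.
    rewrite mem_filter => /andP[/asboolP jU _].
    apply/eqP; rewrite eq_le cone_ge0 andbT leNgt cone_gt0; apply/negP => /jU.
    exact: nUx.
  rewrite indicE mem_set//=.
  have [e e0 He] := metric_ball_nbhs (open_nbhs_nbhs (conj oU Ux)).
  have [k ke] : exists k : nat, (k.+1%:R^-1 : R) < e / 2.
    have e20 : 0 < e / 2 by lra.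
    by have [k] := ltr_add_invr e20; rewrite add0r; exists k.
  have k0 : (0 : R) < k.+1%:R^-1 by rewrite invr_gt0.
  have [i xi] := pdense x k0.
  have jU : inU (i, k).
    apply/asboolP => y /= yi; apply: He.
    have := Defs.metric_triangle md x (p i) y.
    rewrite (Defs.metric_sym md x (p i)) (Defs.metric_sym md (p i) y) => tri.
    apply: le_lt_trans tri _; rewrite (splitr e); apply: ltrD.
      exact: lt_trans xi ke.
    exact: lt_trans yi ke.
  have c0 : 0 < cone (p i) k.+1%:R^-1 x by rewrite cone_gt0 (Defs.metric_sym md x).
  apply: cvg_near_cst; near=> n.
  rewrite /truncated_cones/= /truncated_cones_fun/= (min_idPl _)//.
  apply: (@le_trans _ _ (n%:R * cone (p i) k.+1%:R^-1 x)).
    by rewrite -ler_pdivrMr// mul1r; near: n; exact: nbhs_infty_ger.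
  rewrite ler_wpM2l// (big_rem (i, k))/=; first by rewrite lerDl sumr_ge0// => *; exact: cone_ge0.
  rewrite mem_filter jU/= mem_pmap; apply/mapP; exists (choice.pickle (i, k)); last by rewrite choice.pickleK.
  rewrite mem_iota/= add0n; near: n; exact: nbhs_infty_gt.
have -> : mu U = (\int[mu]_(x in [set: borel G]) (\1_U x)%:E)%E.
  by rewrite integral_indic ?setIT//; exact: borel_open.
under eq_fun do rewrite EFin_pairing.
rewrite (_ : (fun x => _) = fun x : borel G =>
    limn (fun n => (truncated_cones (s n, n) x)%:E)); last first.
  by apply/funext => x; rewrite (cvg_lim _ (cvgU x)).
apply: cvg_monotone_convergence => //.
- by move=> n; apply/measurable_EFinP; exact: test_measurable.
- by move=> n x _; rewrite lee_fin.
- by move=> x _ n m nm; rewrite lee_fin; exact: homo.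
Unshelve. all: by end_near. Qed.

End separating_family.

(** * Weak-* compactness of bounded sets of Radon measures *)

Section level_sums.
Context {R : realType}.

Lemma level_sum_le (z : R) (L : nat) : 0 <= z ->
  \sum_(k < L) (k.+1%:R <= z)%R%:R <= Num.min L%:R z.
Proof.
move=> z0; elim: L => [|L IH]; first by rewrite big_ord0 le_min lexx.
rewrite big_ord_recr/=; move: (\sum_(k < L) _) IH => s.
rewrite !le_min -natr1 => /andP[H1 H2].
by case: (leP (L%:R + 1) z) => zL; rewrite ?mulr1n ?mulr0n; apply/andP; split; lra.
Qed.

Lemma level_sum_ge (z : R) (L : nat) : 0 <= z ->
  Num.min L.+1%:R z <= 1 + \sum_(k < L) (k.+1%:R < z)%R%:R.
Proof.
move=> z0; elim: L => [|L IH]; first by rewrite big_ord0 addr0 ge_min lexx.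
rewrite big_ord_recr/=; move: (\sum_(k < L) _) IH => s.
rewrite -[L.+2%:R]natr1 !ge_min => /orP H.
by case: (ltP L.+1%:R z) => zL; rewrite ?mulr1n ?mulr0n; apply/orP; case: H => H; [left|right|right|right]; lra.
Qed.

End level_sums.

Section radon_topology.
Context {R : realType} {G : lcscGroupType}.
Implicit Types (mu nu : radon R G) (f g h : test_function R G).

Lemma radon_cvg (F : set_system (radon R G)) mu : Filter F ->
  (forall f, radon_pairing nu f @[nu --> F] --> radon_pairing mu f) -> F --> mu.
Proof.
move=> FF H.
have : (@radon_pairing R G) @ F --> radon_pairing mu.
  apply/cvg_sup => f U [_ [[V oV <-] Vx]] /filterS; apply.
  by apply: (H f); exact: open_nbhs_nbhs.
move=> {}H U [_ [[V oV <-] Vx]] /filterS; apply.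
by apply: H; exact: open_nbhs_nbhs.
Qed.

(** The next three lemmas bound an integral from both sides by sums of masses of
    level sets, closed ones below and open ones above; the two sums differ by the
    mesh times the mass of the support. *)
Lemma integral_steps mu (c : R) (A : nat -> set G) (L : nat) : 0 <= c ->
  (forall k, measurable (A k : set (borel G))) ->
  (\int[mu]_(x in [set: borel G]) (\sum_(k < L) c * \1_(A k) x)%:E =
   \sum_(k < L) c%:E * mu (A k))%E.
Proof.
move=> c0 mA.
under eq_integral do rewrite -sumEFin.
rewrite ge0_integral_sum//; last 2 first.
- by move=> k; apply/measurable_EFinP; apply: measurable_funM => //; exact: measurable_indic.
- by move=> k x _; rewrite lee_fin mulr_ge0.
apply: eq_bigr => k _; under eq_integral do rewrite EFinM.
rewrite ge0_integralZl//; last by apply/measurable_EFinP; exact: measurable_indic.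
by rewrite integral_indic// setIT.
Qed.

Lemma levels_le_pairing mu f (n L : nat) : (forall x, 0 <= f x) ->
  (\sum_(k < L) n.+1%:R^-1%:E * mu [set x | (k.+1%:R / n.+1%:R <= f x)%R] <=
   (radon_pairing mu f)%:E)%E.
Proof.
move=> f0; have n0 : (0 : R) < n.+1%:R^-1 by rewrite invr_gt0.
pose A k := [set x | (k.+1%:R / n.+1%:R <= f x)%R].
have mA k : measurable (A k : set (borel G)).
  apply: borel_closed; apply: (@preimage_closed _ _ f [set r | _ <= r]).
    by move=> x _; exact: test_continuous.
  exact: closed_ge.
have := @integral_steps mu n.+1%:R^-1 A L (ltW n0) mA.
rewrite /A => <-; rewrite EFin_pairing.
apply: ge0_le_integral => //.
- by move=> x _; rewrite lee_fin; apply: sumr_ge0 => k _; apply: mulr_ge0; [exact: ltW|rewrite indicE].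
- apply/measurable_EFinP; apply: measurable_sum => k.
  by apply: measurable_funM => //; apply: measurable_indic; exact: (mA k).
- by apply/measurable_EFinP; exact: test_measurable.
move=> x _; rewrite lee_fin -mulr_sumr mulrC ler_pdivrMr//.
have z0 : 0 <= f x * n.+1%:R by rewrite mulr_ge0.
have := level_sum_le L z0; rewrite le_min => /andP[_]; apply: le_trans.
apply: ler_sum => k _; rewrite indicE /A.
by case: (boolP (x \in _)) => [/set_mem/=|//]; rewrite ler_pdivrMr// => ->.
Qed.

Lemma pairing_le_levels mu f (n L : nat) (K : set G) : (forall x, 0 <= f x) ->
  (forall x, f x * n.+1%:R <= L.+1%:R) -> compact K -> (forall x, f x != 0 -> K x) ->
  ((radon_pairing mu f)%:E <= n.+1%:R^-1%:E * mu K +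
   \sum_(k < L) n.+1%:R^-1%:E * mu [set x | (k.+1%:R / n.+1%:R < f x)%R])%E.
Proof.
move=> f0 fL cK fK; have n0 : (0 : R) < n.+1%:R^-1 by rewrite invr_gt0.
pose A k := if k is k'.+1 then [set x | (k'.+1%:R / n.+1%:R < f x)%R] else K.
have mA k : measurable (A k : set (borel G)).
  case: k => [|k]; first by apply: borel_compact => //; exact: lcsc_hausdorff.
  apply: borel_open; apply: (@open_comp _ _ f [set r | _ < r]).
    by move=> x _; exact: test_continuous.
  exact: open_gt.
have := @integral_steps mu n.+1%:R^-1 A L.+1 (ltW n0) mA.
rewrite big_ord_recl/= => <-; rewrite EFin_pairing.
apply: ge0_le_integral => //.
- by move=> x _; rewrite lee_fin.
- by apply/measurable_EFinP; exact: test_measurable.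
- apply/measurable_EFinP; apply: measurable_sum => k.
  by apply: measurable_funM => //; apply: measurable_indic; exact: (mA k).
move=> x _; rewrite lee_fin -mulr_sumr mulrC ler_pdivlMr//.
have [->|fx] := eqVneq (f x) 0; first by rewrite mul0r sumr_ge0.
have z0 : 0 <= f x * n.+1%:R by rewrite mulr_ge0.
have := level_sum_ge L z0; rewrite (min_idPr (fL x)) => /le_trans; apply.
rewrite big_ord_recl/= {1}indicE mem_set/=; last exact: fK.
rewrite lerD2l; apply: ler_sum => k _; rewrite indicE.
case: (boolP (_ < _)) => // kx; rewrite mem_set//.
by rewrite /= add0n ltr_pdivrMr.
Qed.

Lemma measure_le_pairing mu f (K : set G) : compact K -> (forall x, 0 <= f x) ->
  (forall x, K x -> 1 <= f x) -> (mu K <= (radon_pairing mu f)%:E)%E.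
Proof.
move=> cK f0 f1; have mK := borel_compact (@lcsc_hausdorff G) cK.
rewrite EFin_pairing -[X in (mu X <= _)%E]setIT -integral_indic//.
apply: ge0_le_integral => //.
- by apply/measurable_EFinP; exact: measurable_indic.
- by apply/measurable_EFinP; exact: test_measurable.
move=> x _; rewrite lee_fin indicE.
by case: (boolP (x \in K)) => [/set_mem/f1|].
Qed.

End radon_topology.

Section radon_compactness.
Context {R : realType} {G : lcscGroupType} {d0 : G -> G -> R}.
Context (ad : adapted d0) (cd : continuous (fun z : G * G => d0 z.1 z.2)).
Implicit Types (mu nu : radon R G) (f g h : test_function R G).

Section ultralimit.
Context {F : set_system (radon R G)} (FU : UltraFilter F).
Context (C : test_function R G -> R).
Hypothesis FC : forall f, (forall x, 0 <= f x) -> F [set nu | radon_pairing nu f <= C f].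

Let FF := @ultra_proper _ _ FU.

Let lam_i (nu : radon R G) (K : set G) := fine (nu K).
Let lam K := lim (lam_i nu K @[nu --> F]).

Let lam_i_content nu : is_content (lam_i nu).
Proof.
by apply: measure_content; [exact: lcsc_hausdorff|exact: radon_compact].
Qed.

Let lam_i_bounded K : compact K -> exists c, F [set nu | lam_i nu K <= c].
Proof.
move=> cK; have [t t0 Kt] := compact_adapted_bounded ad cK.
pose b := plateau ad cd t; exists (C b).
apply: filterS (FC (plateau_ge0 ad cd t)) => nu /=; apply: le_trans.
rewrite -lee_fin fineK ?ge0_fin_numE ?radon_compact//.
apply: measure_le_pairing => // [x|x /Kt xt]; first exact: plateau_ge0.
by rewrite plateau1// ltW.
Qed.

Let lam_cvg K : compact K -> cvg (lam_i nu K @[nu --> F]).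
Proof. exact: (ultralimit_content FU lam_i_content lam_i_bounded).1. Qed.

Let lam_content : is_content lam.
Proof. exact: (ultralimit_content FU lam_i_content lam_i_bounded).2. Qed.

Let mu_ := content_measure lam_content (@lcsc_hausdorff G).

Let mu_compact (K : set G) : compact K -> (mu_ K < +oo)%E.
Proof.
move=> cK; have [t t0 Kt] := compact_adapted_bounded ad cK.
apply: le_lt_trans (ltry (lam [set x | d0 x 1%g <= t])).
apply: (@le_trans _ _ (inner_content lam [set x | d0 x 1%g < t])).
  by apply: outer_content_open => //; exact: open_metric_ball.
apply: inner_content_le => K' cK' K't; rewrite lee_fin; apply: content_le => //.
  exact: (@compact_metric_ball _ _ _ ad cd t).
by move=> x /K't/ltW.
Qed.

Let mu_outer (A : set G) : mu_ A =
  ereal_inf [set mu_ U | U in [set U : set G | open U /\ A `<=` U]].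
Proof.
congr ereal_inf; apply/seteqP; split=> _ [U [oU AU] <-]; exists U => //.
  exact: outer_contentE.
by apply/esym; exact: outer_contentE.
Qed.

Definition radon_ultralimit : radon R G := Radon mu_compact mu_outer.

Let mu := radon_ultralimit.

(** Comparing [f] with sums of indicators of level sets reduces convergence of
    integrals to convergence on compact level sets; the error is the mass of the
    support times the mesh [1/(n+1)]. *)
Let ultralimit_cvg_ge0 f : (forall x, 0 <= f x) ->
  radon_pairing nu f @[nu --> F] --> radon_pairing mu f.
Proof.
move=> f0.
have cv : cvg (radon_pairing nu f @[nu --> F]).
  apply: (@ultra_bounded_cvg _ _ _ FU _ (C f)); apply: filterS (FC f0) => nu /=.
  by rewrite ger0_norm// pairing_ge0.
suff <- : lim (radon_pairing nu f @[nu --> F]) = radon_pairing mu f by exact: cv.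
set l := lim _.
have [t t0 ft] := test_function_bounded_support ad f.
have [M M0 fM] := test_function_bounded f.
pose K0 := [set x | d0 x 1%g <= t].
have cK0 : compact K0 := @compact_metric_ball _ _ _ ad cd t.
have fK0 x : f x != 0 -> K0 x by move=> /ft/ltW.
have main (n : nat) : `|l - radon_pairing mu f| <= n.+1%:R^-1 * (lam K0 + fine (mu K0)).
  have [L fL] : exists L : nat, forall x, f x * n.+1%:R <= L.+1%:R.
    exists (Num.bound (M * n.+1%:R)) => x; apply: (@le_trans _ _ (M * n.+1%:R)).
      by rewrite ler_wpM2r// (le_trans (ler_norm _)).
    apply/ltW; apply: lt_le_trans (archi_boundP _) _; first by rewrite mulr_ge0.
    by rewrite ler_nat.
  pose K k := [set x | k.+1%:R / n.+1%:R <= f x].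
  have cK k : compact (K k).
    apply: (@subclosed_compact _ _ K0) => // [|x].
      apply: (@preimage_closed _ _ f [set r | _ <= r]).
        by move=> x _; exact: test_continuous.
      exact: closed_ge.
    by rewrite /K/= => fx; apply: fK0; rewrite gt_eqF// (lt_le_trans _ fx).
  have EK (nu : radon R G) (A : set G) : compact A -> ((fine (nu A))%:E = nu A)%E.
    by move=> cA; rewrite fineK// ge0_fin_numE// radon_compact.
  have low (nu : radon R G) :
      \sum_(k < L) n.+1%:R^-1 * fine (nu (K k)) <= radon_pairing nu f.
    rewrite -lee_fin -sumEFin; apply: le_trans (levels_le_pairing nu n L f0).
    by apply: lee_sum => k _; rewrite EFinM EK.
  have up (nu : radon R G) (a : nat -> R) :
      (forall k, (nu [set x | (k.+1%:R / n.+1%:R < f x)%R] <= (a k)%:E)%E) ->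
      radon_pairing nu f <= n.+1%:R^-1 * fine (nu K0) + \sum_(k < L) n.+1%:R^-1 * a k.
    move=> Ha; rewrite -lee_fin EFinD -sumEFin EFinM EK//.
    apply: le_trans (pairing_le_levels nu f0 fL cK0 fK0) _; apply: leeD2l.
    by apply: lee_sum => k _; rewrite EFinM lee_pmul2l// lte_fin.
  have limE : (\sum_(k < L) n.+1%:R^-1 * lam_i nu (K k)) @[nu --> F] -->
     \sum_(k < L) n.+1%:R^-1 * lam (K k).
    elim: L {fL low up} => [|L IH].
      by under eq_fun do rewrite big_ord0; rewrite big_ord0; exact: cvg_cst.
    under eq_fun do rewrite big_ord_recr/=.
    rewrite big_ord_recr/=; apply: cvgD => //; apply: cvgMr.
    exact: (lam_cvg (cK _)).
  have limE' : n.+1%:R^-1 * lam_i nu K0 +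
      (\sum_(k < L) n.+1%:R^-1 * lam_i nu (K k)) @[nu --> F] -->
      n.+1%:R^-1 * lam K0 + \sum_(k < L) n.+1%:R^-1 * lam (K k).
    by apply: cvgD => //; apply: cvgMr; exact: (lam_cvg cK0).
  have H1 : \sum_(k < L) n.+1%:R^-1 * lam (K k) <= l.
    rewrite -(cvg_lim _ limE)//; apply: (ultra_le_lim FU) => //.
      by apply: cvgP limE.
    by apply: nearW => nu; exact: low.
  have H2 : l <= n.+1%:R^-1 * lam K0 + \sum_(k < L) n.+1%:R^-1 * lam (K k).
    rewrite -(cvg_lim _ limE')//; apply: (ultra_le_lim FU) => //.
      by apply: cvgP limE'.
    apply: nearW => nu; apply: (up nu (fun k => lam_i nu (K k))) => k; rewrite EK//.
    apply: le_measure; rewrite ?inE.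
    - apply: borel_open; apply: (@open_comp _ _ f [set r | _ < r]).
        by move=> x _; exact: test_continuous.
      exact: open_gt.
    - by apply: borel_compact => //; exact: lcsc_hausdorff.
    - by move=> x /ltW.
  have H3 : \sum_(k < L) n.+1%:R^-1 * lam (K k) <= radon_pairing mu f.
    apply: le_trans (low mu); apply: ler_sum => k _; rewrite ler_pM2l// -lee_fin EK//.
    exact: outer_content_compact.
  have H4 : radon_pairing mu f <=
      n.+1%:R^-1 * fine (mu K0) + \sum_(k < L) n.+1%:R^-1 * lam (K k).
    apply: (up mu (fun k => lam (K k))) => k.
    apply: (@le_trans _ _ (inner_content lam [set x | (k.+1%:R / n.+1%:R < f x)%R])).
      apply: outer_content_open => //; apply: (@open_comp _ _ f [set r | _ < r]).
        by move=> x _; exact: test_continuous.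
      exact: open_gt.
    apply: inner_content_le => K' cK' K'U; rewrite lee_fin; apply: content_le => //.
    by move=> x /K'U/ltW.
  have p1 : 0 <= n.+1%:R^-1 * lam K0 by rewrite mulr_ge0// content_ge0.
  have p2 : 0 <= n.+1%:R^-1 * fine (mu K0) by rewrite mulr_ge0// fine_ge0.
  rewrite mulrDr; move: H1 H2 H3 H4 p1 p2.
  move: (\sum_(k < L) _) (_ * lam K0) (_ * fine _) => S a1 a2 *.
  by rewrite ler_norml; apply/andP; split; lra.
apply/eqP; rewrite -subr_eq0 -normr_eq0; apply/negPn/negP => ne0.
have A0 : 0 <= lam K0 + fine (mu K0) by rewrite addr_ge0// ?content_ge0// fine_ge0.
have e0 : 0 < `|l - radon_pairing mu f| / (lam K0 + fine (mu K0) + 1).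
  by rewrite divr_gt0// ?lt_neqAle ?normr_ge0 ?andbT 1?eq_sym//; lra.
have [n] := ltr_add_invr e0; rewrite add0r ltr_pdivlMr; last by lra.
have := main n; have n0 : (0 : R) < n.+1%:R^-1 by rewrite invr_gt0.
rewrite [X in X < _]mulrDr mulr1 => H1 H2.
by have := le_lt_trans H1 (lt_trans _ H2); rewrite ltrDl ltxx => /(_ n0).
Qed.

Lemma radon_ultralimit_cvg : F --> radon_ultralimit.
Proof.
apply: radon_cvg => f.
pose fp := fun x : G => Num.max (f x) 0.
pose fn := fun x : G => Num.max (- f x) 0.
have cfp : continuous fp.
  move=> x; apply: (@continuous_max R G f (fun=> 0)); last exact: cvg_cst.
  exact: test_continuous.
have cfn : continuous fn.
  move=> x; apply: (@continuous_max R G (fun x => - f x) (fun=> 0)); last exact: cvg_cst.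
  by apply: cvgN; exact: test_continuous.
have sfp : precompact [set x | fp x != 0].
  apply: precompact_subset (@test_support _ _ f) => x /=.
  by apply: contraNN => /eqP fx; rewrite /fp fx maxxx.
have sfn : precompact [set x | fn x != 0].
  apply: precompact_subset (@test_support _ _ f) => x /=.
  by apply: contraNN => /eqP fx; rewrite /fn fx oppr0 maxxx.
pose f1 := TestFunction cfp sfp; pose f2 := TestFunction cfn sfn.
have fE nu : radon_pairing nu f = radon_pairing nu f1 - radon_pairing nu f2.
  rewrite /radon_pairing -RintegralB//; try exact: test_function_integrable.
  apply: eq_Rintegral => x _ /=; rewrite /fp /fn.
  by case: (leP (f x) 0) => fx; case: (leP (- f x) 0); lra.
rewrite (_ : (fun nu => radon_pairing nu f) =
    fun nu => radon_pairing nu f1 - radon_pairing nu f2); last exact/funext.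
rewrite fE; apply: cvgB; apply: ultralimit_cvg_ge0 => x.
  by rewrite /= /fp le_max lexx orbT.
by rewrite /= /fn le_max lexx orbT.
Qed.

End ultralimit.

(** Weak-* compactness: masses of compact sets have limits along an
    ultrafilter, these limits form a content, and the Radon measure of this
    content is the limit. *)
Lemma radon_bounded_compact (C : test_function R G -> R) :
  compact [set nu : radon R G |
    forall f, (forall x, 0 <= f x) -> radon_pairing nu f <= C f].
Proof.
rewrite compact_ultra => F FU FW; have FF := @ultra_proper _ _ FU.
have FC f : (forall x, 0 <= f x) -> F [set nu | radon_pairing nu f <= C f].
  by move=> f0; apply: filterS FW => nu; exact.
exists (radon_ultralimit FU FC); split; last exact: radon_ultralimit_cvg.
move=> f f0.
have cv : radon_pairing nu f @[nu --> F] --> radon_pairing (radon_ultralimit FU FC) f.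
  apply: cvg_trans (@pairing_continuous R G f (radon_ultralimit FU FC)).
  exact: (cvg_app (fun nu => radon_pairing nu f) (@radon_ultralimit_cvg F FU C FC)).
rewrite -(cvg_lim _ cv)//; apply: limr_le; first exact: cvgP cv.
by apply: filterS FW => nu; exact.
Qed.

Context (p : nat -> G) (pdense : forall x (e : R), 0 < e -> exists i, d0 (p i) x < e).

(** Outer regularity reduces equality of Radon measures to open sets. *)
Lemma truncated_cones_separate mu nu : mu <> nu ->
  exists t, radon_pairing mu (truncated_cones ad cd p t) <>
            radon_pairing nu (truncated_cones ad cd p t).
Proof.
move=> munu; apply: contrapT => /forallNP H; apply: munu.
have {}H t : radon_pairing mu (truncated_cones ad cd p t) =
             radon_pairing nu (truncated_cones ad cd p t) by apply: contrapT.
apply: radon_ext => A; rewrite [LHS]radon_outer [RHS]radon_outer.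
congr ereal_inf; apply: eq_imagel => U [oU _].
have [t Ht] := radon_open_limit ad cd pdense oU.
rewrite -(cvg_lim _ (Ht mu))// -(cvg_lim _ (Ht nu))//.
by under eq_fun do rewrite H.
Qed.

Lemma radon_hausdorff : hausdorff_space (radon R G).
Proof.
rewrite open_hausdorff => mu nu /eqP/truncated_cones_separate[t].
set f := truncated_cones _ _ _ _ => /eqP munu.
have := @Rhausdorff R; rewrite open_hausdorff => /(_ _ _ munu).
case=> -[A B] [/set_mem/= Amu /set_mem/= Bnu] [oA oB /eqP AB].
exists ((fun nu => radon_pairing nu f) @^-1` A, (fun nu => radon_pairing nu f) @^-1` B).
  by split; rewrite inE.
split => /=.
- by apply: open_comp oA => x _; exact: pairing_continuous.
- by apply: open_comp oB => x _; exact: pairing_continuous.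
- by rewrite -preimage_setI AB preimage_set0.
Qed.

End radon_compactness.

(** * The hull is a compact Hausdorff space *)

Lemma rmul_continuous (G : lcscGroupType) (g : G) : continuous (fun x : G => (x * g)%g).
Proof.
move=> x; apply: (@continuous_comp _ _ _ (fun y : G => (y, g))
  (fun z : G * G => (z.1 * z.2)%g)); last exact: mulg_continuous.
by apply: cvg_pair; [exact: cvg_id|exact: cvg_cst].
Qed.

Section translation_action.
Context {R : realType} {G : lcscGroupType}.
Implicit Types (mu nu : radon R G) (f : test_function R G) (g h : G).

Lemma radon_translateM g h mu :
  radon_translate (g * h)%g mu = radon_translate g (radon_translate h mu).
Proof.
apply: radon_ext => A; rewrite /= /translate_fun/= /translate_fun/=.
by congr (mu _); apply/seteqP; split => x /=; rewrite mulgA.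
Qed.

Lemma radon_translate1 mu : radon_translate 1%g mu = mu.
Proof.
apply: radon_ext => A; rewrite /= /translate_fun/=.
by congr (mu _); apply/seteqP; split => x /=; rewrite mul1g.
Qed.

Context {d0 : G -> G -> R}.
Context (ad : adapted d0) (cd : continuous (fun z : G * G => d0 z.1 z.2)).

(** Equicontinuity of the action, uniform over measures whose mass on one fixed
    ball is bounded, such as the measures of the hull. *)
Lemma translate_close f (e : R) (t : R) : (forall x, f x != 0 -> d0 x 1%g < t) -> 0 < e ->
  \forall v \near (1%g : G), forall mu,
    `|radon_pairing (radon_translate v mu) f - radon_pairing mu f| <=
    e * radon_pairing mu (plateau ad cd (t + 1)).
Proof.
move=> ft e0; have := test_function_uniform_left ad cd ft e0.
apply: filterS => v Hv mu; rewrite pairing_translate.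
exact: pairing_close.
Qed.

Lemma orbit_continuous mu : continuous (fun g => radon_translate g mu).
Proof.
apply: continuous_pairing => f g.
have [t t0 ft] := test_function_bounded_support ad f.
set c := radon_pairing (radon_translate g mu) (plateau ad cd (t + 1)).
have c0 : 0 <= c by apply: pairing_ge0 => x; exact: plateau_ge0.
apply/cvgrPdist_le => e e0.
have e'0 : 0 < e / (c + 1) by rewrite divr_gt0//; lra.
have H := translate_close ft e'0.
have cg : (h * g^-1)%g @[h --> g] --> (1%g : G).
  by rewrite -(mulgV g); exact: rmul_continuous.
have Hg : \forall h \near g, forall nu,
    `|radon_pairing (radon_translate (h * g^-1)%g nu) f - radon_pairing nu f| <=
    e / (c + 1) * radon_pairing nu (plateau ad cd (t + 1)) := cg _ H.
apply: filterS Hg => h /(_ (radon_translate g mu)).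
rewrite -radon_translateM mulgVK distrC => /le_trans; apply.
rewrite -/c mulrAC ler_pdivrMr; last by lra.
by rewrite ler_wpM2l// ?lerDl// ltW.
Qed.

End translation_action.

Section hull_compactness.
Context {R : realType} {G : lcscGroupType} (L : weighted_delone R G).
Implicit Types (mu nu : radon R G) (f : test_function R G) (g h : G).

Let Lam := delta_measure L.

(** Every translate of the separating open set [U] carries at most one point, so
    a finite cover of [K] by such translates bounds the mass of all translates
    of [K] at once. *)
Lemma delta_ltrans_bounded (K : set G) : compact K ->
  exists2 c : R, 0 <= c & forall g, (radon_translate g Lam K <= c%:E)%E.
Proof.
move=> cK; have [[U [oU [u Uu] _ U1]] _] := points_delone L.
have [s s1 Hs] := weight_bounded L.
have s0 : 0 <= s by lra.
have H g : (Lam (ltrans g U) <= s%:E)%E.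
  rewrite /Lam/= /delta_fun.
  have [->|/set0P[x [Lx Ux]]] := eqVneq (points L `&` ltrans g U) set0.
    by rewrite esum_set0.
  rewrite (_ : _ `&` _ = [set x]).
    rewrite esum_set1; last exact: weight_ge0.
    by rewrite lee_fin; case/andP: (Hs _ Lx).
  apply/seteqP; split=> [y [Ly Uy]|_ -> //]; exact: (U1 g).
move: (cK); rewrite compact_cover => /(_ G setT (fun x => ltrans (x * u^-1)%g U)).
case=> [x _|x _|D _ KD]; [exact: open_ltrans|by exists x => //; exists u => //; rewrite mulgVK|].
exists (s * #|`D|%:R); first by rewrite mulr_ge0.
move=> g.
have sub : (fun x => (g * x)%g) @^-1` K `<=`
    \bigcup_(x in [set` D]) ltrans (g^-1 * (x * u^-1))%g U.
  move=> y /= /KD[x xD [z Uz zE]]; exists x => //; exists z => //.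
  by rewrite -mulgA zE mulKg.
rewrite [leLHS](_ : _ = Lam ((fun x => (g * x)%g) @^-1` K))//.
apply: (@le_trans _ _ (\sum_(x \in [set` D]) Lam (ltrans (g^-1 * (x * u^-1))%g U))%E).
  apply: (@content_sub_fsum _ _ _ Lam _ _ _ _ _ _ _ sub); first exact: finite_fset.
  by move=> x _; apply: borel_open; exact: open_ltrans.
  by rewrite -ltransVE; apply: borel_compact; [exact: lcsc_hausdorff|exact: compact_ltrans].
rewrite fsbig_finite//= set_fsetK.
apply: le_trans (lee_sum _ (fun x _ => H _)) _.
by rewrite sumEFin lee_fin big_const_seq count_predT iter_addr_0 mulr_natr.
Qed.

Lemma pairing_le_measure mu f (K : set G) (M : R) : compact K ->
  (forall x, 0 <= f x) -> (forall x, f x <= M) -> (forall x, f x != 0 -> K x) ->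
  ((radon_pairing mu f)%:E <= M%:E * mu K)%E.
Proof.
move=> cK f0 fM fK; have M0 : 0 <= M by apply: le_trans (f0 1%g) (fM _).
have mK := borel_compact (@lcsc_hausdorff G) cK.
have := @integral_steps R G mu M (fun=> K) 1 M0 (fun=> mK).
rewrite big_ord1 => <-; rewrite EFin_pairing; apply: ge0_le_integral => //.
- by move=> x _; rewrite lee_fin.
- by apply/measurable_EFinP; exact: test_measurable.
- apply/measurable_EFinP; under eq_fun do rewrite big_ord1.
  by apply: measurable_funM => //; exact: measurable_indic.
move=> x _; rewrite big_ord1 lee_fin indicE.
have [->|fx] := eqVneq (f x) 0; first by rewrite mulr_ge0.
by rewrite mem_set ?mulr1//; exact: fK.
Qed.

Lemma hull_orbit g : hull L (radon_translate g Lam).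
Proof. by apply: subset_closure; exists g => //; exact: delta_translate. Qed.

(** Bounds are proved along the orbit and transferred to the hull through this
    principle. *)
Lemma hull_closed (A : set (radon R G)) : closed A ->
  (forall g, A (radon_translate g Lam)) -> hull L `<=` A.
Proof.
move=> cA HA mu; rewrite /hull (closure_id A).1//; apply: closure_subset.
by move=> _ [g _ <-]; rewrite delta_translate.
Qed.

(** The bound on the orbit that weak-* compactness asks for. *)
Lemma hull_pairing_bounded f : (forall x, 0 <= f x) ->
  exists2 c : R, 0 <= c & forall mu, hull L mu -> radon_pairing mu f <= c.
Proof.
move=> f0; have [K fK [cK _]] := @test_support _ _ f.
have [M M0 HM] := test_function_bounded f.
have [c c0 Hc] := delta_ltrans_bounded cK.
exists (M * c) => [|mu]; first exact: mulr_ge0.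
apply: (hull_closed (A := [set mu | radon_pairing mu f <= M * c])).
  apply: (@preimage_closed _ _ (fun mu => radon_pairing mu f) [set r | r <= M * c]).
    by move=> nu _; exact: pairing_continuous.
  exact: closed_le.
move=> g /=; rewrite -lee_fin EFinM.
apply: le_trans (pairing_le_measure _ cK f0 _ fK) _.
  by move=> x; exact: le_trans (ler_norm _) (HM x).
by apply: lee_pmul => //; rewrite ?lee_fin.
Qed.

Context {d0 : G -> G -> R}.
Context (ad : adapted d0) (cd : continuous (fun z : G * G => d0 z.1 z.2)).

Lemma hull_compact : compact (hull L).
Proof.
have /choice[C HC] : forall f, exists c : R, (forall x, 0 <= f x) ->
    forall mu, hull L mu -> radon_pairing mu f <= c.
  move=> f; have [f0|nf0] := pselect (forall x, 0 <= f x); last by exists 0.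
  by have [c _ Hc] := hull_pairing_bounded f0; exists c.
apply: (subclosed_compact _ (@radon_bounded_compact _ _ _ ad cd C)).
  exact: closed_closure.
by move=> mu Hmu f f0; exact: HC.
Qed.

Lemma hull_space_val_continuous : continuous (val : hull_space L -> radon R G).
Proof. exact: initial_continuous. Qed.

Lemma hull_space_compact : compact [set: hull_space L].
Proof.
move=> F FF _.
have FH : F (val @^-1` (hull L)) by apply: filterE => x; exact: set_valP.
have [mu [Hmu clmu]] := @hull_compact (val @ F) _ FH.
exists (exist _ mu (mem_set Hmu)); split => // A B FA [_ [[V oV <-] Vmu] VB].
have FA' : F (val @^-1` (val @` A)) by apply: filterS FA => x Ax; exists x.
have [_ [[x Ax <-] Vx]] := clmu _ _ FA' (open_nbhs_nbhs (conj oV Vmu)).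
by exists x; split=> //; exact: VB.
Qed.

Lemma hull_space_hausdorff : hausdorff_space (hull_space L).
Proof.
have [p pd] := exists_dense_sequence ad cd.
move=> x y clxy; apply: val_inj; apply: (radon_hausdorff ad cd pd) => A B Ax By.
have [z [Az Bz]] := clxy _ _ (hull_space_val_continuous Ax) (hull_space_val_continuous By).
by exists (val z).
Qed.

Lemma hull_space_continuous (X : topologicalType) (F : X -> hull_space L) :
  continuous (fun x => val (F x) : radon R G) -> continuous F.
Proof. exact: continuous_comp_initial. Qed.

Lemma hull_act_continuous g : continuous (hull_act (L := L) g).
Proof.
apply: hull_space_continuous => x.
apply: (@continuous_comp _ _ _ (val : hull_space L -> radon R G) (radon_translate g)).
  exact: hull_space_val_continuous.
exact: radon_translate_continuous.
Qed.

Lemma hull_orbit_continuous (x : hull_space L) : continuous (fun g => hull_act g x).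
Proof. by apply: hull_space_continuous; exact: (orbit_continuous ad cd). Qed.

Lemma hull_actM g h (x : hull_space L) : hull_act (g * h)%g x = hull_act g (hull_act h x).
Proof. by apply: val_inj; exact: radon_translateM. Qed.

Lemma hull_act1 (x : hull_space L) : hull_act 1%g x = x.
Proof. by apply: val_inj; exact: radon_translate1. Qed.

End hull_compactness.

(** * Averages over translates of a fixed set *)

Lemma countable_bigcup_measurable d (T : sigmaRingType d) U (D : set U) (F : U -> set T) :
  countable D -> (forall i, D i -> measurable (F i)) -> measurable (\bigcup_(i in D) F i).
Proof.
move=> /countable_injP[c injc] mF.
have -> : \bigcup_(i in D) F i = \bigcup_n \bigcup_(i in [set i | D i /\ c i = n]) F i.
  by apply/seteqP; split=> [x [i Di Fx]|x [n _ [i [Di _] Fx]]]; [exists (c i) => //|]; exists i.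
apply: bigcupT_measurable => n.
have [[i [Di ci]]|nD] := pselect (exists i, D i /\ c i = n).
  rewrite (_ : [set _ | _] = [set i]) ?bigcup_set1; first exact: mF.
  apply/seteqP; split=> [j [Dj cj]|_ -> //]; apply: injc; rewrite ?inE//.
  by rewrite cj ci.
rewrite (_ : [set _ | _] = set0) ?bigcup_set0; first exact: measurable0.
by apply/seteqP; split=> // i Di; apply: nD; exists i.
Qed.

Section sigma_finiteness.
Context {R : realType} {G : lcscGroupType}.

(** Radon measures on [G] are sigma-finite; the proof is an argument so that the
    structure required by Tonelli's theorem can be inferred. *)
Definition sigma_radon (m : radon R G) (_ : sigma_finite [set: borel G] m) :
  set (borel G) -> \bar R := m.

HB.instance Definition _ m Hm := Measure.copy (@sigma_radon m Hm) (radon_measure m).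
HB.instance Definition _ m Hm :=
  Measure_isSigmaFinite.Build _ _ _ (@sigma_radon m Hm) Hm.

Lemma radon_sigma_finite (d : G -> G -> R) (m : radon R G) : adapted d ->
  continuous (fun z : G * G => d z.1 z.2) -> sigma_finite [set: borel G] m.
Proof.
move=> ad cd; exists (fun n => [set x | d x 1%g <= n%:R]).
  apply/seteqP; split=> // x _; exists (Num.bound (d x 1%g)) => //=.
  by apply/ltW/archi_boundP; exact: Defs.metric_ge0 (adapted_metric ad) _ _.
move=> n; have cB := @compact_metric_ball _ _ _ ad cd n%:R.
split; last exact: radon_compact.
by apply: borel_compact => //; exact: lcsc_hausdorff.
Qed.

(** Second countability makes the product of the Borel sigma-algebras contain the
    open sets of the product. *)
Lemma open_prod_measurable (E : set (G * G)) : open E ->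
  measurable (E : set (borel G * borel G)).
Proof.
move=> oE; have [B cB [oB nB]] := @lcsc_second_countable G.
pose T := [set UV : set G * set G | [/\ B UV.1, B UV.2 & UV.1 `*` UV.2 `<=` E]].
have -> : E = \bigcup_(UV in T) (UV.1 `*` UV.2).
  apply/seteqP; split=> [[x y] Exy|z [UV [_ _ UVE] /UVE//]].
  have [[U V] /= [nU nV] UVE] : nbhs (x, y) E by exact: open_nbhs_nbhs.
  have [U' [BU' U'x] U'U] := nB x _ nU.
  have [V' [BV' V'y] V'V] := nB y _ nV.
  exists (U', V') => //; split=> // -[a b] /= [/U'U Ua /V'V Vb].
  exact: UVE.
apply: countable_bigcup_measurable => [|[U V] [/= BU BV _]].
  apply: (@sub_countable _ _ _ (B `*` B)); last exact: countableX.
  by apply: subset_card_le => -[U V] [].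
by apply: measurableX; apply: borel_open; exact: oB.
Qed.

End sigma_finiteness.

Section averaging.
Context {R : realType} {G : lcscGroupType} (m : radon R G).
Hypotheses (m_haar : haar m) (m_sigma : sigma_finite [set: borel G] m).

Lemma haar_ltrans g (A : set G) : m (ltrans g A) = m A.
Proof. by rewrite ltransE -[in RHS](m_haar.2 g^-1%g). Qed.

Local Open Scope ereal_scope.

(** Double counting: for [A' D] inside [A], integrate [F y] over the pairs of a
    point [y] of [A'] and a point [x] of [y D]. Summing over [x] first gives the
    mass of [D] times the integral over [A'], because the mass is left
    invariant; summing over [y] first gives at most the integrals of [F] over
    the sets [x D] with [x] in [A], because [D] is symmetric. *)
Lemma averaging (F : G -> R) (A A' D : set G) (a : R) :
  measurable_fun [set: borel G] (F : borel G -> R) -> (forall x, (0 <= F x)%R) ->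
  measurable (A : set (borel G)) -> measurable (A' : set (borel G)) ->
  open D -> (forall x, D x -> D x^-1%g) -> 0 < m D -> m D < +oo ->
  (forall x z, A' x -> D z -> A (x * z)%g) -> (0 <= a)%R ->
  (forall g, \int[m]_(x in ltrans g D) (F x)%:E <= a%:E * m D) ->
  \int[m]_(x in A') (F x)%:E <= a%:E * m A.
Proof.
move=> mF F0 mA mA' oD Dinv D0 Doo AD a0 H.
pose E := [set z : G * G | D (z.1^-1 * z.2)%g].
have mE : measurable (E : set (borel G * borel G)).
  apply: open_prod_measurable.
  apply: (@open_comp _ _ (fun z : G * G => (z.1^-1 * z.2)%g)) => // z _.
  apply: (@continuous_comp _ _ _ (fun z : G * G => (z.1^-1%g, z.2))
     (fun z : G * G => (z.1 * z.2)%g)); last exact: mulg_continuous.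
  apply: cvg_pair; last exact: cvg_snd.
  apply: (@continuous_comp _ _ _ (fun z : G * G => z.1) (fun x : G => x^-1%g)).
    exact: cvg_fst.
  exact: invg_continuous.
pose h (z : borel G * borel G) := (F z.1 * \1_A' z.1 * (\1_A z.2 * \1_E z))%R%:E : \bar R.
have h0 z : 0 <= h z by rewrite lee_fin !mulr_ge0.
have mh : measurable_fun setT h.
  apply/measurable_EFinP; apply: measurable_funM; apply: measurable_funM.
  - exact: measurableT_comp.
  - by apply: measurableT_comp => //; exact: measurable_indic.
  - by apply: measurableT_comp => //; exact: measurable_indic.
  - exact: measurable_indic.
have xD g : measurable (ltrans g D : set (borel G)) by apply: borel_open; exact: open_ltrans.
have indicE' (y x : G) : (\1_E (y, x) = \1_(ltrans y D) x :> R)%R.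
  by rewrite !indicE; congr ((nat_of_bool _)%:R); apply/idP/idP => /set_mem Exy; apply/mem_set;
    move: Exy; rewrite ltransE.
have indicE2 (y x : G) : (\1_E (y, x) = \1_(ltrans x D) y :> R)%R.
  rewrite !indicE; congr ((nat_of_bool _)%:R); apply/idP/idP => /set_mem Exy; apply/mem_set;
    move: Exy; rewrite ltransE /E/= => /Dinv; by rewrite invgM invgK.
have intS (S : set G) : \int[m]_y (F y * \1_S y)%:E = \int[m]_(y in S) (F y)%:E.
  rewrite [RHS]integral_mkcond; apply: eq_integral => y _.
  by rewrite patchE indicE; case: ifP; rewrite (mulr1, mulr0).
have mFS (S : set G) : measurable (S : set (borel G)) ->
    measurable_fun [set: borel G] (fun y : borel G => (F y * \1_S y)%:E : \bar R).
  by move=> mS; apply/measurable_EFinP; apply: measurable_funM => //; exact: measurable_indic.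
have inner1 (y : G) : \int[m]_x h (y, x) = (F y * \1_A' y)%:E * m D.
  rewrite -(haar_ltrans y D).
  rewrite (eq_integral (fun x : borel G => (F y * \1_A' y)%:E * (\1_(ltrans y D) x)%:E)).
    rewrite ge0_integralZl//; last 2 first.
    - by apply/measurable_EFinP; exact: measurable_indic.
    - by rewrite lee_fin mulr_ge0.
    by rewrite integral_indic// setIT.
  move=> x _; rewrite /h/= -EFinM indicE' [(\1_A' y)%R]indicE.
  case: (boolP (y \in A')) => [/set_mem A'y|_]; last by rewrite mulr0 !mul0r.
  congr (_ * _)%:E%R; rewrite !indicE; case: (boolP (x \in ltrans y D)) => [/set_mem [z Dz <-]|_].
    by rewrite mem_set ?mulr1//; exact: AD.
  by rewrite mulr0.
have inner2 (x : G) : \int[m]_y h (y, x) <= (a%:E * m D) * (\1_A x)%:E.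
  rewrite muleC; apply: (@le_trans _ _ ((\1_A x)%:E * \int[m]_(y in ltrans x D) (F y)%:E)); last first.
    by apply: lee_pmul => //; rewrite ?lee_fin//; apply: integral_ge0 => y _; rewrite lee_fin.
  rewrite -intS -ge0_integralZl//; last 2 first.
  - by apply: mFS; exact: xD.
  - by move=> y _; rewrite lee_fin mulr_ge0.
  apply: ge0_le_integral => //.
  - apply: (@measurable_fun_pair1 _ _ _ (borel G) (borel G) (\bar R) h (x : borel G)).
    exact: mh.
  - by apply: measurable_funeM; apply: mFS; exact: xD.
  move=> y _; rewrite /h/= indicE2 lee_fin [leRHS]mulrCA; apply: ler_pM; rewrite ?mulr_ge0//.
  by rewrite ler_piMr// indicE; case: (_ \in _).
have := @fubini_tonelli _ _ _ _ R (sigma_radon m_sigma) (sigma_radon m_sigma) h mh h0.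
have -> : \int[sigma_radon m_sigma]_x \int[sigma_radon m_sigma]_y h (x, y) =
    m D * \int[m]_(x in A') (F x)%:E.
  rewrite -intS -ge0_integralZl//; last 2 first.
  - exact: mFS.
  - by move=> y _; rewrite lee_fin mulr_ge0.
  by apply: eq_integral => y _; rewrite muleC -inner1.
move=> E1.
have {E1} : m D * \int[m]_(x in A') (F x)%:E <= m D * (a%:E * m A).
  rewrite E1.
  apply: (@le_trans _ _ (\int[m]_x ((a%:E * m D) * (\1_A x)%:E))).
    apply: ge0_le_integral => //.
    - by move=> x _; apply: integral_ge0.
    - exact: (measurable_fun_fubini_tonelli_G (m1 := sigma_radon m_sigma) h mh h0).
    - by apply: measurable_funeM; apply/measurable_EFinP; exact: measurable_indic.
  rewrite ge0_integralZl//; last 2 first.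
  - by apply/measurable_EFinP; exact: measurable_indic.
  - by rewrite mule_ge0// lee_fin.
  by rewrite integral_indic// setIT muleCA muleA.
by rewrite lee_pmul2l// ge0_fin_numE.
Qed.

End averaging.

(** * Close patches *)

Section delta_measure_values.
Context {R : realType} {G : lcscGroupType} (L : weighted_delone R G).
Implicit Types (A S : set G) (f : test_function R G).

Lemma points_weight_ge0 x : points L x -> 0 <= weight L x.
Proof. by move=> /weight_ge0; rewrite lee_fin. Qed.

Lemma delta_measure0 A : (forall x, points L x -> ~ A x) -> delta_measure L A = 0%E.
Proof.
move=> H; rewrite /= /delta_fun (_ : _ `&` _ = set0) ?esum_set0//.
by apply/seteqP; split=> // x [/H].
Qed.

Lemma delta_measure1 A x : points L x -> A x -> (forall y, points L y -> A y -> y = x) ->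
  delta_measure L A = (weight L x)%:E.
Proof.
move=> Lx Ax H; rewrite /= /delta_fun (_ : _ `&` _ = [set x]).
  by rewrite esum_set1//; exact: weight_ge0.
by apply/seteqP; split=> [y [Ly Ay]|_ -> //]; exact: H.
Qed.

Lemma delta_measure_ge A x : points L x -> A x -> ((weight L x)%:E <= delta_measure L A)%E.
Proof.
move=> Lx Ax; apply: esum_ge; exists [set x]; last by rewrite fsbig_set1.
by split=> // _ ->.
Qed.

(** The sum runs over any set [S] that contains the support, so that one index
    set can serve several test functions. *)
Lemma delta_pairing f S : finite_set (points L `&` S) -> (forall x, f x != 0 -> S x) ->
  radon_pairing (delta_measure L) f = \sum_(p \in points L `&` S) weight L p * f p.
Proof.
set A := points L `&` S => finA fS.
have mset1 (p : G) : measurable ([set p] : set (borel G)).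
  by apply: borel_compact; [exact: lcsc_hausdorff|exact: compact_set1].
have I1 p : (delta_measure L).-integrable [set: borel G]
    (fun x : borel G => (\1_[set p] x)%:E).
  apply/integrableP; split; first by apply/measurable_EFinP; exact: measurable_indic.
  under eq_integral do rewrite gee0_abs ?lee_fin//.
  by rewrite integral_indic// setIT; apply: radon_compact; exact: compact_set1.
have Ip p : (delta_measure L).-integrable [set: borel G]
    (fun x : borel G => (f p * \1_[set p] x)%:E).
  by apply: eq_integrable (integrableZl _ (f p) (I1 p)).
apply: EFin_inj; rewrite EFin_pairing.
transitivity (\int[delta_measure L]_(x in [set: borel G])
    (\sum_(p <- fset_set A) (f p * \1_[set p] x)%:E))%E.
  apply: ae_eq_integral => //.
  - by apply/measurable_EFinP; exact: test_measurable.
  - apply: emeasurable_sum => p; apply/measurable_EFinP.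
    by apply: measurable_funM => //; exact: measurable_indic.
  exists ([set x | f x != 0] `&` ~` A); split.
  - apply: measurableI.
      apply: borel_open; apply: (@open_comp _ _ f [set r | r != 0]).
        by move=> x _; exact: test_continuous.
      exact: open_neq.
    apply: measurableC; apply: borel_closed; apply: compact_closed; first exact: lcsc_hausdorff.
    exact: finite_compact.
  - by apply: delta_measure0 => x Lx [/fS Sx]; apply; split.
  - move=> x /= /not_implyP[_ H]; split.
      apply/negP => /eqP fx; apply: H; rewrite fx big1// => p _.
      by rewrite indicE; case: (boolP (x \in [set p])) => [/set_mem/= <-|_]; rewrite ?fx ?mul0r ?mulr0.
    move=> Ax; apply: H.
    rewrite (big_rem x)/=; last by rewrite in_fset_set// mem_set.
    rewrite indicE mem_set// mulr1 big_seq big1 ?adde0// => p.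
    rewrite mem_rem_uniq ?fset_uniq// inE => /andP[px _].
    by rewrite indicE memNset ?mulr0// => /= xp; rewrite xp eqxx in px.
rewrite integral_sum//.
rewrite fsbig_finite//= -sumEFin; apply: eq_big_seq => p.
rewrite in_fset_set// => /set_mem[Lp _].
under eq_integral do rewrite EFinM.
rewrite integralZl// integral_indic// setIT (@delta_measure1 _ p)// -?EFinM 1?mulrC//.
Qed.

Lemma delone_separated {d0 : G -> G -> R} (ad : adapted d0)
    (cd : continuous (fun z : G * G => d0 z.1 z.2)) :
  exists2 r : R, 0 < r & forall x y, points L x -> points L y -> d0 x y < r -> x = y.
Proof.
have [[U [oU [u Uu] _ U1]] _] := points_delone L.
have nV : nbhs (1%g : G) (ltrans u^-1%g U).
  apply: open_nbhs_nbhs; split; first exact: open_ltrans.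
  by exists u => //; rewrite mulVg.
have [r r0 Hr] := metric_ball_basis ad cd nV.
exists r => // x y Lx Ly xy.
have : ltrans u^-1%g U (x^-1 * y)%g.
  apply: Hr; rewrite -(adapted_left_invariant ad x) mulVKg mulg1.
  by rewrite (Defs.metric_sym (adapted_metric ad)).
move=> [z Uz zE]; apply: (U1 (x * u^-1)%g); split=> //.
  by exists u => //; rewrite mulgVK.
by exists z => //; rewrite -mulgA zE mulVKg.
Qed.

End delta_measure_values.

Section patch_matching.
Context {R : realType} {G : lcscGroupType} {d0 : G -> G -> R}.
Context (ad0 : adapted d0) (cd0 : continuous (fun z : G * G => d0 z.1 z.2)).
Context (L : weighted_delone R G).

Let md0 := adapted_metric ad0.

Lemma cball_atE (t : R) y x : cball_at d0 t y x <-> d0 x y < t.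
Proof.
rewrite /cball_at ltransE /cball/= -(adapted_left_invariant ad0 y).
by rewrite mulVKg mulg1.
Qed.

(** A ball whose radius is below the separation scale holds at most one point of
    each patch. If the ball about a point of one patch held no point of the
    other, the two masses would differ by a weight, which is at least [s^-1] and
    hence more than the patch distance allows. *)
Lemma patch_match (s r e : R) (g : G) (S : set G) : 1 <= s ->
  (forall x, points L x -> s^-1 <= weight L x <= s) ->
  (forall x y, points L x -> points L y -> d0 x y < r -> x = y) ->
  0 < e -> e + e <= r -> e <= s^-1 ->
  let p := patch_translate g (patch_of L S) in
  (patch_dist d0 (patch_support p) (patch_measure p)
     (restriction L (patch_support p)) < e%:E)%E ->
  (forall x, points L x -> S x -> exists y, [/\ points L y, ltrans g S y,
     d0 (g * x)%g y < e & `|weight L x - weight L y| < e]) /\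
  (forall y, points L y -> ltrans g S y -> exists x,
    [/\ points L x, S x & d0 (g * x)%g y < e]).
Proof.
move=> s1 Hs Hr e0 er es p /ereal_inf_lt[_ [e1 [e10 He1] <-]]; rewrite lte_fin => e1e.
pose mu A := delta_measure L ((fun x => (g * x)%g) @^-1` A `&` S).
have s0 : 0 < s by lra.
have wpos x : points L x -> 0 < weight L x.
  by move=> /Hs/andP[+ _]; apply: lt_le_trans; rewrite invr_gt0.
have {}He1 y : ltrans g S y ->
    (forall U : set G, open U -> U y -> (0 < mu U)%E) \/
    (forall U : set G, open U -> U y -> (0 < delta_measure L (U `&` ltrans g S))%E) ->
    (`|mu (cball_at d0 e1 y) - delta_measure L (cball_at d0 e1 y `&` ltrans g S)| < e1%:E)%E.
  by move=> gSy H; apply: He1.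
have muE x y : points L x -> S x -> d0 (g * x)%g y < e1 ->
    mu (cball_at d0 e1 y) = (weight L x)%:E.
  move=> Lx Sx xy; apply: delta_measure1 => //; first by split=> //=; apply/cball_atE.
  move=> z Lz [/= /cball_atE zy Sz]; apply: Hr => //.
  rewrite -(adapted_left_invariant ad0 g).
  have := Defs.metric_triangle md0 (g * z)%g y (g * x)%g.
  by rewrite (Defs.metric_sym md0 y); lra.
have nuE y y' : points L y -> ltrans g S y -> d0 y' y < e1 ->
    delta_measure L (cball_at d0 e1 y' `&` ltrans g S) = (weight L y)%:E.
  move=> Ly Sy yy'; apply: delta_measure1 => //.
    by split=> //; apply/cball_atE; rewrite (Defs.metric_sym md0).
  move=> z Lz [/cball_atE zy Sz]; apply: Hr => //.
  by have := Defs.metric_triangle md0 z y' y; lra.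
split=> [x Lx Sx|y Ly Sy].
  have gx : ltrans g S (g * x)%g by exists x.
  have sx U : open U -> U (g * x)%g -> (0 < mu U)%E.
    move=> _ Ux; apply: (@lt_le_trans _ _ (weight L x)%:E); first by rewrite lte_fin wpos.
    by apply: delta_measure_ge => //; split.
  have dx : d0 (g * x)%g (g * x)%g < e1 by rewrite (adapted_dist0 ad0).
  have := He1 _ gx (or_introl sx); rewrite (muE x)//.
  have [[y [Ly Sy yx]]|ny] := pselect (exists y, [/\ points L y, ltrans g S y & d0 (g * x)%g y < e1]).
    rewrite (nuE y)// -EFinB /= lte_fin => H.
    by exists y; split=> //; lra.
  rewrite delta_measure0 ?sube0/= ?lte_fin.
    rewrite gtr0_norm ?wpos// => xe1; have /andP[xs _] := Hs _ Lx; lra.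
  move=> y Ly [/cball_atE yx Sy]; apply: ny; exists y; split=> //.
  by rewrite (Defs.metric_sym md0).
have sy U : open U -> U y -> (0 < delta_measure L (U `&` ltrans g S))%E.
  move=> _ Uy; apply: (@lt_le_trans _ _ (weight L y)%:E); first by rewrite lte_fin wpos.
  by apply: delta_measure_ge => //; split.
have dy : d0 y y < e1 by rewrite (adapted_dist0 ad0).
have := He1 _ Sy (or_intror sy); rewrite (nuE y)//.
have [[x [Lx Sx xy]]|nx] := pselect (exists x, [/\ points L x, S x & d0 (g * x)%g y < e1]).
  by move=> _; exists x; split=> //; lra.
rewrite /mu delta_measure0 ?sub0e ?abseN/= ?lte_fin.
  rewrite gtr0_norm ?wpos// => ye1; have /andP[ys _] := Hs _ Ly; lra.
by move=> x Lx [/= /cball_atE xy Sx]; apply: nx; exists x.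
Qed.

Lemma precompact_points_finite (S : set G) : precompact S -> finite_set (points L `&` S).
Proof.
move=> [K SK [cK _]]; apply: sub_finite_set (delone_finite L cK) => x [Lx /SK Kx].
by split.
Qed.

(** Matched points are close and have close weights, so that by uniform continuity
    they contribute nearly the same to the two sums; the number of contributing
    points is bounded through the pairing with a plateau function. The margin
    [rho] keeps the support of [f], translated to [y], inside the patch. *)
Lemma patch_close (d : G -> G -> R) (ad : adapted d) (f : test_function R G) (e : R) : 0 < e ->
  exists2 e0 : R, 0 < e0 & exists2 rho : R, 0 < rho & forall delta x g r,
    let p := patch_translate g (patch_of L (ltrans x (cball d r))) in
    0 < delta <= e0 ->
    (patch_dist d0 (patch_support p) (patch_measure p)
       (restriction L (patch_support p)) < delta%:E)%E ->
    forall y, cball_at d (r - rho) x y ->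
    `|radon_pairing (radon_translate y^-1%g (delta_measure L)) f -
      radon_pairing (radon_translate (g * y)^-1%g (delta_measure L)) f| <= e.
Proof.
move=> epos.
have [t t0 ft] := test_function_bounded_support ad0 f.
pose psi := plateau ad0 cd0 (t + 1).
have [s s1 Hs] := weight_bounded L.
have [r0 r00 Hr0] := delone_separated L ad0 cd0.
have [M M0 HM] := test_function_bounded f.
have [c c0 Hc] := hull_pairing_bounded L (plateau_ge0 ad0 cd0 (t + 1)).
have s0 : 0 < s by lra.
pose e1 := e / (2 * (c + 1)).
have e10 : 0 < e1 by rewrite divr_gt0//; lra.
have [r1 r10 Hr1] := test_function_uniform_right ad0 cd0 ft e10.
have [rho rho0 Hrho] := compact_adapted_bounded ad (@compact_metric_ball _ _ _ ad0 cd0 (t + 2)).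
pose e2 := e1 / (M * s + 1).
have Ms0 : 0 <= M * s by rewrite mulr_ge0// ltW.
have e20 : 0 < e2 by rewrite divr_gt0//; lra.
exists (Num.min 1 (Num.min (r0 / 2) (Num.min s^-1 (Num.min r1 e2)))).
  by rewrite !lt_min ltr01 invr_gt0 s0 r10 e20 divr_gt0.
exists rho => // delta x g r p; rewrite !le_min => /andP[del0 /and5P[del1 delr dels delr1 del2]] Hp y Hy.
set S := ltrans x (cball d r) in p Hp.
have pS : precompact S by apply: precompact_ltrans; exact: adapted_proper.
have pgS : precompact (ltrans g S) by exact: precompact_ltrans.
have := @patch_match s r0 delta g S s1 Hs Hr0 del0.
case=> // [|Hmatch Hmatch']; first lra.
have near_y z : d0 z 1%g <= t + 2 -> S (y * z)%g.
  move=> /Hrho zrho; rewrite /S ltransE/= /cball/= mulgA.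
  move: Hy; rewrite /cball_at ltransE /cball/= => Hy.
  by apply: le_lt_trans (adapted_size_mul ad _ _) _; move: zrho; rewrite /cball/=; lra.
have psiS z : psi (y^-1 * z)%g != 0 -> S z.
  move=> /eqP psiz; rewrite -(mulVKg y z); apply: near_y.
  rewrite leNgt; apply/negP => H; apply: psiz.
  rewrite /psi /plateau/= /plateau_fun (max_idPl _)// ge_min; apply/orP; right; lra.
have fS z : f (y^-1 * z)%g != 0 -> S z.
  by move=> /ft H; rewrite -(mulVKg y z); apply: near_y; lra.
have fgS z : f ((g * y)^-1 * z)%g != 0 -> ltrans g S z.
  rewrite invgM -mulgA => /fS Sz; exists (g^-1 * z)%g => //.
  by rewrite mulVKg.
have E1 (h : test_function R G) : (forall z, h (y^-1 * z)%g != 0 -> S z) ->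
    radon_pairing (radon_translate y^-1%g (delta_measure L)) h =
    \sum_(q \in points L `&` S) weight L q * h (y^-1 * q)%g.
  by move=> hS; rewrite pairing_translate (@delta_pairing _ _ _ _ S)//; exact: precompact_points_finite.
rewrite (E1 f)// pairing_translate (@delta_pairing _ _ _ _ (ltrans g S))//; last first.
  exact: precompact_points_finite.
have /choice[mt Hmt] : forall q, exists q', points L q -> S q ->
    [/\ points L q', ltrans g S q', d0 (g * q)%g q' < delta &
    `|weight L q - weight L q'| < delta].
  move=> q; have [[Lq Sq]|nq] := pselect (points L q /\ S q).
    by have [q' ?] := Hmatch _ Lq Sq; exists q'.
  by exists q => Lq Sq; exfalso; apply: nq.
rewrite (reindex_fsbig mt (points L `&` S) (points L `&` ltrans g S)); last first.
  split.
  - move=> q [Lq Sq]; by case: (Hmt _ Lq Sq).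
  - move=> q q' /set_mem[Lq Sq] /set_mem[Lq' Sq'] qq'; apply: Hr0 => //.
    have [_ _ H1 _] := Hmt _ Lq Sq; have [_ _ H2 _] := Hmt _ Lq' Sq'.
    rewrite -(adapted_left_invariant ad0 g).
    have := Defs.metric_triangle md0 (g * q)%g (mt q) (g * q')%g.
    by move: H2; rewrite -qq' (Defs.metric_sym md0 (mt q)); lra.
  - move=> q' [Lq' Sq']; have [q [Lq Sq qq']] := Hmatch' _ Lq' Sq'.
    have [Lm _ H1 _] := Hmt _ Lq Sq.
    exists q => //; apply: Hr0 => //.
    have := Defs.metric_triangle md0 (mt q) (g * q)%g q'.
    by rewrite (Defs.metric_sym md0 (mt q) (g * q)%g); lra.
have finS := precompact_points_finite pS.
have bound : \sum_(q \in points L `&` S) weight L q * psi (y^-1 * q)%g <= c.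
  by rewrite -(E1 psi)//; apply: Hc; exact: hull_orbit.
rewrite !fsbig_finite//= -sumrB; apply: le_trans (ler_norm_sum _ _ _) _.
apply: (@le_trans _ _ (\sum_(q <- fset_set (points L `&` S)) 2 * e1 * (weight L q * psi (y^-1 * q)%g))).
  rewrite big_seq [leRHS]big_seq; apply: ler_sum => q.
  rewrite in_fset_set// => /set_mem[Lq Sq].
  have [Lm Sm dm wm] := Hmt _ Lq Sq.
  set u := (y^-1 * q)%g; set u' := (_ * mt q)%g.
  have uu' : d0 u u' < delta.
    by rewrite -(adapted_left_invariant ad0 (g * y)%g) /u /u' mulVKg -mulgA mulVKg.
  have H1 : `|f u' - f u| <= e1 * psi u by apply: Hr1; exact: lt_le_trans uu' _.
  have /andP[ws _] := Hs _ Lq.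
  have w0 := points_weight_ge0 Lq.
  have H2 : `|weight L q - weight L (mt q)| * `|f u'| <= e1 * (weight L q * psi u).
    have [->|fu'] := eqVneq (f u') 0.
      rewrite normr0 mulr0; apply: mulr_ge0; first exact: ltW.
      by apply: mulr_ge0 => //; exact: plateau_ge0.
    have /ft u't := fu'.
    have -> : psi u = 1.
      apply: plateau1; have := adapted_le_size ad0 u u'; lra.
    rewrite mulr1; apply: (@le_trans _ _ (e2 * M)).
      by apply: ler_pM => //; lra.
    apply: (@le_trans _ _ (e1 * s^-1)); last by rewrite ler_wpM2l// ltW.
    rewrite /e2 -mulrA ler_wpM2l ?(ltW e10)// mulrC ler_pdivrMr; last lra.
    by rewrite mulrDr mulr1 mulrCA mulVf ?gt_eqF// mulr1 lerDl invr_ge0 ltW.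
  have -> : weight L q * f u - weight L (mt q) * f u' =
      weight L q * (f u - f u') + (weight L q - weight L (mt q)) * f u' by ring.
  apply: le_trans (ler_normD _ _) _; rewrite !normrM (ger0_norm w0) (distrC (f u)).
  have : weight L q * `|f u' - f u| <= weight L q * (e1 * psi u) by rewrite ler_wpM2l.
  lra.
rewrite -mulr_sumr; move: bound; rewrite fsbig_finite//= => bound.
apply: (@le_trans _ _ (2 * e1 * c)); first by rewrite ler_wpM2l// mulr_ge0// ltW.
rewrite /e1; have -> : 2 * (e / (2 * (c + 1))) * c = e * (c / (c + 1)).
  by field; lra.
by rewrite ler_piMr ?(ltW epos)// ler_pdivrMr; lra.
Qed.

End patch_matching.

(** * Balls and growth *)

Section growth.
Context {R : realType} {G : lcscGroupType} {d : G -> G -> R} (ad : adapted d).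
Context (m : radon R G) (m_haar : haar m).

(** Balls of an adapted metric may fail to be Borel. Their interiors have the
    same growth and still form a symmetric multiplicative filtration. *)
Definition oball (t : R) : set G := (cball d t)°.

Lemma oball_open t : open (oball t).
Proof. exact: open_interior. Qed.

Lemma oball_sub t : oball t `<=` cball d t.
Proof. exact: interior_subset. Qed.

Lemma oball_precompact t : precompact (oball t).
Proof. exact: precompact_subset (@oball_sub t) (adapted_proper ad t). Qed.

Lemma ltrans_precompact_finite g (A : set G) : precompact A -> (m (ltrans g A) < +oo)%E.
Proof.
move=> pA; have [K AK [cK _]] := precompact_ltrans g pA.
apply: le_lt_trans (radon_compact m cK).
rewrite [leLHS]radon_outer [leRHS]radon_outer.
apply: ereal_inf_le_tmp => _ [U [oU KU] <-]; exists U => //.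
by split=> //; exact: subset_trans KU.
Qed.

Lemma precompact_finite (A : set G) : precompact A -> (m A < +oo)%E.
Proof.
move=> /(ltrans_precompact_finite 1%g); congr (m _ < _)%E.
by rewrite ltransE; apply/seteqP; split=> x /=; rewrite invg1 mul1g.
Qed.

Lemma radon_homo (A B : set G) : A `<=` B -> (m A <= m B)%E.
Proof.
move=> AB; rewrite [leLHS]radon_outer [leRHS]radon_outer.
apply: ereal_inf_le_tmp => _ [U [oU KU] <-]; exists U => //.
by split=> //; exact: subset_trans KU.
Qed.

Lemma oball_inv t x : oball t x -> oball t x^-1%g.
Proof.
rewrite /oball /interior /= => nx.
have cn : nbhs (x^-1%g : G) ((fun y : G => y^-1%g) @^-1` (cball d t)).
  by apply: invg_continuous; rewrite invgK.
apply: filterS cn => y /=; rewrite /cball/= => yt.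
by rewrite -(adapted_size_inv ad).
Qed.

Lemma cball_mul s t x y : cball d s x -> cball d t y -> cball d (s + t) (x * y)%g.
Proof.
by rewrite /cball/= => xs yt; have := adapted_size_mul ad x y; lra.
Qed.

Lemma oball_mul s t x y : oball s x -> oball t y -> oball (s + t) (x * y)%g.
Proof.
move=> sx; rewrite /oball /interior/= => ty.
have : nbhs (x * y)%g (ltrans x (cball d t)).
  have : {for (x * y)%g, continuous (fun z => (x^-1 * z)%g)} by exact: lmul_continuous.
  by rewrite ltransE => /(_ (cball d t)); rewrite /= mulKg; exact.
apply: filterS => _ [z tz <-]; apply: cball_mul => //; exact: oball_sub.
Qed.

(** Local boundedness gives the identity a neighbourhood of finite diameter, so
    that interiors contain the balls whose radius is smaller by a constant. *)
Lemma cball_oball : exists2 r0 : R, 0 < r0 & forall t, cball d (t - r0) `<=` oball t.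
Proof.
have [V nV [M HM]] := adapted_locally_bounded ad 1%g.
exists (`|M| + 1); first by have := normr_ge0 M; lra.
move=> t x xt; rewrite /oball /interior/=.
have : nbhs x ((fun z => (x^-1 * z)%g) @^-1` V).
  by apply: lmul_continuous; rewrite mulVg.
apply: filterS => z /= Vz; rewrite -(mulVKg x z) /cball/=.
have := adapted_size_mul ad x (x^-1 * z)%g.
have := HM _ _ Vz (nbhs_singleton nV); have := ler_norm M.
by move: xt; rewrite /cball/=; lra.
Qed.

Definition oball_measure (t : R) : R := fine (m (oball t)).

Lemma oball_measureE t : (oball_measure t)%:E = m (oball t).
Proof. by rewrite fineK// ge0_fin_numE// precompact_finite//; exact: oball_precompact. Qed.

Lemma oball_homo s t : s <= t -> oball s `<=` oball t.
Proof.
move=> st x; rewrite /oball /interior/=; apply: filterS => y.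
by rewrite /cball/=; lra.
Qed.

Lemma powR_continuous (q c : R) : 0 < c -> x `^ q @[x --> c] --> c `^ q.
Proof.
move=> c0.
have cont : {for c, continuous (fun x : R => expR (q * ln x))}.
  apply: (@continuous_comp _ _ _ (fun x : R => q * ln x) expR); last exact: continuous_expR.
  by apply: cvgM; [exact: cvg_cst|exact: continuous_ln].
have -> : c `^ q = expR (q * ln c) by rewrite /powR gt_eqF.
apply: cvg_trans cont; apply: near_eq_cvg.
have : \forall x \near c, 0 < x by exact: lt_nbhsr.
by apply: filterS => x x0; rewrite /powR gt_eqF.
Qed.

Lemma affine_growth (q c k : R) : 0 < c ->
  ((c * r + k) / r) `^ q @[r --> +oo] --> c `^ q.
Proof.
move=> c0.
have H : (c * r + k) / r @[r --> +oo] --> c.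
  have Hinv : (r : R)^-1 @[r --> +oo] --> 0.
    by apply/gtr0_cvgV0; [exact: nbhs_pinfty_gt|exact: cvg_id].
  have H0 : c + k * r^-1 @[r --> +oo] --> c + k * 0.
    by apply: cvgD; [exact: cvg_cst|apply: cvgM => //; exact: cvg_cst].
  rewrite mulr0 addr0 in H0.
  apply: cvg_trans H0; apply: near_eq_cvg.
  have : \forall r \near (+oo : set_system R), 0 < r by apply: nbhs_pinfty_gt; exact: num_real.
  by apply: filterS => r r0; rewrite mulrDl -mulrA mulfV ?gt_eqF// mulr1.
apply: (@cvg_comp _ _ _ (fun r : R => (c * r + k) / r) (fun x : R => x `^ q) _ _ _ H).
exact: powR_continuous.
Qed.

Section exact_growth.
Context (C q : R) (C0 : 0 < C)
  (Hlim : (m (cball d t) * ((C * t `^ q)^-1)%:E)%E @[t --> +oo] --> 1%E).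

(** The form of exact polynomial growth used below: a change of the radius by a
    constant does not affect the leading term. *)
Lemma cball_growth (c k : R) : 0 < c ->
  fine (m (cball d (c * r + k))) / (C * r `^ q) @[r --> +oo] --> c `^ q.
Proof.
move=> c0.
have H1 : fine (m (cball d t)) / (C * t `^ q) @[t --> +oo] --> (1 : R).
  move/fine_cvgP : Hlim => [_]; apply: cvg_trans; apply: near_eq_cvg.
  apply: nearW => t /=; rewrite fineM// ge0_fin_numE// precompact_finite//.
  exact: adapted_proper.
have Hc : c * r + k @[r --> +oo] --> (+oo : set_system R).
  apply/cvgryPge => A; near=> r.
  have : (A - k) / c <= r by near: r; apply: nbhs_pinfty_ge; exact: num_real.
  by rewrite ler_pdivrMr//; lra.
have H3 : fine (m (cball d (c * r + k))) / (C * (c * r + k) `^ q) *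
    ((c * r + k) / r) `^ q @[r --> +oo] --> 1 * c `^ q.
  by apply: cvgM; [exact: (cvg_comp _ _ Hc H1)|exact: affine_growth].
rewrite mul1r in H3; apply: cvg_trans H3; apply: near_eq_cvg.
near=> r.
have r0 : 0 < r by near: r; apply: nbhs_pinfty_gt; exact: num_real.
have cr0 : 0 < c * r + k.
  have : - k / c < r by near: r; apply: nbhs_pinfty_gt; exact: num_real.
  by rewrite ltr_pdivrMr//; lra.
have TE : (c * r + k) `^ q = ((c * r + k) / r) `^ q * r `^ q.
  by rewrite -powRM ?ltW ?divr_gt0// mulfVK// gt_eqF.
have x0 : ((c * r + k) / r) `^ q != 0 by rewrite gt_eqF// powR_gt0// divr_gt0.
have y0 : r `^ q != 0 by rewrite gt_eqF// powR_gt0.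
rewrite /= TE; move: (fine _) => z; field.
by rewrite x0 y0 gt_eqF.
Unshelve. all: by end_near. Qed.

Lemma oball_growth (c k : R) : 0 < c ->
  oball_measure (c * r + k) / (C * r `^ q) @[r --> +oo] --> c `^ q.
Proof.
move=> c0; have [r0 r00 Hr0] := cball_oball.
apply: (@squeeze_cvgr _ _ _ _ (fun r => fine (m (cball d (c * r + (k - r0)))) / (C * r `^ q))
   (fun r => fine (m (cball d (c * r + k))) / (C * r `^ q))); [|exact: cball_growth|exact: cball_growth].
near=> r.
have w0 : 0 <= (C * r `^ q)^-1 by rewrite invr_ge0 mulr_ge0 ?powR_ge0// ltW.
have fin t : (m (cball d t) \is a fin_num)%E.
  by rewrite ge0_fin_numE// precompact_finite//; exact: adapted_proper.
have fin' t : (m (oball t) \is a fin_num)%E by rewrite -oball_measureE.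
apply/andP; split; rewrite ler_wpM2r// fine_le//; apply: radon_homo.
  by rewrite addrA; exact: Hr0.
exact: oball_sub.
Unshelve. all: by end_near. Qed.

Lemma oball_measure_gt0 : \forall t \near (+oo : set_system R), 0 < oball_measure t.
Proof.
have H := @oball_growth 1 0 ltr01; rewrite powR1 in H.
have H1 : \forall r \near (+oo : set_system R), 0 < oball_measure (1 * r + 0) / (C * r `^ q).
  by apply: (cvgr_gt _ H); exact: ltr01.
near=> r; have : 0 < oball_measure (1 * r + 0) / (C * r `^ q) by near: r.
rewrite mul1r addr0 pmulr_lgt0// invr_gt0 mulr_gt0// powR_gt0//.
Unshelve. all: by end_near. Qed.

End exact_growth.
End growth.

(** * Local functions *)

Section local_functions.
Context {R : realType} {G : lcscGroupType}.
Implicit Types (mu nu : radon R G) (phi : test_function R G) (f : radon R G -> R).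

(** Uniformly continuous functions of finitely many pairings. They are
    numerous enough to separate probabilities on the hull, while their values
    along the orbit are controlled by patches. *)
Definition local_function f := exists s : seq (test_function R G),
  forall e, 0 < e -> exists2 delta, 0 < delta & forall mu nu,
    (forall phi, phi \in s -> `|radon_pairing mu phi - radon_pairing nu phi| <= delta) ->
    `|f mu - f nu| <= e.

Lemma local_function_onem f : local_function f -> local_function (fun mu => 1 - f mu).
Proof.
move=> [s Hs]; exists s => e /Hs[delta d0 H]; exists delta => // mu nu /H.
by rewrite (_ : 1 - f mu - (1 - f nu) = f nu - f mu) 1?distrC//; ring.
Qed.

Lemma local_function_near (A : Type) (F : set_system A) (mu_ nu_ : A -> radon R G) f e :
  Filter F -> local_function f -> 0 < e ->
  (forall phi delta, 0 < delta -> \forall a \near F,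
    `|radon_pairing (mu_ a) phi - radon_pairing (nu_ a) phi| <= delta) ->
  \forall a \near F, `|f (mu_ a) - f (nu_ a)| <= e.
Proof.
move=> FF [s Hs] /Hs[delta d0 H] near_pairing.
suff : \forall a \near F, forall phi, phi \in s ->
    `|radon_pairing (mu_ a) phi - radon_pairing (nu_ a) phi| <= delta.
  by apply: filterS => a; exact: H.
elim: s {Hs H} => [|phi s IH]; first by near=> a.
have := near_pairing phi delta d0; apply: filterS2 IH => a H1 H2 psi.
by rewrite inE => /orP[/eqP ->//|]; exact: H1.
Unshelve. all: by end_near. Qed.

Lemma local_function_continuous f : local_function f -> continuous f.
Proof.
move=> lf mu; apply: (iffRL (@cvgrPdist_le _ _ _ (nbhs mu) (nbhs_filter mu) f (f mu))) => e e0.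
apply: (@local_function_near _ (nbhs mu) (fun=> mu) id f e (nbhs_filter mu) lf e0) => phi delta d0.
exact: (iffLR (@cvgrPdist_le _ _ _ (nbhs mu) (nbhs_filter mu) _ _) (@pairing_continuous R G phi mu)).
Qed.

Context {d0 : G -> G -> R}.
Context (ad0 : adapted d0) (cd0 : continuous (fun z : G * G => d0 z.1 z.2)).
Context (L : weighted_delone R G).

Lemma local_function_equicontinuous f e : local_function f -> 0 < e ->
  \forall v \near (1%g : G), forall mu, hull L mu -> `|f (radon_translate v mu) - f mu| <= e.
Proof.
move=> [s Hs] /Hs[delta delta0 H].
suff : \forall v \near (1%g : G), forall phi, phi \in s -> forall mu, hull L mu ->
    `|radon_pairing (radon_translate v mu) phi - radon_pairing mu phi| <= delta.
  by apply: filterS => v Hv mu Hmu; apply: H => phi /Hv; exact.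
elim: s {Hs H} => [|phi s IH]; first by near=> v.
have [t t0 ft] := test_function_bounded_support ad0 phi.
have [c c0 Hc] := hull_pairing_bounded L (plateau_ge0 ad0 cd0 (t + 1)).
have e0 : 0 < delta / (c + 1) by rewrite divr_gt0//; lra.
have := translate_close ad0 cd0 ft e0; apply: filterS2 IH => v H1 H2 psi.
rewrite inE => /orP[/eqP -> mu Hmu|]; last exact: H1.
apply: le_trans (H2 mu) _; rewrite mulrAC ler_pdivrMr; last lra.
by rewrite ler_wpM2l ?(ltW delta0)//; have := Hc _ Hmu; lra.
Unshelve. all: by end_near. Qed.

(** The inverse makes the value at [y] depend on the measure near [y], so that a
    patch which recurs after translation by [g] gives equal values at [y] and
    [g y]. *)
Definition orbit_function f (y : G) : R := f (radon_translate y^-1%g (delta_measure L)).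

Lemma orbit_function_continuous f : local_function f -> continuous (orbit_function f).
Proof.
move=> lf y; apply: (@continuous_comp _ _ _ (fun y : G => radon_translate y^-1%g (delta_measure L)) f).
  apply: (@continuous_comp _ _ _ (fun y : G => y^-1%g)
    (fun y => radon_translate y (delta_measure L))); first exact: invg_continuous.
  exact: (orbit_continuous ad0 cd0).
exact: local_function_continuous.
Qed.

Lemma local_patch_close (d : G -> G -> R) (ad : adapted d) f e :
  local_function f -> 0 < e ->
  exists2 e0 : R, 0 < e0 & exists2 rho : R, 0 < rho & forall delta x g r,
    let p := patch_translate g (patch_of L (ltrans x (cball d r))) in
    0 < delta <= e0 ->
    (patch_dist d0 (patch_support p) (patch_measure p)
       (restriction L (patch_support p)) < delta%:E)%E ->
    forall y, cball_at d (r - rho) x y ->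
    `|orbit_function f y - orbit_function f (g * y)%g| <= e.
Proof.
move=> [s Hs] /Hs[delta delta0 H].
suff [e0 e00 [rho rho0 Hrho]] : exists2 e0 : R, 0 < e0 & exists2 rho : R, 0 < rho & forall delta' x g r,
    let p := patch_translate g (patch_of L (ltrans x (cball d r))) in
    0 < delta' <= e0 ->
    (patch_dist d0 (patch_support p) (patch_measure p)
       (restriction L (patch_support p)) < delta'%:E)%E ->
    forall y, cball_at d (r - rho) x y -> forall phi, phi \in s ->
    `|radon_pairing (radon_translate y^-1%g (delta_measure L)) phi -
      radon_pairing (radon_translate (g * y)^-1%g (delta_measure L)) phi| <= delta.
  exists e0 => //; exists rho => // delta' x g r p Hd Hp y Hy.
  by apply: H; exact: Hrho Hp y Hy.
elim: s {Hs H} => [|phi s [e1 e10 [rho1 rho10 IH]]]; first by exists 1 => //; exists 1.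
have [e2 e20 [rho2 rho20 H2]] := patch_close ad0 cd0 L ad phi delta0.
exists (Num.min e1 e2); first by rewrite lt_min e10.
exists (Num.max rho1 rho2); first by rewrite lt_max rho10.
move=> delta' x g r p /andP[d'0]; rewrite le_min => /andP[d1 d2] Hp y Hy psi.
have mono rho : rho <= Num.max rho1 rho2 -> cball_at d (r - rho) x y.
  move=> Hrho; move: Hy; rewrite /cball_at !ltransE /cball/= => /lt_le_trans; apply.
  by rewrite lerD2l lerN2.
rewrite inE => /orP[/eqP ->|]; [apply: (H2 delta' x g r _ Hp)|apply: (IH delta' x g r _ Hp)].
- by rewrite d'0.
- by apply: mono; rewrite le_max lexx orbT.
- by rewrite d'0.
- by apply: mono; rewrite le_max lexx.
Qed.

End local_functions.

(** * Upper averages of recurrent functions *)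

Lemma continuous_borel {R : realType} {G : lcscGroupType} (F : G -> R) :
  continuous F -> measurable_fun [set: borel G] (F : borel G -> R).
Proof.
move=> cF; apply: (measurability _ (RGenOpens.measurableE R)).
move=> _ [_ [a [b ->] <-]]; rewrite setTI; apply: borel_open.
by move/continuousP : cF; apply; exact: interval_open.
Qed.

Section upper_averages.
Context {R : realType} {G : lcscGroupType} {d : G -> G -> R} (ad : adapted d).
Context (m : radon R G) (m_haar : haar m) (m_sigma : sigma_finite [set: borel G] m).

Local Notation v := (oball_measure (d := d) m).
Local Notation D := (oball (d := d)).

(** The infimum of these numbers is an upper mean of [F]: averages over all
    translates of a ball are bounded, uniformly in the translate. *)
Definition upper_averages (F : G -> R) : set R :=
  [set a | exists2 s, 0 < v s & forall g, \int[m]_(x in ltrans g (D s)) F x <= a * v s].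

(** What almost linear repetitivity says about the values along the orbit. The
    constant [rho] is the width of the layer at the boundary of a ball where the
    values also depend on the outside of the ball. *)
Definition recurrent (F : G -> R) := forall e, 0 < e -> exists2 c : R, 0 < c &
  exists2 rho : R, 0 <= rho & forall r x h, 1 <= r -> exists g,
    ltrans g (ltrans x (cball d r)) `<=` cball_at d (c * r) h /\
    forall y, cball_at d (r - rho) x y -> `|F y - F (g * y)%g| <= e.

Let vE t : (v t)%:E = m (D t). Proof. exact: oball_measureE. Qed.

Let mD g t : measurable (ltrans g (D t) : set (borel G)).
Proof. by apply: borel_open; apply: open_ltrans; exact: oball_open. Qed.

Let fD g t : (m (ltrans g (D t)) < +oo)%E.
Proof. by apply: ltrans_precompact_finite; exact: oball_precompact. Qed.

Let measure_D g t : m (ltrans g (D t)) = (v t)%:E.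
Proof. by rewrite haar_ltrans// vE. Qed.

Lemma oball_measure_gt0_radius s : 0 < v s -> 0 < s.
Proof.
move=> vs; rewrite ltNge; apply/negP => s0; move: vs.
rewrite -lte_fin vE (_ : D s = set0) ?measure0 ?ltxx//.
apply/seteqP; split=> // x /oball_sub; rewrite /cball/=.
by have := Defs.metric_ge0 (adapted_metric ad) x 1%g; lra.
Qed.

Let measure_DD g h s t : ltrans g (D s) `<=` ltrans h (D t) ->
  m (ltrans h (D t) `\` ltrans g (D s)) = (v t - v s)%:E.
Proof.
move=> sub; rewrite measureD//; last exact: fD.
by rewrite (setIidr sub) EFinB -(measure_D h) -(measure_D g).
Qed.

Section bounded_function.
Context (F : G -> R) (cF : continuous F) (F0 : forall x, 0 <= F x) (F1 : forall x, F x <= 1).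
Local Notation I A := (\int[m]_(x in A) F x).

Let mF : measurable_fun [set: borel G] (F : borel G -> R).
Proof. exact: continuous_borel. Qed.

Lemma bounded_integrable (A : set G) : measurable (A : set (borel G)) -> (m A < +oo)%E ->
  m.-integrable (A : set (borel G)) (EFin \o F).
Proof.
move=> mA fA; apply: measurable_bounded_integrable => //.
  exact: measurable_funTS.
exists 1; split=> // M M1 x _ /=; rewrite ger0_norm//.
by apply: le_trans (F1 x) _; exact: ltW.
Qed.

Lemma bounded_integral_le (A : set G) : measurable (A : set (borel G)) -> (m A < +oo)%E ->
  I A <= fine (m A).
Proof.
move=> mA fA; rewrite -[leRHS]mul1r -Rintegral_cst//; apply: le_Rintegral => //.
  exact: bounded_integrable.
apply: measurable_bounded_integrable => //.
by exists 1; split=> // M M1 x _ /=; rewrite normr1 ltW.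
Qed.

Lemma bounded_integral_setU (A B : set G) : measurable (A : set (borel G)) ->
  measurable (B : set (borel G)) -> (m B < +oo)%E -> A `<=` B ->
  I B = I A + I (B `\` A).
Proof.
move=> mA mB fB AB; rewrite -Rintegral_setU//.
- by rewrite setDUK.
- exact: measurableD.
- by rewrite setDUK//; exact: bounded_integrable.
- by apply/disj_setPS => x [Ax []].
Qed.

Lemma bounded_averaging (A A' : set G) a s : 0 < v s ->
  (forall g, I (ltrans g (D s)) <= a * v s) ->
  measurable (A : set (borel G)) -> measurable (A' : set (borel G)) -> (m A < +oo)%E ->
  (m A' < +oo)%E -> (forall x z, A' x -> D s z -> A (x * z)%g) -> I A' <= a * fine (m A).
Proof.
move=> s0 Ha mA mA' fA fA' AD.
have a0 : 0 <= a.
  by have := le_trans (Rintegral_ge0 m (fun x _ => F0 x)) (Ha 1%g); rewrite pmulr_lge0.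
rewrite -lee_fin EFinM !fineK; last 2 first.
- by rewrite ge0_fin_numE.
- exact: integrable_fin_num (bounded_integrable mA' fA').
apply: (averaging m_haar m_sigma (D := D s)) => //.
- exact: oball_open.
- exact: oball_inv.
- by rewrite -vE lte_fin.
- by rewrite -vE ltry.
move=> g; rewrite -vE -EFinM -(fineK (integrable_fin_num _ (bounded_integrable (mD g s) (fD g s))))//.
rewrite lee_fin; exact: Ha.
Qed.

Lemma bounded_integral_ltrans g (A : set G) : measurable (A : set (borel G)) ->
  I (ltrans g A) = \int[m]_(x in A) F (g * x)%g.
Proof.
move=> mA; congr fine.
have mg : measurable (ltrans g A : set (borel G)).
  by rewrite ltransE -[X in measurable X]setTI; exact: lmul_measurable.
have := @ge0_integral_pushforward _ _ _ _ R _ (@lmul_measurable G g) m (ltrans g A) (EFin \o F) mg.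
move=> /(_ _ _)/= H.
rewrite -[in LHS](m_haar.2 g).
transitivity (\int[pushforward m (fun x : borel G => (g * x)%g : borel G)]_(x in ltrans g A) (F x)%:E)%E.
  by [].
rewrite H.
- rewrite (_ : _ @^-1` _ = A)//; apply/seteqP; split=> x; rewrite ltransE/= mulKg//.
- by apply/measurable_EFinP; exact: measurable_funTS.
- by move=> x _; rewrite lee_fin.
Qed.

End bounded_function.
Context (C q : R) (C0 : 0 < C)
  (Hlim : (m (cball d t) * ((C * t `^ q)^-1)%:E)%E @[t --> +oo] --> 1%E).

Section recurrent_function.
Context (F : G -> R) (cF : continuous F) (F0 : forall x, 0 <= F x) (F1 : forall x, F x <= 1).

Lemma upper_averages_lbound : lbound (upper_averages F) 0.
Proof.
move=> a [s s0 Ha].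
by have := le_trans (Rintegral_ge0 m (fun x _ => F0 x)) (Ha 1%g); rewrite pmulr_lge0.
Qed.

Lemma upper_averages_has_inf : has_inf (upper_averages F).
Proof.
split; last by exists 0; exact: upper_averages_lbound.
have [s s0] := filter_ex (oball_measure_gt0 ad C0 Hlim).
exists 1, s => // g; rewrite mul1r -lee_fin.
have := bounded_integral_le cF F0 F1 (mD g s) (fD g s).
by rewrite measure_D.
Qed.

Let upper_averages_lbound' : lbound (upper_averages (fun x => 1 - F x)) 0.
Proof.
move=> a [s s0 Ha].
have := le_trans (Rintegral_ge0 m _) (Ha 1%g); rewrite pmulr_lge0//; apply => x _.
by rewrite subr_ge0.
Qed.

(** Some ball of radius [r] has an average of [1 - F] that nearly reaches its
    upper mean, hence a low average of [F]. It reappears in every ball of radius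
    [T = c r + r0], where it occupies a definite proportion; on the rest of the
    large ball the average of [F] is at most [a], up to a boundary layer. This
    bounds the averages over all balls of radius [T], and the upper mean of [F]
    cannot exceed this bound. *)
Lemma recurrent_key (e c rho r0 a s r : R) : 0 < e -> 0 <= r0 ->
  (forall t, cball d (t - r0) `<=` D t) ->
  (forall x h, exists g,
    ltrans g (ltrans x (cball d r)) `<=` cball_at d (c * r) h /\
    forall y, cball_at d (r - rho) x y -> `|F y - F (g * y)%g| <= e) ->
  0 < s -> 0 < v s -> (forall g, \int[m]_(x in ltrans g (D s)) F x <= a * v s) ->
  0 <= rho -> 0 < v r ->
  v r <= v (c * r + r0) /\
  inf (upper_averages F) * v (c * r + r0) <=
    a * (v (c * r + (r0 + s)) - v (r - s)) +
    (1 - inf (upper_averages (fun x => 1 - F x)) + 2 * e) * v r + (v r - v (r - rho)).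
Proof.
move=> e0 r00 Hr0 rec s0 vs Ha rho0 vr.
set b := inf (upper_averages F); set b' := inf _.
pose T := c * r + r0.
have F'0 x : 0 <= 1 - F x by rewrite subr_ge0.
have [x Hx] : exists x, \int[m]_(y in ltrans x (D r)) F y <= (1 - b' + e) * v r.
  (* Otherwise the balls of radius [r] would witness an upper average below [b']. *)
  have nU : ~ upper_averages (fun x => 1 - F x) (b' - e).
    move=> H; have : b' <= b' - e by apply: inf_lbound => //; exists 0; exact: upper_averages_lbound'.
    lra.
  have /existsNP[x /negP] : ~ forall x, \int[m]_(y in ltrans x (D r)) (1 - F y) <= (b' - e) * v r.
    by move=> H; apply: nU; exists r.
  rewrite -ltNge RintegralB//; last 2 first.
  - apply: measurable_bounded_integrable => //.
    by exists 1; split=> // M M1 y _ /=; rewrite normr1 ltW.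
  - exact: (bounded_integrable cF F0 F1).
  rewrite Rintegral_cst// measure_D mul1r/= => H; exists x.
  by move: H; lra.
have fin (A : set G) t g : A `<=` ltrans g (D t) -> (m A < +oo)%E.
  by move=> AD; apply: le_lt_trans (fD g t); exact: radon_homo.
have Qsub h : exists g, [/\ ltrans (g * x)%g (D r) `<=` ltrans h (D T) &
    \int[m]_(y in ltrans (g * x)%g (D r)) F y <=
      (1 - b' + 2 * e) * v r + (v r - v (r - rho))].
  have [g [Hg1 Hg2]] := rec x h; exists g.
  have ltM (A : set G) : ltrans (g * x)%g A = ltrans g (ltrans x A).
    by rewrite !ltransE; apply/seteqP; split=> y /=; rewrite invgM mulgA.
  split.
    rewrite ltM => _ [z xz <-].
    have [w cw <-] : cball_at d (c * r) h (g * z)%g.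
      by apply: Hg1; exists z => //; move: xz => [w /oball_sub Dw <-]; exists w.
    by exists w => //; apply: Hr0; rewrite /T addrK.
  rewrite ltM (bounded_integral_ltrans cF F0)//.
  pose W := ltrans x (D (r - rho)).
  have WD : W `<=` ltrans x (D r).
    by move=> _ [w Dw <-]; exists w => //; apply: oball_homo Dw; lra.
  have cFg : continuous (fun y => F (g * y)%g).
    by move=> y; apply: (@continuous_comp _ _ _ (fun y => (g * y)%g) F); [exact: lmul_continuous|exact: cF].
  have Fg0 y : 0 <= F (g * y)%g by [].
  have Fg1 y : F (g * y)%g <= 1 by [].
  have mW := mD x (r - rho); have fW := fD x (r - rho).
  rewrite (bounded_integral_setU cFg Fg0 Fg1 mW (mD x r) (fD x r) WD).
  have HF := bounded_integral_setU cF F0 F1 mW (mD x r) (fD x r) WD.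
  have mB : measurable (ltrans x (D r) `\` W : set (borel G)) by exact: measurableD.
  have fB : (m (ltrans x (D r) `\` W) < +oo)%E by apply: (fin _ r x) => y [].
  have HB := bounded_integral_le cFg Fg0 Fg1 mB fB.
  rewrite (measure_DD WD)/= in HB.
  have HB0 : 0 <= \int[m]_(y in ltrans x (D r) `\` W) F y by apply: Rintegral_ge0.
  have HW : \int[m]_(y in W) F (g * y)%g <= \int[m]_(y in W) F y + e * v (r - rho).
    have -> : e * v (r - rho) = \int[m]_(y in W) e.
      by rewrite Rintegral_cst// measure_D.
    have Ie : m.-integrable (W : set (borel G)) (EFin \o (fun=> e)).
      apply: measurable_bounded_integrable => //.
      by exists e; split=> [|M M1 y _ /=]; rewrite ?num_real// ger0_norm ltW.
    have IF := bounded_integrable cF F0 F1 mW (fD x (r - rho)).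
    rewrite -RintegralD//; apply: le_Rintegral => //.
    - exact: (bounded_integrable cFg Fg0 Fg1).
    - by apply: eq_integrable (integrableD _ IF Ie).
    move=> y [w Dw <-].
    have /Hg2 : cball_at d (r - rho) x (x * w)%g by exists w => //; exact: oball_sub.
    by rewrite ler_norml => /andP[]; lra.
  have vrr : v (r - rho) <= v r.
    by rewrite -lee_fin -(measure_D x (r - rho)) -(measure_D x r); exact: radon_homo.
  have : e * v (r - rho) <= e * v r by rewrite ler_wpM2l// ltW.
  by move: Hx HF HB HB0 HW; lra.
have [g1 [Hg1 _]] := Qsub 1%g.
have vrT : v r <= v T.
  by rewrite -lee_fin -(measure_D (g1 * x)%g) -(measure_D 1%g T); exact: radon_homo.
split=> //.
set X := (X in _ <= X).
have vT : 0 < v T by lra.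
rewrite -ler_pdivlMr//; apply: inf_lbound; first by exists 0; exact: upper_averages_lbound.
exists T => // h; rewrite divfK ?gt_eqF//.
have [g [Hg2 Hg3]] := Qsub h.
set Q := ltrans (g * x)%g (D r) in Hg2 Hg3.
rewrite (bounded_integral_setU cF F0 F1 (mD (g * x)%g r) (mD h T) (fD h T) Hg2).
suff : \int[m]_(y in ltrans h (D T) `\` Q) F y <= a * (v (T + s) - v (r - s)).
  rewrite /X (_ : c * r + (r0 + s) = T + s); last by rewrite /T addrA.
  by move: Hg3; rewrite -/Q; lra.
pose Q' := ltrans (g * x)%g (D (r - s)).
have Q'Q : Q' `<=` Q.
  by move=> _ [y Dy <-]; exists y => //; apply: oball_homo Dy; lra.
have Q'T : Q' `<=` ltrans h (D (T + s)).
  move=> y /Q'Q/Hg2[z Dz <-]; exists z => //; apply: oball_homo Dz; lra.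
have mA : m (ltrans h (D (T + s)) `\` Q') = (v (T + s) - v (r - s))%:E.
  exact: measure_DD.
apply: le_trans (bounded_averaging cF F0 F1 (A := ltrans h (D (T + s)) `\` Q') vs Ha _ _ _ _ _) _.
- by apply: measurableD; exact: mD.
- by apply: measurableD; exact: mD.
- by rewrite mA ltry.
- by apply: (fin _ T h) => y [].
- move=> y z [[y0 Dy0 <-] nQ] Dz; split.
    by exists (y0 * z)%g; [exact: oball_mul|rewrite mulgA].
  move=> [w Dw wE]; apply: nQ; exists (w * z^-1)%g.
    have -> : r = (r - s) + s by lra.
    by apply: oball_mul => //; exact: oball_inv.
  by rewrite mulgA wE mulgK.
by rewrite mA.
Qed.

End recurrent_function.

(** Dividing the previous inequality by [C r^q] and letting [r] grow, all shifts
    of radii disappear and with [k = c^q] there remains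
    [b k <= a (k - 1) + 1 - b' + 2 e]. Here [a] may be taken as close to [b] as
    desired, and [b + b' <= 1] follows. Exact growth makes all ratios of masses
    converge; two-sided polynomial bounds would leave a factor. *)
Theorem recurrent_upper_averages (F : G -> R) : continuous F ->
  (forall x, 0 <= F x) -> (forall x, F x <= 1) -> recurrent F ->
  inf (upper_averages F) + inf (upper_averages (fun x => 1 - F x)) <= 1.
Proof.
move=> cF F0 F1 rec; apply/ler_addgt0Pr => e3 e30; pose e := e3 / 3.
have e0 : 0 < e by rewrite divr_gt0.
have [c c0 [rho rho0 Hrec]] := rec e e0.
have [r0 r00 Hr0] := cball_oball ad.
set b := inf _; set b' := inf _.
pose w r := C * r `^ q; pose k := c `^ q.
have k0 : 0 < k by rewrite powR_gt0.
have growth c1 k1 : 0 < c1 -> v (c1 * r + k1) / w r @[r --> +oo] --> c1 `^ q.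
  by move=> c10; exact: (oball_growth ad C0 Hlim).
have growth1 k1 : v (r + k1) / w r @[r --> +oo] --> (1 : R).
  have := @growth 1 k1 ltr01; rewrite powR1.
  by under eq_fun do rewrite mul1r.
have growth0 : v r / w r @[r --> +oo] --> (1 : R).
  by have := growth1 0; under eq_fun do rewrite addr0.
have w_gt0 : \forall r \near (+oo : set_system R), 0 < w r.
  near=> r; rewrite /w mulr_gt0// powR_gt0//.
have key a s : 0 < v s -> (forall g, \int[m]_(x in ltrans g (D s)) F x <= a * v s) ->
    \forall r \near (+oo : set_system R), v r / w r <= v (c * r + r0) / w r /\
    b * (v (c * r + r0) / w r) <=
    a * (v (c * r + (r0 + s)) / w r - v (r - s) / w r) +
    (1 - b' + 2 * e) * (v r / w r) + (v r / w r - v (r - rho) / w r).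
  move=> vs Ha; near=> r.
  have wr : 0 < w r by near: r.
  have r1 : 1 <= r by near: r; apply: nbhs_pinfty_ge; exact: num_real.
  have vr : 0 < v r by near: r; exact: (oball_measure_gt0 ad C0 Hlim).
  have s0 := oball_measure_gt0_radius vs.
  have [H1 H2] := recurrent_key cF F0 F1 e0 (ltW r00) Hr0
    (fun x h => Hrec r x h r1) s0 vs Ha rho0 vr.
  split; first by rewrite ler_pM2r// invr_gt0.
  move: H2; rewrite -/b -/b' -(ler_pM2r (x := (w r)^-1)) ?invr_gt0//.
  by move: (v _) (v (c * r + (r0 + s))) (v r) (v (r - s)) (v (r - rho)) (w r)^-1 => *; lra.
have main a s : 0 < v s -> (forall g, \int[m]_(x in ltrans g (D s)) F x <= a * v s) ->
    1 <= k /\ b * k <= a * (k - 1) + (1 - b' + 2 * e).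
  move=> vs Ha; have Hkey := key _ _ vs Ha; split.
    apply: (ler_cvg_to growth0 (growth c r0 c0)).
    by apply: filterS Hkey => r [].
  have -> : a * (k - 1) + (1 - b' + 2 * e) =
      a * (k - 1) + (1 - b' + 2 * e) * 1 + (1 - 1) by rewrite mulr1 subrr addr0.
  apply: (@ler_cvg_to _ (+oo : set_system R) _ _ (fun r => b * (v (c * r + r0) / w r))
    (fun r => a * (v (c * r + (r0 + s)) / w r - v (r - s) / w r) +
    (1 - b' + 2 * e) * (v r / w r) + (v r / w r - v (r - rho) / w r))).
  - exact: (cvgM (cvg_cst b) (growth c r0 c0)).
  - apply: cvgD; last exact: (cvgB growth0 (growth1 (- rho))).
    apply: cvgD; last exact: (cvgM (cvg_cst _) growth0).
    exact: (cvgM (cvg_cst a) (cvgB (growth c (r0 + s) c0) (growth1 (- s)))).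
  - by apply: filterS Hkey => r [].
(* With [a < b + e / k], replacing [a] by [b] costs at most one more [e]. *)
have [a Ua ab] := inf_adherent (divr_gt0 e0 k0) (upper_averages_has_inf cF F0 F1).
have [s vs Ha] := Ua; have [k1] := main _ _ vs Ha; rewrite -/b in ab.
have : a * (k - 1) <= (b + e / k) * (k - 1) by rewrite ler_wpM2r ?subr_ge0// ltW.
have : e / k * (k - 1) <= e by rewrite mulrAC ler_pdivrMr// ler_wpM2l ?(ltW e0)//; lra.
have -> : (b + e / k) * (k - 1) = b * k - b + e / k * (k - 1) by ring.
by rewrite /e; lra.
Unshelve. all: by end_near. Qed.

End upper_averages.

(** * Repetitivity and invariant means *)

Section repetitivity.
Context {R : realType} {G : lcscGroupType} {d d0 : G -> G -> R}.
Context (ad : adapted d) (ad0 : adapted d0) (cd0 : continuous (fun z : G * G => d0 z.1 z.2)).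
Context (L : weighted_delone R G).

(** Patches that are equal are at distance zero, since they have finite mass. *)
Lemma linearly_repetitive_almost :
  linearly_repetitive L d -> almost_linearly_repetitive d0 L d.
Proof.
move=> [c c0 H] delta /andP[del0 _]; exists c => // r r1 Pi HPi h.
have [p [Pip psub pE]] := H r r1 Pi HPi h; exists p; split=> //.
have pS : precompact (patch_support p).
  have [x _ xE] := HPi; move: Pip; rewrite -xE => -[g _ <-] /=.
  by do 2 apply: precompact_ltrans; exact: adapted_proper.
apply: (@le_lt_trans _ _ (delta / 2)%:E); last by rewrite lte_fin; lra.
apply: ereal_inf_lbound; exists (delta / 2) => //; split; first by lra.
move=> y _ _; rewrite pE subee ?abse0 ?lte_fin; first by lra.
have [K SK [cK _]] := pS.
rewrite ge0_fin_numE; last exact: measure_ge0.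
apply: le_lt_trans (radon_compact (delta_measure L) cK); apply: radon_homo.
by move=> z [_ /SK].
Qed.

Lemma repetitive_recurrent f : local_function f -> almost_linearly_repetitive d0 L d ->
  recurrent (d := d) (orbit_function L f).
Proof.
move=> lf rep e e0.
have [e1 e10 [rho rho0 Hclose]] := local_patch_close ad0 cd0 L ad lf e0.
pose delta := Num.min e1 (1 / 2).
have d0' : 0 < delta by rewrite lt_min e10 divr_gt0.
have [c c0 Hc] : exists2 c : R, 0 < c & forall r : R, 1 <= r ->
    forall Pi, pattern_of_size L (cball d r) Pi ->
      forall h, almost_occurs d0 L delta Pi (cball_at d (c * r) h).
  by apply: rep; rewrite d0'/= gt_min; apply/orP; right; lra.
exists c => //; exists rho; first exact: ltW.
move=> r x h r1.
have [|p [[g _ <-] psub Hp]] := Hc r r1 (pattern (patch_of L (ltrans x (cball d r)))) _ h.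
  by exists x.
exists g; split=> // y Hy.
apply: (Hclose delta x g r _ Hp y Hy).
by rewrite d0'/= ge_min lexx.
Qed.

End repetitivity.

Lemma continuous_affine {R : realType} {T : topologicalType} (c : R) (f g : T -> R) :
  continuous f -> continuous g -> continuous (fun x => c * f x + g x).
Proof.
move=> cf cg x; apply: cvgD; last exact: cg.
by apply: cvgM; [exact: cvg_cst|exact: cf].
Qed.

Section invariant_means.
Context {R : realType} {G : lcscGroupType} {d d0 : G -> G -> R}.
Context (ad : adapted d) (ad0 : adapted d0) (cd0 : continuous (fun z : G * G => d0 z.1 z.2)).
Context (m : radon R G) (m_haar : haar m) (L : weighted_delone R G).
Local Notation H := (hull_space L).
Local Notation v := (oball_measure (d := d) m).
Local Notation D := (oball (d := d)).

Lemma hull_function_measurable (f : radon R G -> R) : continuous f ->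
  measurable_fun [set: borel H] ((fun x => f (val x)) : borel H -> R).
Proof.
move=> cf; apply: (measurability _ (RGenOpens.measurableE R)).
move=> _ [_ [a [b ->] <-]]; rewrite setTI; apply: borel_open.
apply: (@open_comp _ _ (fun x : H => f (val x)) `]a, b[%classic); last exact: interval_open.
move=> x _; apply: (@continuous_comp _ _ _ (val : H -> radon R G) f).
  exact: hull_space_val_continuous.
exact: cf.
Qed.

Lemma hull_function_integrable (P : probability (borel H) R) (f : radon R G -> R) (M : R) :
  continuous f -> (forall mu, `|f mu| <= M) ->
  P.-integrable [set: borel H] (EFin \o ((fun x => f (val x)) : borel H -> R)).
Proof.
move=> cf fM; apply: measurable_bounded_integrable => //.
- by apply: le_lt_trans (probability_le1 P measurableT) _; exact: ltry.
- exact: hull_function_measurable.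
by exists M; split; [exact: num_real|move=> M' MM' x _ /=; apply: le_trans (fM _) _; exact: ltW].
Qed.

Lemma invariant_integral (P : probability (borel H) R) (f : radon R G -> R) g :
  Defs.invariant (hull_act (L := L)) P -> continuous f -> (forall mu, 0 <= f mu) ->
  \int[P]_x f (radon_translate g (val x)) = \int[P]_x f (val x).
Proof.
move=> invP cf f0; congr fine.
have mact : measurable_fun [set: borel H] (hull_act (L := L) g : borel H -> borel H).
  apply: (@measurability _ _ (borel H) (borel H) _ _ (@open H)) => //.
  move=> _ [U oU <-]; rewrite setTI; apply: borel_open.
  by move/continuousP : (@hull_act_continuous _ _ L g); exact.
have mf := hull_function_measurable cf.
transitivity (\int[pushforward P (hull_act (L := L) g : borel H -> borel H)]_x (f (val x))%:E)%E.
  rewrite ge0_integral_pushforward//.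
    by apply/measurable_EFinP.
  by move=> x _; rewrite lee_fin.
by apply: eq_measure_integral => A mA _; exact: invP.
Qed.

Lemma orbit_function_uniform (f : radon R G -> R) (e : R) : local_function f -> 0 < e ->
  exists2 V : set G, open V /\ V 1%g & forall y z, V z ->
    `|orbit_function L f (y * z)%g - orbit_function L f y| <= e.
Proof.
move=> lf e0.
pose N := [set w : G | forall mu, hull L mu -> `|f (radon_translate w mu) - f mu| <= e].
have nV : nbhs (1%g : G) N := local_function_equicontinuous ad0 cd0 L lf e0.
exists ((fun v : G => v^-1%g) @^-1` N)°.
  split; first exact: open_interior.
  by apply: invg_continuous; rewrite invg1.
move=> y z /interior_subset/= /(_ (radon_translate y^-1%g (delta_measure L)) (@hull_orbit _ _ L _)).
by rewrite -radon_translateM -invgM.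
Qed.

Lemma translates_sum_continuous (f : radon R G -> R) (ps : seq (R * G)) : continuous f ->
  continuous (fun mu => \sum_(p <- ps) p.1 * f (radon_translate p.2^-1%g mu)).
Proof.
move=> cf; elim: ps => [|p ps IH].
  by under eq_fun do rewrite big_nil; exact: cst_continuous.
under eq_fun do rewrite big_cons.
apply: continuous_affine; last exact: IH.
move=> mu; apply: (@continuous_comp _ _ _ (radon_translate p.2^-1%g) f).
  exact: radon_translate_continuous.
exact: cf.
Qed.

Lemma oball_finite_cover s (V : set G) : open V -> V 1%g ->
  exists ys : seq G, oball (d := d) s `<=` \bigcup_(y in [set` ys]) ltrans y V.
Proof.
move=> oV V1; have [K DK [cK _]] := oball_precompact ad s.
move: cK; rewrite compact_cover => /(_ G setT (fun y => ltrans y V)).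
case=> [y _|y _|ys _ Kys]; [exact: open_ltrans|by exists y => //; exists 1%g => //; rewrite mulg1|].
by exists ys => y /DK/Kys.
Qed.

(** Cutting [A] along translates of [V], on which [F] hardly varies, replaces
    integrals over all sets [h A] by one finite combination of translates of
    [F]. For the value of a local function such a combination, unlike the
    integral, is visibly a continuous function of the measure, so that bounds
    extend from the orbit to the hull. *)
Lemma riemann_sum (F : G -> R) (V : set G) (e : R) (ys : seq G) (A : set G) :
  continuous F -> (forall x, 0 <= F x) -> (forall x, F x <= 1) -> open V ->
  (forall y z, V z -> F y - e <= F (y * z)%g) ->
  measurable (A : set (borel G)) -> (m A < +oo)%E ->
  A `<=` \bigcup_(y in [set` ys]) ltrans y V ->
  exists cs : seq (R * G), [/\ forall p, p \in cs -> 0 <= p.1,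
    \sum_(p <- cs) p.1 = fine (m A) &
    forall h, \sum_(p <- cs) p.1 * F (h * p.2)%g <=
      \int[m]_(y in A) F (h * y)%g + e * fine (m A)].
Proof.
move=> cF F0 F1 oV HV; elim: ys A => [|y ys IH] A mA fA.
  rewrite bigcup0 => [|//]; rewrite subset0 => ->; exists [::].
  by split=> // [|h]; rewrite big_nil measure0// Rintegral_set0 mulr0 addr0.
move=> Asub; have mV : measurable (ltrans y V : set (borel G)).
  by apply: borel_open; exact: open_ltrans.
have mA1 := measurableI _ _ mA mV; have mA2 := measurableD mA mV.
have fA1 : (m (A `&` ltrans y V) < +oo)%E.
  by apply: le_lt_trans fA; apply: radon_homo => x [].
have fA2 : (m (A `\` ltrans y V) < +oo)%E.
  by apply: le_lt_trans fA; apply: radon_homo => x [].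
have [|cs [cs0 csum cle]] := IH _ mA2 fA2.
  move=> x [/Asub[z /=]]; rewrite inE => /orP[/eqP ->//|zys Vx _].
  by exists z.
have mE : fine (m A) = fine (m (A `&` ltrans y V)) + fine (m (A `\` ltrans y V)).
  by rewrite -fineD ?ge0_fin_numE// addeC -measureDI.
exists ((fine (m (A `&` ltrans y V)), y) :: cs); split.
- by move=> p; rewrite inE => /orP[/eqP -> /=|/cs0//]; rewrite fine_ge0.
- by rewrite big_cons/= csum mE.
move=> h; rewrite big_cons/=.
have cFh : continuous (fun z => F (h * z)%g).
  by move=> z; apply: (@continuous_comp _ _ _ (fun z => (h * z)%g) F); [exact: lmul_continuous|exact: cF].
have Fh0 z : 0 <= F (h * z)%g by [].
have Fh1 z : F (h * z)%g <= 1 by [].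
have sub : A `&` ltrans y V `<=` A by move=> x [].
rewrite (bounded_integral_setU cFh Fh0 Fh1 mA1 mA fA sub).
have AE : A `\` (A `&` ltrans y V) = A `\` ltrans y V by rewrite setDIr setDv set0U.
rewrite AE mE.
have H1 : fine (m (A `&` ltrans y V)) * F (h * y)%g <=
    \int[m]_(z in A `&` ltrans y V) F (h * z)%g + e * fine (m (A `&` ltrans y V)).
  rewrite -lerBlDr mulrC -mulrBl -Rintegral_cst//; apply: le_Rintegral => //.
  - apply: measurable_bounded_integrable => //.
    exists (`|F (h * y)%g - e|); split=> [|M M1 z _ /=]; [exact: num_real|exact: ltW].
  - exact: (bounded_integrable cFh Fh0 Fh1).
  by move=> z [_ [w Vw <-]]; rewrite mulgA; exact: HV.
have := cle h; lra.
Qed.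

Context (m_sigma : sigma_finite [set: borel G] m).

(** The Riemann sum is bounded by [a + e] along the orbit, hence on the hull;
    integrated against an invariant probability, all its translates have the
    same mean. *)
Lemma mean_le_upper_average (P : probability (borel H) R) (f : radon R G -> R) (a : R) :
  Defs.invariant (hull_act (L := L)) P -> local_function f ->
  (forall mu, 0 <= f mu) -> (forall mu, f mu <= 1) ->
  upper_averages (d := d) m (orbit_function L f) a ->
  \int[P]_x f (val x) <= a.
Proof.
move=> invP lf f0 f1 [s vs Ha]; apply/ler_addgt0Pr => e e0.
have cf := local_function_continuous lf.
pose F := orbit_function L f.
have [V [oV V1] HV'] := orbit_function_uniform lf e0.
have HV (y z : G) : V z -> F y - e <= F (y * z)%g.
  by move=> /(HV' y); rewrite ler_norml => /andP[+ _]; rewrite /F; lra.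
have [ys Dys] := oball_finite_cover s oV V1.
have cF : continuous F := orbit_function_continuous ad0 cd0 lf.
have F0 y : 0 <= F y by exact: f0.
have F1 y : F y <= 1 by exact: f1.
have mD : measurable (D s : set (borel G)) by apply: borel_open; exact: oball_open.
have fD : (m (D s) < +oo)%E by apply: precompact_finite; exact: oball_precompact.
have [cs [cs0 csum cle]] := @riemann_sum F V e ys (D s) cF F0 F1 oV HV mD fD Dys.
pose Phi (ps : seq (R * G)) mu := \sum_(p <- ps) p.1 * f (radon_translate p.2^-1%g mu).
have cfg g : continuous (fun mu => f (radon_translate g mu)).
  move=> mu; apply: (@continuous_comp _ _ _ (radon_translate g) f).
    exact: radon_translate_continuous.
  exact: cf.
have cPhi ps : continuous (Phi ps) by exact: translates_sum_continuous.
have Phi_le ps mu : `|Phi ps mu| <= \sum_(p <- ps) `|p.1|.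
  apply: le_trans (ler_norm_sum _ _ _) _; apply: ler_sum => p _.
  by rewrite normrM ler_piMr// ger0_norm.
have PhiI ps := hull_function_integrable P (cPhi ps) (Phi_le ps).
have PhiH mu : hull L mu -> Phi cs mu <= (a + e) * v s.
  apply: (hull_closed (A := [set mu | Phi cs mu <= (a + e) * v s])).
    apply: (@preimage_closed _ _ (Phi cs) [set r | r <= _]); last exact: closed_le.
    by move=> nu _; exact: cPhi.
  move=> h /=; apply: (@le_trans _ _ (\sum_(p <- cs) p.1 * F (h^-1 * p.2)%g)).
    rewrite le_eqVlt; apply/orP; left; apply/eqP; apply: eq_bigr => p _.
    by rewrite /F /orbit_function invgM invgK radon_translateM.
  apply: le_trans (cle h^-1%g) _; rewrite mulrDl lerD2r.
  rewrite -(bounded_integral_ltrans m_haar cF F0 h^-1%g mD); exact: Ha.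
have intPhi ps : \int[P]_x Phi ps (val x) = (\sum_(p <- ps) p.1) * \int[P]_x f (val x).
  elim: ps => [|p ps IH].
    under eq_Rintegral do rewrite /Phi big_nil.
    by rewrite big_nil mul0r Rintegral_cst// mul0r.
  under eq_Rintegral do rewrite /Phi big_cons.
  have If1 : P.-integrable [set: borel H] (EFin \o (fun x : borel H => f (radon_translate p.2^-1%g (val x)))).
    by apply: (@hull_function_integrable P _ 1 (cfg _)) => mu; rewrite ger0_norm.
  rewrite RintegralD//; last 2 first.
  - by apply: eq_integrable (integrableZl _ p.1 If1).
  - exact: PhiI.
  rewrite RintegralZl// (invariant_integral _ invP cf f0) big_cons mulrDl.
  by congr (_ + _); exact: IH.
have : v s * \int[P]_x f (val x) <= (a + e) * v s.
  rewrite -[v s]csum -intPhi csum.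
  have := probability_setT P => PT.
  have -> : (a + e) * v s = \int[P]_(x in [set: borel H]) ((a + e) * v s).
    by rewrite Rintegral_cst// [X in fine X](_ : _ = 1%E) ?mulr1.
  apply: le_Rintegral => //.
  - apply: (@hull_function_integrable P (fun=> (a + e) * v s) `|(a + e) * v s|) => //.
    exact: cst_continuous.
  by move=> x _; apply: PhiH; exact: set_valP.
by rewrite mulrC ler_pM2r.
Qed.

End invariant_means.

(** * Half-space intersections *)

Section half_spaces.
Context {R : realType} {G : lcscGroupType}.
Implicit Types (mu nu : radon R G) (s : seq (test_function R G * R * R)).

(** An entry [(phi, c, t)] stands for the condition [t < c * mu(phi)]; the factor
    [c] gives access to both sides of a threshold. *)
Definition half_spaces s : set (radon R G) :=
  [set mu | forall p, p \in s -> p.2 < p.1.2 * radon_pairing mu p.1.1].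

Definition ramp (x : R) : R := Num.max 0 (Num.min 1 x).

Lemma ramp_ge0 x : 0 <= ramp x. Proof. by rewrite le_max lexx. Qed.

Lemma ramp_gt0 x : (0 < ramp x) = (0 < x).
Proof. by rewrite lt_max ltxx/= lt_min ltr01. Qed.

Lemma ramp_homo x y : x <= y -> ramp x <= ramp y.
Proof.
move=> xy; rewrite /ramp ge_max !le_max lexx/=; apply/orP; right.
by rewrite le_min !ge_min lexx xy/= orbT.
Qed.

Lemma ramp_lipschitz x y : `|ramp x - ramp y| <= `|x - y|.
Proof.
wlog xy : x y / x <= y.
  move=> H; have [/H//|/ltW/H] := leP x y.
  by rewrite distrC (distrC y).
rewrite distrC (distrC x) ger0_norm ?subr_ge0 ?ramp_homo// ger0_norm ?subr_ge0//.
rewrite lerBlDl; have x0 := ramp_ge0 x.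
have : Num.min 1 x <= ramp x by rewrite /ramp le_max lexx orbT.
rewrite ge_min [ramp y]/ramp ge_max => /orP[x1|xx].
  by rewrite addr_ge0// ?subr_ge0//= ge_min; apply/orP; left; lra.
by rewrite addr_ge0// ?subr_ge0//= ge_min; apply/orP; right; lra.
Qed.

Lemma min_close (a b x y e : R) : `|a - b| <= e -> `|x - y| <= e ->
  `|Num.min a x - Num.min b y| <= e.
Proof.
rewrite !ler_norml => /andP[? ?] /andP[? ?].
by case: (leP a x) => ax; case: (leP b y) => bY; apply/andP; split; lra.
Qed.

(** As [n] grows, these local functions increase to the indicator of the open set
    [half_spaces s]. *)
Definition half_spaces_ramp s (n : nat) mu : R :=
  \big[Num.min/1]_(p <- s) ramp (n%:R * (p.1.2 * radon_pairing mu p.1.1 - p.2)).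

Lemma half_spaces_ramp_ge0 s n mu : 0 <= half_spaces_ramp s n mu.
Proof.
rewrite /half_spaces_ramp; elim: s => [|p s IH]; first by rewrite big_nil.
by rewrite big_cons le_min ramp_ge0.
Qed.

Lemma half_spaces_ramp_le1 s n mu : half_spaces_ramp s n mu <= 1.
Proof.
rewrite /half_spaces_ramp; elim: s => [|p s IH]; first by rewrite big_nil.
by rewrite big_cons ge_min IH orbT.
Qed.

Lemma half_spaces_ramp_homo s mu n n' : (n <= n')%N ->
  half_spaces_ramp s n mu <= half_spaces_ramp s n' mu.
Proof.
move=> nn'; rewrite /half_spaces_ramp; elim: s => [|p s IH]; first by rewrite !big_nil.
rewrite !big_cons le_min !ge_min IH orbT andbT; apply/orP; left.
set z := _ - _; have [z0|z0] := leP z 0.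
  apply: (@le_trans _ _ 0); last exact: ramp_ge0.
  by rewrite leNgt ramp_gt0 -leNgt mulr_ge0_le0.
by apply: ramp_homo; rewrite ler_wpM2r ?ler_nat// ltW.
Qed.

Lemma half_spaces_ramp_gt0 s n mu : 0 < half_spaces_ramp s n mu -> half_spaces s mu.
Proof.
rewrite /half_spaces_ramp /half_spaces; elim: s => [//|p s IH].
rewrite big_cons lt_min ramp_gt0 => /andP[H1 /IH H2] p'.
rewrite inE => /orP[/eqP ->|]; last exact: H2.
rewrite -subr_gt0; have := ler0n R n; rewrite le_eqVlt => /orP[/eqP n0|n0].
  by move: H1; rewrite -n0 mul0r ltxx.
by move: H1; rewrite pmulr_rgt0.
Qed.

Lemma half_spaces_ramp_near1 s mu : half_spaces s mu ->
  \forall n \near \oo, half_spaces_ramp s n mu = 1.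
Proof.
rewrite /half_spaces_ramp; elim: s => [_|p s IH Hs].
  by near=> n; rewrite big_nil.
have Hp : 0 < p.1.2 * radon_pairing mu p.1.1 - p.2 by rewrite subr_gt0; apply: Hs; rewrite inE eqxx.
have {}IH := IH (fun p' p's => Hs p' (mem_behead (s := p :: s) p's)).
near=> n; rewrite big_cons.
have -> : \big[Num.min/1]_(j <- s) ramp (n%:R * (j.1.2 * radon_pairing mu j.1.1 - j.2)) = 1.
  by near: n.
rewrite (min_idPr _)// /ramp (min_idPl _) ?(max_idPr _)//.
rewrite -ler_pdivrMr// mul1r; near: n; exact: nbhs_infty_ger.
Unshelve. all: by end_near. Qed.

Lemma half_spaces_ramp_local s n : local_function (half_spaces_ramp s n).
Proof.
exists [seq p.1.1 | p <- s] => e e0.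
rewrite /half_spaces_ramp; elim: s => [|p s [delta1 delta10 IH]].
  by exists 1 => // mu nu _; rewrite !big_nil subrr normr0 ltW.
pose c := n%:R * `|p.1.2| + 1.
have c0 : 0 < c by rewrite ltr_wpDl// mulr_ge0.
exists (Num.min delta1 (e / c)); first by rewrite lt_min delta10 divr_gt0.
move=> mu nu H.
have H1 : `|radon_pairing mu p.1.1 - radon_pairing nu p.1.1| <= e / c.
  have /H : p.1.1 \in [seq p.1.1 | p <- p :: s] by rewrite inE eqxx.
  by rewrite le_min => /andP[].
have {}IH := IH mu nu.
have {}IH : `|\big[Num.min/1]_(j <- s) ramp (n%:R * (j.1.2 * radon_pairing mu j.1.1 - j.2)) -
   \big[Num.min/1]_(j <- s) ramp (n%:R * (j.1.2 * radon_pairing nu j.1.1 - j.2))| <= e.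
  apply: IH => phi phis.
  have /H : phi \in [seq p.1.1 | p <- p :: s] by rewrite inE phis orbT.
  by rewrite le_min => /andP[].
rewrite !big_cons; move: IH; set A := \big[_/_]_(_ <- _) _; set B := \big[_/_]_(_ <- _) _ => IH.
have : `|ramp (n%:R * (p.1.2 * radon_pairing mu p.1.1 - p.2)) -
  ramp (n%:R * (p.1.2 * radon_pairing nu p.1.1 - p.2))| <= e.
  apply: le_trans (ramp_lipschitz _ _) _.
  rewrite -mulrBr (_ : p.1.2 * _ - _ - _ = p.1.2 * (radon_pairing mu p.1.1 - radon_pairing nu p.1.1)); last by ring.
  rewrite !normrM mulrA (ger0_norm (ler0n _ _)).
  apply: (@le_trans _ _ ((n%:R * `|p.1.2|) * (e / c))); first by rewrite ler_wpM2l// mulr_ge0.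
  rewrite mulrCA ler_piMr ?(ltW e0)// ler_pdivrMr// mul1r /c lerDl//.
by move=> H2; exact: min_close.
Qed.

Lemma open_half_spaces s : open (half_spaces s).
Proof.
elim: s => [|p s IH].
  rewrite (_ : half_spaces [::] = setT); first exact: openT.
  by apply/seteqP; split.
rewrite (_ : half_spaces (p :: s) = (fun mu => radon_pairing mu p.1.1) @^-1` [set r | p.2 < p.1.2 * r] `&` half_spaces s).
  apply: openI => //; apply: open_comp; first by move=> mu _; exact: pairing_continuous.
  apply: (@open_comp _ _ (fun r => p.1.2 * r) [set r | p.2 < r]); last exact: open_gt.
  by move=> r _; exact: mulrl_continuous.
apply/seteqP; split=> mu /=.
  move=> H; split; first by apply: H; rewrite inE eqxx.
  by move=> p' p's; apply: H; rewrite inE p's orbT.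
by move=> [H1 H2] p'; rewrite inE => /orP[/eqP ->//|]; exact: H2.
Qed.

End half_spaces.

(** * Half-spaces determine probabilities on the hull *)

Section borel_generation.
Context {R : realType} {G : lcscGroupType} {d0 : G -> G -> R}.
Context (ad0 : adapted d0) (cd0 : continuous (fun z : G * G => d0 z.1 z.2)).
Context (L : weighted_delone R G).
Local Notation H := (hull_space L).

Definition hull_half_spaces (s : seq (test_function R G * R * R)) : set H :=
  val @^-1` (half_spaces s).

Lemma open_hull_half_spaces s : open (hull_half_spaces s).
Proof.
apply: open_comp; last exact: open_half_spaces.
by move=> x _; exact: hull_space_val_continuous.
Qed.

(** The codes of countably many half-spaces: a separating test function, a side
    and a rational threshold. *)
Definition half_space_code (p : nat -> G) (i : seq (nat * nat) * nat * bool * rat) :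
    test_function R G * R * R :=
  (truncated_cones ad0 cd0 p i.1.1, if i.1.2 then 1 else -1, ratr i.2).

(** On a compact space a family of continuous functions that separates points
    determines the topology: the complement of [U] is covered by finitely many
    half-spaces that avoid [x]. *)
Lemma hull_half_spaces_base : exists p : nat -> G, forall (U : set H) (x : H), open U -> U x ->
  exists s, hull_half_spaces (map (half_space_code p) s) x /\
            hull_half_spaces (map (half_space_code p) s) `<=` U.
Proof.
have [p pd] := exists_dense_sequence ad0 cd0; exists p => U x oU Ux.
have sep (y : H) : exists i : seq (nat * nat) * nat * bool * rat, ~ U y ->
    (half_space_code p i).2 < (half_space_code p i).1.2 * radon_pairing (val x) (half_space_code p i).1.1 /\
    (half_space_code p i).1.2 * radon_pairing (val y) (half_space_code p i).1.1 < (half_space_code p i).2.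
  have [Uy|nUy] := pselect (U y); first by exists (([::], 0%N), true, 0).
  have xy : val x <> val y by move=> /val_inj xy; apply: nUy; rewrite -xy.
  have [t /eqP] := truncated_cones_separate ad0 cd0 pd xy.
  rewrite neq_lt => /orP[] /rat_in_itvoo[r]; rewrite in_itv/= => /andP[r1 r2].
    exists (t, false, (- r)) => _; rewrite /half_space_code/= rmorphN/= !mulN1r.
    by rewrite !ltrN2.
  by exists (t, true, r) => _; rewrite /half_space_code/= !mul1r.
have /choice[i Hi] := sep.
have cK : compact (~` U).
  by apply: subclosed_compact (@hull_space_compact _ _ L _ ad0 cd0) _ => //; exact: open_closedC.
move: cK; rewrite compact_cover.
move=> /(_ _ (~` U) (fun y => (fun z : H => (half_space_code p (i y)).1.2 *
   radon_pairing (val z) (half_space_code p (i y)).1.1) @^-1` [set r | r < (half_space_code p (i y)).2])).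
case=> [y nUy|y nUy|D DU KD].
- apply: open_comp; last exact: open_lt.
  move=> z _; apply: (@continuous_comp _ _ _ (val : H -> radon R G)
    (fun mu => (half_space_code p (i y)).1.2 * radon_pairing mu (half_space_code p (i y)).1.1)).
    exact: hull_space_val_continuous.
  apply: (@continuous_comp _ _ _ (fun mu => radon_pairing mu (half_space_code p (i y)).1.1) (fun r => _ * r)).
    exact: pairing_continuous.
  exact: mulrl_continuous.
- by exists y => //=; exact: (Hi y nUy).2.
exists (map i D); split.
  move=> q /mapP[j /mapP[y yD ->] ->].
  by have /set_mem nUy := DU _ yD; exact: (Hi y nUy).1.
move=> z Hz; apply: contrapT => nUz.
have [y yD /=] := KD z nUz.
have : (half_space_code p (i y)).2 < (half_space_code p (i y)).1.2 *
    radon_pairing (val z) (half_space_code p (i y)).1.1.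
  by apply: Hz; apply: map_f; exact: map_f.
by move=> /lt_trans/[apply]; rewrite ltxx.
Qed.

(** Half-space intersections form a pi-system. It generates the Borel sets
    because countably many of its members form a base. *)
Lemma probability_eq_half_spaces (P Q : probability (borel H) R) :
  (forall s, P (hull_half_spaces s) = Q (hull_half_spaces s)) ->
  forall A : set (borel H), measurable A -> P A = Q A.
Proof.
move=> PQ; have [p base] := hull_half_spaces_base.
move=> A mA; apply: (@measure_unique _ R (borel H) (range hull_half_spaces)
  (fun=> hull_half_spaces [::]) _ _ _ _ P Q _ _ A mA).
- apply/seteqP; split; last first.
    apply: smallest_sub; first exact: sigma_algebra_measurable.
    by move=> _ [s _ <-]; apply: borel_open; exact: open_hull_half_spaces.
  apply: smallest_sub; first exact: smallest_sigma_algebra.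
  move=> U oU.
  have -> : U = \bigcup_(s in [set s | hull_half_spaces (map (half_space_code p) s) `<=` U])
      hull_half_spaces (map (half_space_code p) s).
    apply/seteqP; split=> [x Ux|x [s sU /sU//]].
    by have [s [sx sU]] := base U x oU Ux; exists s.
  apply: (@countable_bigcup_measurable _ (g_sigma_algebraType (range hull_half_spaces))).
    exact: countableP.
  by move=> s _; apply: sub_sigma_algebra; exists (map (half_space_code p) s).
- move=> _ _ [s _ <-] [s' _ <-]; exists (s ++ s') => //.
  apply/seteqP; split=> x /=.
    move=> Hx; split => q qs; apply: Hx; rewrite mem_cat qs ?orbT//.
  by move=> [H1 H2] q; rewrite mem_cat => /orP[/H1|/H2].
- by move=> _; exists [::].
- apply/seteqP; split=> // x _; exists 0%N => //.
- by move=> _ [s _ <-]; exact: PQ.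
- by move=> _; apply: le_lt_trans (probability_le1 P _) (ltry 1); apply: borel_open; exact: open_hull_half_spaces.
Qed.

Lemma half_spaces_ramp_limit (P : probability (borel H) R) s :
  (\int[P]_x half_spaces_ramp s n (val x))%:E @[n --> \oo] --> P (hull_half_spaces s).
Proof.
have mE : measurable (hull_half_spaces s : set (borel H)).
  by apply: borel_open; exact: open_hull_half_spaces.
have cvg1 (x : H) : (half_spaces_ramp s n (val x))%:E @[n --> \oo] -->
    ((\1_(hull_half_spaces s) x)%:E : \bar R).
  apply: cvg_near_cst; rewrite indicE.
  case: (boolP (x \in _)) => [/set_mem xs|/negP nxs].
    by apply: filterS (half_spaces_ramp_near1 xs) => n ->.
  apply: nearW => n; congr EFin; apply/eqP; rewrite eq_le half_spaces_ramp_ge0 andbT.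
  by rewrite leNgt; apply/negP => /half_spaces_ramp_gt0 xs; apply: nxs; exact: mem_set.
have -> : P (hull_half_spaces s) = (\int[P]_(x in [set: borel H]) (\1_(hull_half_spaces s) x)%:E)%E.
  by rewrite integral_indic ?setIT.
rewrite (_ : (fun x => (\1_(hull_half_spaces s) x)%:E) = fun x : borel H =>
    limn (fun n => (half_spaces_ramp s n (val x))%:E)); last first.
  by apply/funext => x; rewrite (cvg_lim _ (cvg1 x)).
have c_ n : continuous (half_spaces_ramp (R := R) (G := G) s n).
  exact: local_function_continuous (half_spaces_ramp_local s n).
under eq_fun => n.
  rewrite fineK; last first.
    apply: (integrable_fin_num _ (hull_function_integrable P (c_ n) (M := 1) _)) => // mu.
    by rewrite ger0_norm ?half_spaces_ramp_ge0 ?half_spaces_ramp_le1.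
  over.
apply: cvg_monotone_convergence => //.
- by move=> n; apply/measurable_EFinP; exact: hull_function_measurable.
- by move=> n x _; rewrite lee_fin half_spaces_ramp_ge0.
- by move=> x _ n n' nn'; rewrite lee_fin half_spaces_ramp_homo.
Qed.

End borel_generation.

(** * Unique ergodicity and minimality *)

Section ergodicity.
Context {R : realType} {G : lcscGroupType} {d d0 : G -> G -> R}.
Context (ad : adapted d) (ad0 : adapted d0) (cd0 : continuous (fun z : G * G => d0 z.1 z.2)).
Context (m : radon R G) (m_haar : haar m) (growth : exact_polynomial_growth m d).
Context (L : weighted_delone R G) (rep : almost_linearly_repetitive d0 L d).
Local Notation H := (hull_space L).

Let m_sigma := radon_sigma_finite m ad0 cd0.

(** The mean of [f] under [P] is at most the upper mean of [f], the mean of [1 - f]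
    under [Q] at most that of [1 - f], and the two upper means add up to at most
    1. *)
Lemma invariant_mean_le (P Q : probability (borel H) R) (f : radon R G -> R) :
  Defs.invariant (hull_act (L := L)) P -> Defs.invariant (hull_act (L := L)) Q ->
  local_function f -> (forall mu, 0 <= f mu) -> (forall mu, f mu <= 1) ->
  \int[P]_x f (val x) <= \int[Q]_x f (val x).
Proof.
move=> invP invQ lf f0 f1; have [C [q [C0 _ Hlim]]] := growth.
pose F := orbit_function L f.
have cF : continuous F := orbit_function_continuous ad0 cd0 lf.
have F0 y : 0 <= F y by exact: f0.
have F1 y : F y <= 1 by exact: f1.
have g0 mu : 0 <= 1 - f mu by rewrite subr_ge0.
have g1 mu : 1 - f mu <= 1 by rewrite gerBl.
have lg := local_function_onem lf.
have cG : continuous (fun y => 1 - F y) := orbit_function_continuous ad0 cd0 lg.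
have main := recurrent_upper_averages ad m_haar m_sigma C0 Hlim cF F0 F1
  (repetitive_recurrent ad ad0 cd0 lf rep).
have hP : \int[P]_x f (val x) <= inf (upper_averages (d := d) m F).
  apply: lb_le_inf; first by case: (upper_averages_has_inf ad m_haar C0 Hlim cF F0 F1).
  by move=> a; exact: (mean_le_upper_average ad ad0 cd0 m_haar invP lf f0 f1).
have hQ : \int[Q]_x (1 - f (val x)) <= inf (upper_averages (d := d) m (fun y => 1 - F y)).
  apply: lb_le_inf.
    have G0 y : 0 <= 1 - F y by rewrite subr_ge0.
    have G1 y : 1 - F y <= 1 by rewrite gerBl.
    by case: (upper_averages_has_inf ad m_haar C0 Hlim cG G0 G1).
  by move=> a; exact: (mean_le_upper_average ad ad0 cd0 m_haar invQ lg g0 g1).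
have : \int[Q]_x (1 - f (val x)) = 1 - \int[Q]_x f (val x).
  have cf := local_function_continuous lf.
  rewrite RintegralB//; last 2 first.
  - apply: (@hull_function_integrable _ _ _ Q (fun=> 1) 1); first exact: cst_continuous.
    by move=> mu; rewrite normr1.
  - by apply: (@hull_function_integrable _ _ _ Q f 1 cf) => mu; rewrite ger0_norm.
  rewrite Rintegral_cst// [X in fine X](_ : _ = 1%E) ?mulr1//.
  exact: (probability_setT Q).
by move: hP hQ main; rewrite /F; lra.
Qed.

Lemma invariant_unique (P Q : probability (borel H) R) :
  Defs.invariant (hull_act (L := L)) P -> Defs.invariant (hull_act (L := L)) Q ->
  forall A : set (borel H), measurable A -> P A = Q A.
Proof.
move=> invP invQ; apply: (probability_eq_half_spaces ad0 cd0) => s.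
rewrite -(cvg_lim _ (@half_spaces_ramp_limit _ _ _ P s))//.
rewrite -(cvg_lim _ (@half_spaces_ramp_limit _ _ _ Q s))//.
congr (lim (_ @ \oo)); apply/funext => n; congr EFin.
have le P' Q' (iP : Defs.invariant (hull_act (L := L)) P') (iQ : Defs.invariant (hull_act (L := L)) Q') :=
  invariant_mean_le iP iQ (half_spaces_ramp_local s n)
  (half_spaces_ramp_ge0 s n) (half_spaces_ramp_le1 s n).
by apply/eqP; rewrite eq_le !le.
Qed.

(** A positive value of a local function recurs, with a definite lower bound, at
    finitely many relative positions; this closed condition passes from the
    orbit to the hull. *)
Lemma positive_on_orbits (f : radon R G -> R) (g0 : G) : local_function f ->
  (forall mu, 0 <= f mu) ->
  0 < f (radon_translate g0 (delta_measure L)) ->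
  forall mu, hull L mu -> exists g, 0 < f (radon_translate g mu).
Proof.
move=> lf f0 pos mu Hmu.
pose F := orbit_function L f; pose x := g0^-1%g.
have Fx : 0 < F x by rewrite /F /orbit_function invgK.
pose e := F x / 4.
have e0 : 0 < e by rewrite divr_gt0.
have [c c0 [rho rho0 Hrec]] := repetitive_recurrent ad ad0 cd0 lf rep e0.
have [V [oV V1] HV] := orbit_function_uniform ad0 cd0 L lf e0.
have [r0 r00 Hr0] := cball_oball ad.
(* Any radius [r >= 1] with [rho < r] will do: only the centre [x] of the
   recurring ball matters. *)
pose r := rho + 1.
have r1 : 1 <= r by rewrite /r; lra.
have [ys Hys] := oball_finite_cover ad (c * r + r0) oV V1.
pose Phi nu := \sum_(p <- [seq (1, y) | y <- ys]) p.1 * f (radon_translate p.2^-1%g nu).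
have PhiE nu : Phi nu = \sum_(y <- ys) f (radon_translate y^-1%g nu).
  by rewrite /Phi big_map; apply: eq_bigr => y _; rewrite mul1r.
have HPhi : e <= Phi mu.
  apply: (hull_closed (L := L) (A := [set nu | e <= Phi nu])) Hmu.
    apply: (@preimage_closed _ _ Phi [set t | e <= t]); last exact: closed_ge.
    move=> nu _; apply: translates_sum_continuous; exact: local_function_continuous.
  move=> h /=; rewrite PhiE.
  have [g [Hg1 Hg2]] := Hrec r x h^-1%g r1.
  have xr : cball_at d (r - rho) x x.
    by exists 1%g; rewrite ?mulg1// /cball/= (adapted_dist0 ad) /r; lra.
  have Fgx := Hg2 _ xr.
  have [z cz zE] : cball_at d (c * r) h^-1%g (g * x)%g.
    apply: Hg1; exists x => //; exists 1%g; rewrite ?mulg1// /cball/= (adapted_dist0 ad); lra.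
  have [y /= yys [w Vw wE]] : (\bigcup_(y in [set` ys]) ltrans y V) z.
    by apply: Hys; apply: Hr0; rewrite addrK.
  have Fy : F (h^-1 * y)%g >= e.
    have := HV (h^-1 * y)%g w Vw; rewrite -mulgA wE zE.
    move: Fgx; rewrite -/F /e !ler_norml => /andP[? ?] /andP[? ?]; lra.
  rewrite (big_rem y)//=; apply: (@le_trans _ _ (F (h^-1 * y)%g)) => //.
  rewrite /F /orbit_function invgM invgK radon_translateM lerDl.
  by apply: sumr_ge0 => *; exact: f0.
apply: contrapT => /forallNP nf; move: HPhi; rewrite PhiE big1; first by rewrite leNgt e0.
move=> y _; apply/eqP; rewrite eq_le f0 andbT leNgt; apply/negP; exact: nf.
Qed.

(** An open subset of the hull meets the orbit of [Lambda], hence contains the set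
    where some ramp is positive; the ramp is then positive somewhere on
    every orbit in the hull. *)
Lemma hull_minimal : minimal (hull_act (L := L)).
Proof.
move=> x U [y Uy] oU.
have [p base] := hull_half_spaces_base ad0 cd0 L.
have pointE g : val (hull_act g (point : H)) = radon_translate g (delta_measure L).
  by rewrite /= delta_translate radon_translate1.
have [g0 Ug0] : exists g, U (hull_act g (point : H)).
  have [_ [[V oV <-] Vy] VU] := open_nbhs_nbhs (conj oU Uy).
  have [_ [[g _ <-] Vg]] := set_valP y _ (open_nbhs_nbhs (conj oV Vy)).
  by exists g; apply: VU; rewrite /= -[set_val _]/(val _) pointE -delta_translate.
have [s [Hs sU]] := base U _ oU Ug0.
set hs := map _ s in Hs sU.
have [n Hn] := filter_ex (half_spaces_ramp_near1 Hs).
have [|g Hg] := @positive_on_orbits (half_spaces_ramp hs n) g0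
  (half_spaces_ramp_local hs n)
  (half_spaces_ramp_ge0 hs n) _ (val x) (set_valP x).
  by rewrite -pointE Hn ltr01.
exists (hull_act g x); split; last by exists g.
by apply: sU; exact: half_spaces_ramp_gt0 Hg.
Qed.

End ergodicity.

(** * Existence of an invariant probability *)

Section invariant_law.
Context {R : realType} {G : lcscGroupType} {d d0 : G -> G -> R}.
Context (ad : adapted d) (ad0 : adapted d0) (cd0 : continuous (fun z : G * G => d0 z.1 z.2)).
Context (m : radon R G) (m_haar : haar m).
Context (C q : R) (C0 : 0 < C)
  (Hlim : (m (cball d t) * ((C * t `^ q)^-1)%:E)%E @[t --> +oo] --> 1%E).
Context (L : weighted_delone R G) (F : set_system nat) (FU : UltraFilter F)
  (F_infty : \oo `<=` F).
Local Notation H := (hull_space L).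
Local Notation v := (oball_measure (d := d) m).
Local Notation D := (oball (d := d)).

Let FF := @ultra_proper _ _ FU.

Let hH : hausdorff_space H := @hull_space_hausdorff _ _ L _ ad0 cd0.

(** The law of [g.Lambda], for [g] uniformly distributed in a large ball, seen as a
    content. Its limits are the candidates for an invariant probability. *)
Let frequency (n : nat) (K : set H) : R :=
  fine (m (D n%:R `&` (fun g => hull_act g point) @^-1` K)) / v n%:R.

Let preimage_borel (K : set H) : compact K ->
  measurable ((fun g : G => hull_act g (point : H)) @^-1` K : set (borel G)).
Proof.
move=> cK; apply: borel_closed; apply: preimage_closed.
  by move=> g _; exact: (hull_orbit_continuous ad0 cd0).
exact: compact_closed.
Qed.

Let mD t : measurable (D t : set (borel G)).
Proof. by apply: borel_open; exact: oball_open. Qed.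

Let fD t (A : set G) : A `<=` D t -> m A \is a fin_num.
Proof.
move=> AD; rewrite ge0_fin_numE//; apply: le_lt_trans (radon_homo m AD) _.
by apply: precompact_finite; exact: oball_precompact.
Qed.

Let v0 t : 0 <= v t. Proof. exact: fine_ge0. Qed.

Let frequency_content n : is_content (frequency n).
Proof.
have vi : 0 <= (v n%:R)^-1 by rewrite invr_ge0.
have mI K : compact K -> measurable (D n%:R `&` (fun g : G => hull_act g (point : H)) @^-1` K : set (borel G)).
  by move=> cK; apply: measurableI => //; exact: preimage_borel.
have fI K : m (D n%:R `&` (fun g : G => hull_act g (point : H)) @^-1` K) \is a fin_num.
  by apply: (@fD n%:R) => x [].
split=> [K _|K K' cK cK' KK'|K K' cK cK'|K K' cK cK' KK'].
- by rewrite divr_ge0// fine_ge0.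
- rewrite ler_wpM2r// fine_le//; apply: radon_homo.
  by move=> x [? ?]; split=> //; exact: KK'.
- rewrite -mulrDl ler_wpM2r// -fineD// fine_le//; first by rewrite fin_numD !fI.
  by rewrite preimage_setU setIUr; apply: measureU2; exact: mI.
- rewrite -mulrDl -fineD//; congr (fine _ * _).
  rewrite preimage_setU setIUr measureU//; [exact: mI|exact: mI|].
  by rewrite setIACA setIid -preimage_setI KK' preimage_set0 setI0.
Qed.

Let frequency_le1 n K : frequency n K <= 1.
Proof.
have := v0 n%:R; rewrite le_eqVlt => /orP[/eqP v0'|vpos].
  by rewrite /frequency -v0' invr0 mulr0.
rewrite ler_pdivrMr// mul1r fine_le//.
- by apply: (@fD n%:R) => x [].
- exact: (@fD n%:R).
- by apply: radon_homo => x [].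
Qed.

Let frequency_bounded K : compact K -> exists c, F [set n | frequency n K <= c].
Proof. by move=> _; exists 1; apply: filterE => n; exact: frequency_le1. Qed.

Let lam K := lim (frequency n K @[n --> F]).

Let lam_cvg K : compact K -> cvg (frequency n K @[n --> F]).
Proof. exact: (ultralimit_content FU frequency_content frequency_bounded).1. Qed.

Let lam_content : is_content lam.
Proof. exact: (ultralimit_content FU frequency_content frequency_bounded).2. Qed.

Let cT : compact [set: H] := @hull_space_compact _ _ L _ ad0 cd0.

Let ratio_cvg t : v (n%:R + t) / v n%:R @[n --> \oo] --> (1 : R).
Proof.
have H1 k : v (n%:R + k) / (C * n%:R `^ q) @[n --> \oo] --> (1 : R).
  have := @oball_growth _ _ _ ad m C q C0 Hlim 1 k ltr01; rewrite powR1.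
  under eq_fun do rewrite mul1r.
  by move=> Hk; apply: (cvg_comp _ _ (@cvgr_idn R) Hk).
have H2 : (v (n%:R + t) / (C * n%:R `^ q)) * (v (n%:R + 0) / (C * n%:R `^ q))^-1
    @[n --> \oo] --> (1 * 1^-1 : R).
  by apply: cvgM; [exact: H1|apply: cvgV; [exact: oner_neq0|exact: H1]].
rewrite invr1 mulr1 in H2; apply: cvg_trans H2; apply: near_eq_cvg.
near=> n; have n0 : (0 : R) < n%:R by rewrite ltr0n; near: n; exact: nbhs_infty_gt.
have w0 : C * n%:R `^ q != 0 by rewrite gt_eqF// mulr_gt0// powR_gt0.
by rewrite addr0 invf_div mulrA mulfVK.
Unshelve. all: by end_near. Qed.

Let v_gt0 : \forall n \near \oo, 0 < v n%:R.
Proof.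
have := oball_measure_gt0 ad C0 Hlim => Hv.
exact: (@cvgr_idn R _ Hv).
Qed.

Let lamT : lam setT = 1.
Proof.
apply: cvg_lim => //; apply: cvg_near_cst; apply: F_infty.
apply: filterS v_gt0 => n vn; rewrite /frequency preimage_setT setIT divff//.
by rewrite gt_eqF.
Qed.

Let compact_preimage_act g K : compact K -> compact (hull_act (L := L) g @^-1` K).
Proof.
move=> cK; apply: subclosed_compact cT _ => //; apply: preimage_closed.
  by move=> x _; exact: hull_act_continuous.
exact: compact_closed.
Qed.

(** By exact growth the masses of the balls of radii [n] and [n + t] are
    asymptotically equal, so that a left translate of a large ball differs from
    the ball by a negligible proportion. *)
Let lam_act_le g K : compact K -> lam (hull_act (L := L) g @^-1` K) <= lam K.
Proof.
move=> cK; have cgK := @compact_preimage_act g K cK.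
have [r0 r00 Hr0] := cball_oball ad.
pose t := d g 1%g + 1 + r0.
have gt : D t g by apply: Hr0; rewrite /t addrK /cball/= ltrDl.
have H1 : F [set n | frequency n (hull_act (L := L) g @^-1` K) <=
    frequency n K + (v (n%:R + t) / v n%:R - 1)].
  apply: F_infty; apply: filterS v_gt0 => n /= vn.
  rewrite -[X in _ + (_ - X)](divff (lt0r_neq0 vn)) -mulrBl -mulrDl ler_pM2r ?invr_gt0//.
  set o := (fun g : G => hull_act g (point : H)).
  have mE := preimage_borel cK.
  have E1 : m (D n%:R `&` o @^-1` (hull_act (L := L) g @^-1` K)) =
            m (ltrans g (D n%:R) `&` o @^-1` K).
    rewrite -(haar_ltrans m_haar g) !ltransE; congr (m _).
    apply/seteqP; split=> x /=; rewrite /o -hull_actM mulVKg//.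
  have sub1 : ltrans g (D n%:R) `<=` D (n%:R + t).
    by move=> _ [x Dx <-]; rewrite addrC; exact: oball_mul.
  have sub2 : ltrans g (D n%:R) `&` o @^-1` K `<=`
      (D n%:R `&` o @^-1` K) `|` (D (n%:R + t) `\` D n%:R).
    move=> x [/sub1 xt xK]; have [xn|nxn] := pselect (D n%:R x); first by left.
    by right.
  have tn : D n%:R `<=` D (n%:R + t).
    by apply: oball_homo; have := Defs.metric_ge0 (adapted_metric ad) g 1%g; move: r00; rewrite /t; lra.
  have f1 : m (D n%:R `&` o @^-1` K) \is a fin_num by apply: (@fD n%:R) => x [].
  have f2 : m (D (n%:R + t) `\` D n%:R) \is a fin_num by apply: (@fD (n%:R + t)) => x [].
  have f3 : m (ltrans g (D n%:R) `&` o @^-1` K) \is a fin_num.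
    by apply: (@fD (n%:R + t)) => x [/sub1].
  have vE : v (n%:R + t) - v n%:R = fine (m (D (n%:R + t) `\` D n%:R)).
    rewrite measureD//; last by rewrite -ge0_fin_numE//; exact: (@fD (n%:R + t)).
    rewrite (setIidr tn) fineB//; first exact: (@fD (n%:R + t)).
    exact: (@fD n%:R).
  rewrite E1 vE -fineD// fine_le//; first by rewrite fin_numD f1.
  apply: le_trans (radon_homo m sub2) _; apply: measureU2; first exact: measurableI.
  exact: measurableD.
have H2 : frequency n K + (v (n%:R + t) / v n%:R - 1) @[n --> F] --> lam K + (1 - 1).
  apply: cvgD; first exact: lam_cvg.
  by apply: cvgB; [apply: cvg_trans (@ratio_cvg t); exact: cvg_app|exact: cvg_cst].
rewrite subrr addr0 in H2.
rewrite -(cvg_lim _ H2)//; apply: (ultra_le_lim FU) => //; first exact: lam_cvg.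
exact: cvgP H2.
Qed.

Let inner_act_le g U : (inner_content lam (hull_act (L := L) g @^-1` U) <= inner_content lam U)%E.
Proof.
apply: inner_content_le => K cK KU.
have cK' := @compact_preimage_act g^-1%g K cK.
apply: (@le_trans _ _ (lam (hull_act (L := L) g^-1%g @^-1` K))%:E).
  rewrite lee_fin; apply: le_trans (lam_act_le g cK').
  apply: content_le => //; first exact: compact_preimage_act.
  by move=> x Kx /=; rewrite -hull_actM mulVg hull_act1.
apply: inner_content_ge => // x /KU/=.
by rewrite -hull_actM mulgV hull_act1.
Qed.

Let outer_act_le g A : (outer_content lam (hull_act (L := L) g @^-1` A) <= outer_content lam A)%E.
Proof.
apply: le_ereal_inf_tmp => _ [U [oU AU] <-].
apply: le_trans (inner_act_le g U); apply: outer_content_open.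
  by apply: open_comp oU => x _; exact: hull_act_continuous.
by move=> x /AU.
Qed.

(** The hull is compact, so no mass escapes in the limit. *)
Definition invariant_law : set (borel H) -> \bar R := content_measure lam_content hH.

HB.instance Definition _ := Measure.on invariant_law.

Let invariant_law_setT : invariant_law setT = 1%E.
Proof.
rewrite /invariant_law /content_measure outer_contentE; last exact: openT.
apply/eqP; rewrite eq_le; apply/andP; split.
  apply: inner_content_le => K cK _; rewrite lee_fin -lamT.
  exact: content_le.
by rewrite -lamT; exact: inner_content_ge.
Qed.

HB.instance Definition _ := Measure_isProbability.Build _ _ _ invariant_law invariant_law_setT.

Lemma invariant_law_invariant :
  Defs.invariant (hull_act (L := L)) (invariant_law : probability (borel H) R).
Proof.
move=> g A _; apply/eqP; rewrite eq_le outer_act_le/=.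
have := outer_act_le g^-1%g (hull_act (L := L) g @^-1` A).
congr (_ <= _)%E; congr (outer_content lam _).
by apply/seteqP; split=> x /=; rewrite -hull_actM mulgV hull_act1.
Qed.

End invariant_law.

Unset Implicit Arguments.
Set Strict Implicit.

Theorem theorem1p2 (R : realType) (G : lcscGroupType) (m : radon R G)
    (d d0 : G -> G -> R) (m_haar : haar m)
    (d_adapted : adapted d) (d_growth : exact_polynomial_growth m d)
    (d0_adapted : adapted d0)
    (d0_continuous : continuous (fun z : G * G => d0 z.1 z.2))
    (L : weighted_delone R G)
    (L_repetitive : almost_linearly_repetitive d0 L d \/
                    linearly_repetitive L d) :
  minimal (@hull_act R G L) /\ uniquely_ergodic R (@hull_act R G L).
Proof.
have rep : almost_linearly_repetitive d0 L d.
  by case: L_repetitive => // lr; exact: (@linearly_repetitive_almost _ _ d d0 d_adapted L lr).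
split; first exact: (hull_minimal d_adapted d0_adapted d0_continuous rep).
have [C [q [C0 _ Hlim]]] := d_growth.
have [F [FU F_infty]] := @ultraFilterLemma _ \oo eventually_filter.
have inv := @invariant_law_invariant _ _ _ _ d_adapted d0_adapted d0_continuous
  _ m_haar _ _ C0 Hlim L _ FU F_infty.
eexists; first exact: inv.
move=> Q invQ A mA.
exact: (invariant_unique d_adapted d0_adapted d0_continuous m_haar d_growth rep invQ inv).
Qed.
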